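(* Let $k\in\{1,2,3,\dots\}$, $\alpha\in(0,2]$, and let $c_{-k}$ be a real number with $c_{-k}\in(-L,L)$, where $L=\min\{M,N\}$, $$N=\frac{\alpha}{2\left(\dfrac{(k-\frac{\alpha}{2})\,\Gamma(k+1)\,\Gamma(2+\frac{\alpha}{2})}{\Gamma(k+1+\frac{\alpha}{2})}+k\right)},\qquad M=\frac{\Gamma(k+1+\frac{\alpha}{2})}{k^{2}\,\Gamma(k+1)\,\Gamma(2+\frac{\alpha}{2})}.$$ Let $$u^{*}(e^{i\theta})=F_{1}(1)e^{i\theta}+c_{-k}F_{k}(1)e^{-ik\theta}.$$ Then $u^{*}$ is a homeomorphism of the unit circle $\mathbb{T}$ onto a convex Jordan curve $\gamma$ which is the boundary of a bounded convex domain $\Omega\subset\mathbb{C}$. Furthermore, the function $$u(z)=\frac{1}{2\pi}\int_{0}^{2\pi}K_{\alpha}(ze^{-i\tau})\,u^{*}(e^{i\tau})\,d\tau,\qquad z\in\mathbb{D},$$ defines a univalent real kernel $\alpha$-harmonic mapping of $\mathbb{D}$ onto $\Omega$.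
   Context: $\mathbb{D}$ is the open unit disk and $\mathbb{T}$ the unit circle in $\mathbb{C}$; $\Gamma$ is the Gamma function. For $j=1,2,\dots$, $F_j(1)=\lim_{t\to1^-}F\left(-\tfrac{\alpha}{2},j-\tfrac{\alpha}{2};j+1;t\right)=\frac{\Gamma(j+1)\Gamma(1+\alpha)}{\Gamma(j+1+\frac{\alpha}{2})\Gamma(1+\frac{\alpha}{2})}$, where $F(a,b;c;x)=\sum_{n=0}^{\infty}\frac{(a)_n(b)_n}{(c)_n}\frac{x^n}{n!}$ is the Gauss hypergeometric function. The kernel is $$K_{\alpha}(z)=c_{\alpha}\frac{(1-|z|^{2})^{\alpha+1}}{|1-z|^{\alpha+2}},\qquad c_{\alpha}=\frac{\Gamma^{2}(\frac{\alpha}{2}+1)}{\Gamma(1+\alpha)}.$$ A real kernel $\alpha$-harmonic mapping ($\alpha>-1$) is a function $u\in\mathcal{C}^2(\mathbb{D})$ given by such a Poisson type integral of its boundary data; equivalently, it is a solution in $\mathbb{D}$ of $T_\alpha(u)=0$, where $$T_{\alpha}=-\frac{\alpha^{2}}{4}(1-|z|^{2})^{-\alpha-1}+\frac{\alpha}{2}(1-|z|^{2})^{-\alpha-1}\left(z\frac{\partial}{\partial z}+\bar{z}\frac{\partial}{\partial\bar{z}}\right)+(1-|z|^{2})^{-\alpha}\cdot 4\frac{\partial^2}{\partial z\,\partial\bar z}.$$ Univalent means injective.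
   Formalization: The operator T_α is taken with second-order term (1-|z|²)^{-α} ∂²/∂z∂z̄, without the printed factor 4; with that factor the claim fails, e.g. for α=1, k=1, c_{-1}=0, where u(z)=zF(-1/2,1/2;2;|z|²). *)

(* Defs.v *)
From Stdlib Require Import Reals Factorial.
From Coquelicot Require Import Coquelicot.

Open Scope R_scope.

(* Euler's integral; only used at x > 0, where it converges. *)
Definition Gamma (x : R) : R :=
  RInt_gen (fun t : R => Rpower t (x - 1) * exp (- t))
           (at_right 0) (Rbar_locally p_infty).

Fixpoint pochhammer (a : R) (n : nat) : R :=
  match n with
  | O => 1
  | S m => pochhammer a m * (a + INR m)
  end.

Definition hypergeometric (a b c x : R) : R :=
  PSeries (fun n => pochhammer a n * pochhammer b n
                      / (pochhammer c n * INR (fact n))) x.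

Definition F_fun (alpha : R) (j : nat) (t : R) : R :=
  hypergeometric (- (alpha / 2)) (INR j - alpha / 2) (INR j + 1) t.

(* F_j(1) is the limit of F_j(t) as t -> 1 from the left, not the value of the
   power series at 1. *)
Definition F_at_1 (alpha : R) (j : nat) : R :=
  iota (fun l : R => filterlim (F_fun alpha j) (at_left 1) (locally l)).

Definition N_bound (alpha : R) (k : nat) : R :=
  alpha /
  (2 * ((INR k - alpha / 2) * Gamma (INR k + 1) * Gamma (2 + alpha / 2)
          / Gamma (INR k + 1 + alpha / 2)
        + INR k)).

Definition M_bound (alpha : R) (k : nat) : R :=
  Gamma (INR k + 1 + alpha / 2)
  / (INR k ^ 2 * Gamma (INR k + 1) * Gamma (2 + alpha / 2)).

Definition L_bound (alpha : R) (k : nat) : R :=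
  Rmin (M_bound alpha k) (N_bound alpha k).

Definition unit_disk (z : C) : Prop := Cmod z < 1.
Definition unit_circle (z : C) : Prop := Cmod z = 1.

(* e^{i theta} *)
Definition cis (theta : R) : C := (cos theta, sin theta).

Definition homeomorphism (A B : C -> Prop) (f : C -> C) : Prop :=
  continuous_on A f /\ (forall z, A z -> B (f z)) /\
  exists g : C -> C,
    continuous_on B g /\ (forall w, B w -> A (g w)) /\
    (forall z, A z -> g (f z) = z) /\ (forall w, B w -> f (g w) = w).

Definition boundary (S : C -> Prop) (z : C) : Prop :=
  ~ locally z S /\ ~ locally z (fun w => ~ S w).

Definition convex (S : C -> Prop) : Prop :=
  forall (z w : C) (t : R), S z -> S w -> 0 <= t <= 1 ->
    S (RtoC (1 - t) * z + RtoC t * w)%C.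

Definition bounded_set (S : C -> Prop) : Prop :=
  exists r : R, forall z, S z -> Cmod z <= r.

(* Connectedness, part of the notion of a domain, is implied by convexity. *)
Definition bounded_convex_domain (Omega : C -> Prop) : Prop :=
  open Omega /\ (exists z, Omega z) /\ convex Omega /\ bounded_set Omega.

Definition jordan_curve (gamma : C -> Prop) : Prop :=
  exists f : C -> C, homeomorphism unit_circle gamma f.

Definition convex_jordan_curve (gamma : C -> Prop) : Prop :=
  jordan_curve gamma /\
  exists Omega : C -> Prop, bounded_convex_domain Omega /\
    forall z, gamma z <-> boundary Omega z.

Definition injective_on (A : C -> Prop) (f : C -> C) : Prop :=
  forall z w, A z -> A w -> f z = f w -> z = w.

Definition maps_onto (A B : C -> Prop) (f : C -> C) : Prop :=
  forall w, B w <-> exists z, A z /\ f z = w.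

Definition Dx (f : C -> R) (z : C) : R := Derive (fun t => f (t, Im z)) (Re z).
Definition Dy (f : C -> R) (z : C) : R := Derive (fun t => f (Re z, t)) (Im z).

Definition C1_on (A : C -> Prop) (f : C -> R) : Prop :=
  forall z, A z ->
    ex_derive (fun t => f (t, Im z)) (Re z) /\
    ex_derive (fun t => f (Re z, t)) (Im z) /\
    continuous (Dx f) z /\ continuous (Dy f) z.

Definition C2_on (A : C -> Prop) (f : C -> R) : Prop :=
  C1_on A f /\ C1_on A (Dx f) /\ C1_on A (Dy f).

Definition C2_mapping_on (A : C -> Prop) (u : C -> C) : Prop :=
  C2_on A (fun z => Re (u z)) /\ C2_on A (fun z => Im (u z)).

Definition CDx (u : C -> C) (z : C) : C :=
  (Dx (fun w => Re (u w)) z, Dx (fun w => Im (u w)) z).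
Definition CDy (u : C -> C) (z : C) : C :=
  (Dy (fun w => Re (u w)) z, Dy (fun w => Im (u w)) z).

(* The Wirtinger derivatives d/dz and d/d(conjugate of z). *)
Definition dz (u : C -> C) (z : C) : C :=
  (RtoC (1 / 2) * (CDx u z - Ci * CDy u z))%C.
Definition dzbar (u : C -> C) (z : C) : C :=
  (RtoC (1 / 2) * (CDx u z + Ci * CDy u z))%C.

(* The second-order term is (1-|z|^2)^{-alpha} u_{z zbar}, i.e. one quarter of
   the Laplacian.  This is the normalization for which T_alpha annihilates the
   integrals of [poisson_kernel] below: for alpha = 2 the integral of a constant
   is a multiple of 1 + |z|^2, and
     - (1 + |z|^2) + 2 |z|^2 + kappa (1 - |z|^2) = (kappa - 1) (1 - |z|^2),
   so that the coefficient kappa of (1-|z|^2)^{-alpha} u_{z zbar} must be 1. *)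
Definition T_op (alpha : R) (u : C -> C) (z : C) : C :=
  let rho := 1 - Cmod z ^ 2 in
  (RtoC (- (alpha ^ 2 / 4) * Rpower rho (- alpha - 1)) * u z
   + RtoC (alpha / 2 * Rpower rho (- alpha - 1))
       * (z * dz u z + Cconj z * dzbar u z)
   + RtoC (Rpower rho (- alpha)) * dz (dzbar u) z)%C.

Definition real_kernel_harmonic (alpha : R) (u : C -> C) : Prop :=
  C2_mapping_on unit_disk u /\
  forall z, unit_disk z -> T_op alpha u z = RtoC 0.

Definition poisson_kernel (alpha : R) (z : C) : R :=
  Gamma (alpha / 2 + 1) ^ 2 / Gamma (1 + alpha)
  * (Rpower (1 - Cmod z ^ 2) (alpha + 1)
     / Rpower (Cmod (RtoC 1 - z)%C) (alpha + 2)).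

(* f is only evaluated on the unit circle. *)
Definition poisson_integral (alpha : R) (f : C -> C) (z : C) : C :=
  (RtoC (1 / (2 * PI))
   * RInt (V := C_R_CompleteNormedModule)
       (fun tau : R =>
          RtoC (poisson_kernel alpha (z * cis (- tau))) * f (cis tau))
       0 (2 * PI))%C.

(* Main.v *)
Require Import Defs.
From Stdlib Require Import Reals ZArith Lra Lia Psatz Classical ClassicalEpsilon.
From Coquelicot Require Import Coquelicot.

Open Scope R_scope.

(** Put a = alpha/2. Expanding |1 - z|^(-2(a+1)) = |(1 - z)^(-(a+1))|^2 and using Euler's
    transformation and Gauss's value of F_j(1), one finds
    u(z) = F_1(|z|^2) z + c F_k(|z|^2) conj(z)^k, which extends continuously by ustar to
    the closed disk. Each F_j decreases on [0,1] with Lipschitz constant (j-a)/2 F_j(1),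
    and with |c| < N this makes u a perturbation of the identity by a contraction; hence
    u is injective. With |c| < M the boundary curve is strictly convex, and Omega is the
    intersection of the open half-planes bounded by its tangents. A point w of Omega is
    attained: a fixed point z of the contraction proj(w - (u(z) - z)) of the closed disk
    satisfies u(z) = w unless |z| = 1 and w = u(z) + lambda z with lambda >= 0, but such a w
    is outside Omega. Conversely u maps the open disk into Omega, because on a segment from
    0 it cannot meet the boundary curve, whose points are already values on the circle. *)

(** * The Gamma function *)

(** No derivative of [u] is estimated. In polar coordinates both parts of [u(z) - z] have the form
    [(r, theta) -> (p(r), n theta)], and by the law of cosines the Lipschitz constant of such a map
    is controlled by [n] and [p], up to and including the circle. The part from [F_1] contributes
    [1 - a F_1(1)], the part from [F_k] contributes [|c| k F_k(1) (3 - a)/2]; so the perturbation is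
    a contraction once [|c| k F_k(1) (3 - a)/2 < a F_1(1)].

    The Gamma quotient in both [M] and [N] is [F_k(1) / F_1(1)]. Hence [|c| < M] reads
    [k^2 |c| F_k(1) < F_1(1)], and [|c| < N] reads [|c| ((k - a) F_k(1) + k F_1(1)) < a F_1(1)],
    which implies the contraction condition because [F_k(1) <= F_1(1)].

    Gauss's value serves this quotient and also the cancellation of [c_alpha]. It comes from an
    Abelian comparison of two power series that both diverge at 1, and the coefficient quotient
    there is governed by the log-convexity of Gamma. Complex powers with real exponents are replaced
    by pairs of real series satisfying a first order differential system. *)

Lemma continuous_of_is_derive (f : R -> R) (x l : R) (h : is_derive f x l) :
  continuous f x.
Proof. apply (ex_derive_continuous (V := R_NormedModule)). now exists l. Qed.

Lemma is_derive_Rpower (y t : R) (ht : 0 < t) :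
  is_derive (fun s => Rpower s y) t (y * Rpower t (y - 1)).
Proof.
  apply is_derive_Reals. now apply derivable_pt_lim_power.
Qed.

Lemma is_derive_exp_opp (t : R) : is_derive (fun s => exp (- s)) t (- exp (- t)).
Proof. auto_derive; [easy | ring]. Qed.

Lemma continuous_Rpower (y t : R) (ht : 0 < t) :
  continuous (fun s => Rpower s y) t.
Proof. eapply continuous_of_is_derive. now apply is_derive_Rpower. Qed.

Lemma at_right_0_intro (P : R -> Prop) (d : R) (hd : 0 < d)
  (h : forall t, 0 < t < d -> P t) : at_right 0 P.
Proof.
  exists (mkposreal d hd). intros t ht ht0. apply h.
  apply Rabs_def2 in ht. unfold minus, plus, opp in ht; simpl in ht. lra.
Qed.

(** The endpoints of a generalized integral come without an order, hence [Rmin] and [Rmax]; both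
    being positive keeps the whole interval inside the half-line where the integrands are smooth. *)
Lemma pos_filter_prod (P : R -> Prop) (hP : forall t, 0 < t -> P t) :
  filter_prod (at_right 0) (Rbar_locally p_infty)
    (fun ab : R * R =>
       forall x, Rmin (fst ab) (snd ab) <= x <= Rmax (fst ab) (snd ab) -> P x).
Proof.
  exists (fun x => 0 < x) (fun x => 0 < x).
  - exists (mkposreal 1 Rlt_0_1). intros y _ hy. exact hy.
  - exists 0. intros y hy. exact hy.
  - intros x y hx hy z [hz _]. apply hP.
    apply Rlt_le_trans with (2 := hz). now apply Rmin_glb_lt.
Qed.

Lemma is_RInt_gen_antiderivative (F f : R -> R) (la lb : R)
  (hF : forall t, 0 < t -> is_derive F t (f t))
  (hf : forall t, 0 < t -> continuous f t)
  (ha : filterlim F (at_right 0) (locally la))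
  (hb : filterlim F (Rbar_locally p_infty) (locally lb)) :
  is_RInt_gen f (at_right 0) (Rbar_locally p_infty) (lb - la).
Proof.
  apply is_RInt_gen_ext with (Derive F).
  - generalize (pos_filter_prod (fun t => Derive F t = f t)
      (fun t ht => is_derive_unique _ _ _ (hF t ht))).
    apply filter_imp. intros ab h x hx. apply h. lra.
  - apply is_RInt_gen_Derive; try assumption.
    + apply (pos_filter_prod (fun t => ex_derive F t)).
      intros t ht. exists (f t). now apply hF.
    + apply (pos_filter_prod (fun t => continuous (Derive F) t)).
      intros t ht. apply continuous_ext_loc with f.
      * exists (mkposreal t ht). intros y hy.
        symmetry. apply is_derive_unique, hF.
        apply Rabs_def2 in hy. unfold minus, plus, opp in hy; simpl in hy. lra.
      * now apply hf.
Qed.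

Lemma ex_RInt_pos (f : R -> R) (hf : forall t, 0 < t -> continuous f t)
  (a b : R) (ha : 0 < a) (hb : 0 < b) : ex_RInt f a b.
Proof.
  apply (ex_RInt_continuous (V := R_CompleteNormedModule)).
  intros z [hz _]. apply hf.
  apply Rlt_le_trans with (2 := hz). now apply Rmin_glb_lt.
Qed.

Lemma RInt_mono_interval (f : R -> R)
  (hf : forall t, 0 < t -> continuous f t) (hpos : forall t, 0 < t -> 0 <= f t)
  (a a' b b' : R) (ha : 0 < a) (haa : a <= a') (hab : a' <= b') (hbb : b' <= b) :
  RInt f a' b' <= RInt f a b.
Proof.
  assert (e : forall x y, 0 < x -> 0 < y -> ex_RInt f x y)
    by (intros; now apply ex_RInt_pos).
  rewrite <- (RInt_Chasles f a a' b) by (apply e; lra).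
  rewrite <- (RInt_Chasles f a' b' b) by (apply e; lra).
  assert (0 <= RInt f a a')
    by (apply RInt_ge_0; [lra | apply e; lra | intros; apply hpos; lra]).
  assert (0 <= RInt f b' b)
    by (apply RInt_ge_0; [lra | apply e; lra | intros; apply hpos; lra]).
  unfold plus; simpl. lra.
Qed.

(** For a nonnegative integrand the integral grows with the interval, so the supremum of the
    integrals over compact intervals is the limit. *)
Lemma ex_RInt_gen_bounded (f : R -> R) (M : R)
  (hf : forall t, 0 < t -> continuous f t) (hpos : forall t, 0 < t -> 0 <= f t)
  (hM : forall a b, 0 < a <= b -> RInt f a b <= M) :
  ex_RInt_gen f (at_right 0) (Rbar_locally p_infty).
Proof.
  destruct (completeness
    (fun v => exists a b, 0 < a <= b /\ v = RInt f a b)) as [l [hub hl]].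
  - exists M. intros v (a & b & hab & ->). now apply hM.
  - exists (RInt f 1 1), 1, 1. split; [lra | easy].
  - exists l. intros P [eps hP].
    assert (hc : exists a b, 0 < a <= b /\ l - eps < RInt f a b).
    { apply NNPP. intros hn. assert (l <= l - eps).
      { apply hl. intros v (a & b & hab & ->).
        apply Rnot_lt_le. intros hlt. apply hn. now exists a, b. }
      destruct eps as [eps heps]; simpl in *; lra. }
    destruct hc as (a & b & hab & hlt).
    exists (fun x => 0 < x < a) (fun y => b < y).
    + now apply at_right_0_intro with a.
    + exists b. easy.
    + intros x y hx hy. exists (RInt f x y). split; simpl.
      * apply (RInt_correct (V := R_CompleteNormedModule)).
        apply ex_RInt_pos; try assumption; lra.
      * apply hP. assert (RInt f a b <= RInt f x y)
          by (apply RInt_mono_interval; try assumption; lra).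
        assert (RInt f x y <= l)
          by (apply hub; exists x, y; split; [lra | easy]).
        apply Rabs_def1; unfold minus, plus, opp; simpl; lra.
Qed.

Definition Gamma_integrand (x t : R) : R := Rpower t (x - 1) * exp (- t).

Lemma continuous_Gamma_integrand (x t : R) (ht : 0 < t) :
  continuous (Gamma_integrand x) t.
Proof.
  apply (continuous_mult (fun s => Rpower s (x - 1)) (fun s => exp (- s))).
  - now apply continuous_Rpower.
  - eapply continuous_of_is_derive. apply is_derive_exp_opp.
Qed.

Lemma Gamma_integrand_pos (x t : R) : 0 < Gamma_integrand x t.
Proof. apply Rmult_lt_0_compat; apply exp_pos. Qed.

(** The tangent line of the concave function [ln] at [x], obtained from [1 + s <= exp s] at
    [s = ln (y / x)]. *)
Lemma ln_le_linear (x y : R) (hx : 0 < x) (hy : 0 < y) :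
  ln y <= ln x + y / x - 1.
Proof.
  assert (h : 0 < y / x) by now apply Rdiv_lt_0_compat.
  assert (ln (y / x) <= y / x - 1).
  { assert (h1 := exp_ineq1_le (ln (y / x))). rewrite exp_ln in h1 by easy. lra. }
  unfold Rdiv in H at 1. rewrite ln_mult, ln_Rinv in H; try easy; try lra.
  now apply Rinv_0_lt_compat.
Qed.

Lemma exp_dominates_Rpower (x : R) (hx : 0 < x) :
  exists C, 0 < C /\ forall t, 0 < t -> Rpower t x * exp (- t) <= C * exp (- (t / 2)).
Proof.
  (* The constant is [(2 x)^x]: the tangent of [ln] at [2 x] has slope [1 / (2 x)], so [x ln t]
     costs exactly [t / 2], half of the available exponential decay. *)
  exists (exp (x * ln (2 * x))). split; [apply exp_pos |].
  intros t ht. unfold Rpower. rewrite <- !exp_plus.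
  assert (h := ln_le_linear (2 * x) t ltac:(lra) ht).
  apply Rmult_le_compat_l with (r := x) in h; [| lra].
  replace (x * (ln (2 * x) + t / (2 * x) - 1)) with (x * ln (2 * x) + t / 2 - x) in h
    by (field; lra).
  assert (hle : x * ln t + - t <= x * ln (2 * x) + - (t / 2)) by lra.
  destruct hle as [H | H].
  - now apply Rlt_le, exp_increasing.
  - right. now rewrite H.
Qed.

(* With [t^x e^(-t) <= C e^(-t/2)], the integrand is at most the derivative of the
   bounded function [(t^x e^(-t) - 2 C e^(-t/2)) / x]. *)
Lemma ex_RInt_gen_Gamma (x : R) (hx : 0 < x) :
  ex_RInt_gen (Gamma_integrand x) (at_right 0) (Rbar_locally p_infty).
Proof.
  destruct (exp_dominates_Rpower x hx) as (C & hC & hle).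
  assert (hc := continuous_Gamma_integrand x).
  apply ex_RInt_gen_bounded with (M := / x * (3 * C)); [exact hc | |].
  - intros; apply Rlt_le, Gamma_integrand_pos.
  - intros a b hab.
    set (H := fun t => / x * (Rpower t x * exp (- t) + - (2 * C) * exp (- (t / 2)))).
    set (h := fun t => / x * ((x * Rpower t (x - 1) * exp (- t)
                + Rpower t x * - exp (- t)) + C * exp (- (t / 2)))).
    assert (dH : forall t, 0 < t -> is_derive H t (h t)).
    { intros t ht. apply is_derive_scal.
      apply (is_derive_plus (fun t => Rpower t x * exp (- t))
               (fun t => - (2 * C) * exp (- (t / 2)))).
      - apply (is_derive_mult (fun t => Rpower t x) (fun t => exp (- t)));
          [now apply is_derive_Rpower | apply is_derive_exp_opp | exact Rmult_comm].
      - auto_derive; [easy |]. change (t * / 2) with (t / 2). field. }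
    assert (ch : forall t, 0 < t -> continuous h t).
    { intros t ht. apply (ex_derive_continuous (V := R_NormedModule)).
      unfold h, Rpower. auto_derive. lra. }
    assert (hI : is_RInt h a b (H b - H a)).
    { apply (is_RInt_derive H h); intros t; rewrite Rmin_left, Rmax_right by lra;
        intros; [apply dH | apply ch]; lra. }
    assert (hi : 0 < / x) by now apply Rinv_0_lt_compat.
    apply Rle_trans with (H b - H a).
    + rewrite <- (is_RInt_unique _ _ _ _ hI). apply RInt_le; [lra | | |].
      * apply ex_RInt_pos; try lra. exact hc.
      * eexists; exact hI.
      * intros t ht. unfold h. assert (ht' := hle t ltac:(lra)).
        replace (Gamma_integrand x t) with (/ x * (x * Rpower t (x - 1) * exp (- t)))
          by (unfold Gamma_integrand; field; lra).
        apply Rmult_le_compat_l; lra.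
    + unfold H. rewrite <- Rmult_minus_distr_l.
      assert (he : forall t, 0 < t -> 0 < exp (- (t / 2)) <= 1).
      { intros t ht. split; [apply exp_pos |].
        rewrite <- exp_0. apply Rlt_le, exp_increasing. lra. }
      assert (ha' := he a ltac:(lra)). assert (hb' := he b ltac:(lra)).
      assert (hb := hle b ltac:(lra)).
      assert (0 < Rpower a x * exp (- a)) by (apply Rmult_lt_0_compat; apply exp_pos).
      apply Rmult_le_compat_l; nra.
Qed.

Lemma is_RInt_gen_Gamma (x : R) (hx : 0 < x) :
  is_RInt_gen (Gamma_integrand x) (at_right 0) (Rbar_locally p_infty) (Gamma x).
Proof.
  apply (RInt_gen_correct (V := R_CompleteNormedModule)); try apply _.
  now apply ex_RInt_gen_Gamma.
Qed.

Lemma is_RInt_gen_pos_le (f g : R -> R) (lf lg : R)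
  (hfg : forall t, 0 < t -> 0 <= f t <= g t)
  (hf : is_RInt_gen f (at_right 0) (Rbar_locally p_infty) lf)
  (hg : is_RInt_gen g (at_right 0) (Rbar_locally p_infty) lg) : lf <= lg.
Proof.
  apply Rle_trans with (norm lf); [apply Rle_abs |].
  apply (RInt_gen_norm (V := R_CompleteNormedModule)
           (Fa := at_right 0) (Fb := Rbar_locally p_infty) f g); try assumption.
  - exists (fun x => 0 < x < 1) (fun y => 1 < y).
    + apply at_right_0_intro with 1; [lra | easy].
    + exists 1. easy.
    + intros; simpl; lra.
  - generalize (pos_filter_prod _ hfg). apply filter_imp.
    intros ab h x hx. assert (h1 : 0 <= f x <= g x).
    { apply h. split; [apply Rle_trans with (fst ab); [apply Rmin_l | lra] |].
      apply Rle_trans with (snd ab); [lra | apply Rmax_r]. }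
    change (Rabs (f x) <= g x). rewrite Rabs_pos_eq; lra.
Qed.

Lemma Rpower_small (x eps : R) (hx : 0 < x) (heps : 0 < eps) :
  exists d, 0 < d /\ forall t, 0 < t < d -> Rpower t x < eps.
Proof.
  exists (Rpower eps (/ x)). split; [apply exp_pos |]. intros t ht.
  replace eps with (Rpower (Rpower eps (/ x)) x).
  - apply Rlt_Rpower_l; lra.
  - rewrite Rpower_mult, Rinv_l by lra. now apply Rpower_1.
Qed.

Lemma Rpower_exp_lim_0 (x : R) (hx : 0 < x) :
  filterlim (fun t => Rpower t x * exp (- t)) (at_right 0) (locally 0).
Proof.
  intros P [eps hP]. destruct (Rpower_small x eps hx (cond_pos eps)) as (d & hd & h).
  apply at_right_0_intro with d; [exact hd |]. intros t ht. apply hP.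
  specialize (h t ht).
  assert (h0 : 0 < Rpower t x) by apply exp_pos.
  assert (h1 : 0 < exp (- t)) by apply exp_pos.
  assert (h2 : exp (- t) <= 1) by (rewrite <- exp_0; apply Rlt_le, exp_increasing; lra).
  change (Rabs (Rpower t x * exp (- t) - 0) < eps).
  rewrite Rminus_0_r, Rabs_pos_eq by nra. nra.
Qed.

Lemma Rpower_exp_lim_infty (x : R) (hx : 0 < x) :
  filterlim (fun t => Rpower t x * exp (- t)) (Rbar_locally p_infty) (locally 0).
Proof.
  destruct (exp_dominates_Rpower x hx) as (C & hC & hle).
  intros P [eps hP]. assert (heps := cond_pos eps).
  assert (hCe : 0 < 2 * C / eps) by (apply Rdiv_lt_0_compat; lra).
  exists (2 * C / eps). intros t ht. apply hP.
  assert (h := hle t ltac:(lra)).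
  assert (h0 : 0 < Rpower t x * exp (- t)) by (apply Rmult_lt_0_compat; apply exp_pos).
  (* From [1 + s <= exp s]: the exponential is at most [2 / t], which explains the threshold
     [2 * C / eps]. *)
  assert (h1 : exp (- (t / 2)) * (t / 2) < 1).
  { assert (h2 := exp_ineq1_le (t / 2)). assert (h3 := exp_pos (- (t / 2))).
    rewrite <- exp_0. replace 0 with (- (t / 2) + t / 2) by ring.
    rewrite exp_plus. apply Rmult_lt_compat_l; lra. }
  assert (h4 : C < eps * (t / 2)).
  { apply Rmult_lt_compat_l with (r := eps / 2) in ht; [| lra].
    replace (eps / 2 * (2 * C / eps)) with C in ht by (field; lra). lra. }
  change (Rabs (Rpower t x * exp (- t) - 0) < eps).
  rewrite Rminus_0_r, Rabs_pos_eq by lra.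
  apply Rle_lt_trans with (1 := h). assert (h5 := exp_pos (- (t / 2))).
  apply Rmult_lt_compat_r with (r := exp (- (t / 2))) in h4; [| easy]. nra.
Qed.

(** Integration by parts: [t^x e^(-t)] vanishes at both ends, so the integral of its derivative
    [x t^(x-1) e^(-t) - t^x e^(-t)] is 0. *)
Lemma Gamma_succ (x : R) (hx : 0 < x) : Gamma (x + 1) = x * Gamma x.
Proof.
  assert (h : is_RInt_gen
    (fun t => minus (scal x (Gamma_integrand x t)) (Gamma_integrand (x + 1) t))
    (at_right 0) (Rbar_locally p_infty) (0 - 0)).
  { apply (is_RInt_gen_antiderivative (fun t => Rpower t x * exp (- t))).
    - intros t ht.
      replace (minus (scal x (Gamma_integrand x t)) (Gamma_integrand (x + 1) t))
        with (x * Rpower t (x - 1) * exp (- t) + Rpower t x * (- exp (- t))).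
      + apply (is_derive_mult (fun t => Rpower t x) (fun t => exp (- t))).
        * now apply is_derive_Rpower.
        * apply is_derive_exp_opp.
        * apply Rmult_comm.
      + unfold Gamma_integrand, minus, plus, opp, scal; simpl; unfold mult; simpl.
        replace (x + 1 - 1) with x by ring. ring.
    - intros t ht.
      apply (continuous_minus (fun t => scal x (Gamma_integrand x t))
               (Gamma_integrand (x + 1))).
      + apply (continuous_scal_r x (Gamma_integrand x)).
        now apply continuous_Gamma_integrand.
      + now apply continuous_Gamma_integrand.
    - now apply Rpower_exp_lim_0.
    - now apply Rpower_exp_lim_infty. }
  assert (h' : is_RInt_gen
    (fun t => minus (scal x (Gamma_integrand x t)) (Gamma_integrand (x + 1) t))
    (at_right 0) (Rbar_locally p_infty) (minus (scal x (Gamma x)) (Gamma (x + 1)))).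
  { apply (is_RInt_gen_minus (fun t => scal x (Gamma_integrand x t))).
    - apply (is_RInt_gen_scal (Gamma_integrand x) x). now apply is_RInt_gen_Gamma.
    - apply is_RInt_gen_Gamma; lra. }
  apply (is_RInt_gen_unique (V := R_CompleteNormedModule)) in h; try apply _.
  apply (is_RInt_gen_unique (V := R_CompleteNormedModule)) in h'; try apply _.
  rewrite h in h'. unfold minus, plus, opp, scal in h'; simpl in h';
    unfold mult in h'; simpl in h'. lra.
Qed.

Lemma Gamma_1 : Gamma 1 = 1.
Proof.
  assert (h : is_RInt_gen (Gamma_integrand 1)
                (at_right 0) (Rbar_locally p_infty) (0 - - 1)).
  { apply (is_RInt_gen_antiderivative (fun t => - exp (- t))).
    - intros t ht. unfold Gamma_integrand. replace (1 - 1) with 0 by ring.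
      rewrite Rpower_O by easy. auto_derive; [easy | ring].
    - intros; now apply continuous_Gamma_integrand.
    - assert (hc : continuous (fun t => - exp (- t)) 0).
      { apply (ex_derive_continuous (V := R_NormedModule)). auto_derive. easy. }
      unfold continuous in hc. rewrite Ropp_0, exp_0 in hc.
      intros P hP. destruct (hc P hP) as [e he]. exists e. intros y hy _. now apply he.
    - replace 0 with (- 0) by ring.
      apply (filterlim_comp _ _ _ (fun t => exp (- t)) Ropp _ (locally 0)).
      + apply (filterlim_comp _ _ _ Ropp exp _ (Rbar_locally m_infty)).
        * apply (filterlim_Rbar_opp p_infty).
        * apply is_lim_exp_m.
      + apply (filterlim_opp (V := R_NormedModule) 0). }
  apply (is_RInt_gen_unique (V := R_CompleteNormedModule)) in h; try apply _.
  unfold Gamma. unfold Gamma_integrand in h. rewrite h. ring.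
Qed.

Lemma Rpower_bernoulli (x s : R) (hx : 0 < x) (hs : 0 <= s <= 1) :
  Rpower x s <= s * x + (1 - s).
Proof.
  assert (h : forall y, 1 + y <= exp y) by apply exp_ineq1_le.
  (* tangent lines of exp at s ln x, evaluated at ln x and 0 *)
  set (p := Rpower x s). assert (hp : 0 < p) by apply exp_pos.
  assert (h1 : p * (1 + (1 - s) * ln x) <= x).
  { rewrite <- (exp_ln x hx) at 2.
    replace (ln x) with (s * ln x + (1 - s) * ln x) at 2 by ring.
    rewrite exp_plus. apply Rmult_le_compat_l; [apply Rlt_le, hp | apply h]. }
  assert (h2 : p * (1 + - s * ln x) <= 1).
  { apply Rle_trans with (p * exp (- s * ln x)).
    - apply Rmult_le_compat_l; [apply Rlt_le, hp | apply h].
    - right. unfold p, Rpower. rewrite <- exp_plus, <- exp_0. f_equal. ring. }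
  assert (h3 := Rmult_le_compat_l s _ _ (proj1 hs) h1).
  assert (h4 := Rmult_le_compat_l (1 - s) _ _ ltac:(lra) h2).
  nra.
Qed.

(* Integrate Bernoulli's inequality [(t/x)^s <= s t/x + (1-s)]. *)
Lemma Gamma_add_le (x s : R) (hx : 0 < x) (hs : 0 <= s <= 1) :
  Gamma (x + s) <= Rpower x s * Gamma x.
Proof.
  assert (h1 : 0 < x + 1) by lra.
  assert (hr := is_RInt_gen_plus _ _ _ _
    (is_RInt_gen_scal _ (Rpower x s * (s / x)) _ (is_RInt_gen_Gamma (x + 1) h1))
    (is_RInt_gen_scal _ (Rpower x s * (1 - s)) _ (is_RInt_gen_Gamma x hx))).
  apply Rle_trans with (plus (scal (Rpower x s * (s / x)) (Gamma (x + 1)))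
       (scal (Rpower x s * (1 - s)) (Gamma x))).
  - refine (is_RInt_gen_pos_le _ _ _ _ _ (is_RInt_gen_Gamma (x + s) ltac:(lra)) hr).
    intros t ht. split; [apply Rlt_le, Gamma_integrand_pos |].
    assert (hb := Rpower_bernoulli (t / x) s ltac:(now apply Rdiv_lt_0_compat) hs).
    unfold plus, scal; simpl; unfold mult; simpl. unfold Gamma_integrand.
    replace (x + s - 1) with ((x - 1) + s) by ring.
    replace (x + 1 - 1) with ((x - 1) + 1) by ring.
    rewrite !(Rpower_plus _ _ t), Rpower_1 by easy.
    replace (Rpower t s) with (Rpower x s * Rpower (t / x) s).
    2:{ rewrite Rpower_mult_distr; try easy.
        - f_equal. field. lra.
        - now apply Rdiv_lt_0_compat. }
    assert (0 < Rpower t (x - 1) * exp (- t) * Rpower x s).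
    { repeat apply Rmult_lt_0_compat; apply exp_pos. }
    apply Rmult_le_compat_l with (r := Rpower t (x - 1) * exp (- t) * Rpower x s)
      in hb; [| lra].
    unfold Rdiv in *. lra.
  - rewrite Gamma_succ by easy.
    unfold plus, scal; simpl; unfold mult; simpl. right. field. lra.
Qed.

Lemma Gamma_pochhammer (x : R) (n : nat) (hx : 0 < x) :
  Gamma (x + INR n) = pochhammer x n * Gamma x.
Proof.
  induction n as [| n IH].
  - simpl. rewrite Rplus_0_r. ring.
  - rewrite S_INR. replace (x + (INR n + 1)) with ((x + INR n) + 1) by ring.
    assert (0 <= INR n) by apply pos_INR.
    rewrite Gamma_succ, IH by lra. simpl. ring.
Qed.

Lemma pochhammer_1 (n : nat) : pochhammer 1 n = INR (fact n).
Proof.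
  induction n as [| n IH]; [easy |].
  change (fact (S n)) with (S n * fact n)%nat.
  rewrite mult_INR, S_INR. simpl. rewrite IH. ring.
Qed.

Lemma Gamma_nat_succ (n : nat) : Gamma (INR n + 1) = INR (fact n).
Proof.
  rewrite Rplus_comm, Gamma_pochhammer, pochhammer_1, Gamma_1 by lra. ring.
Qed.

(** Positivity is transported back from an integer: [Gamma_add_le] bounds [Gamma (n + 1) = n!] by a
    positive multiple of [Gamma x], with [n] the integer part of [x]. *)
Lemma Gamma_pos (x : R) (hx : 0 < x) : 0 < Gamma x.
Proof.
  destruct (nfloor_ex x ltac:(lra)) as [n hn].
  assert (h := Gamma_add_le x (INR n + 1 - x) hx ltac:(lra)).
  replace (x + (INR n + 1 - x)) with (INR n + 1) in h by ring.
  rewrite Gamma_nat_succ in h. assert (hf := INR_fact_lt_0 n).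
  assert (hp : 0 < Rpower x (INR n + 1 - x)) by apply exp_pos.
  apply Rmult_lt_reg_l with (1 := hp). lra.
Qed.

(* [Gamma_add_le] from [y + a] to [y + 1]. *)
Lemma Gamma_add_ge (y a : R) (hy : 0 < y) (ha : 0 <= a <= 1) :
  y / (y + a) * Rpower (y + a) a * Gamma y <= Gamma (y + a).
Proof.
  assert (h := Gamma_add_le (y + a) (1 - a) ltac:(lra) ltac:(lra)).
  replace (y + a + (1 - a)) with (y + 1) in h by ring.
  rewrite Gamma_succ in h by easy.
  assert (hp : 0 < Rpower (y + a) a) by apply exp_pos.
  assert (e : Rpower (y + a) (1 - a) * Rpower (y + a) a = y + a).
  { rewrite <- Rpower_plus. replace (1 - a + a) with 1 by ring.
    apply Rpower_1. lra. }
  apply Rmult_le_compat_l with (r := Rpower (y + a) a / (y + a)) in h.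
  2:{ apply Rlt_le, Rdiv_lt_0_compat; lra. }
  apply Rle_trans with (Rpower (y + a) a / (y + a) * (y * Gamma y)).
  - right. field. lra.
  - apply Rle_trans with (1 := h). right.
    transitivity (Rpower (y + a) (1 - a) * Rpower (y + a) a / (y + a) * Gamma (y + a)).
    + field. lra.
    + rewrite e. field. lra.
Qed.

(** [Gamma (y + a) / Gamma y] behaves like [y^a] by the two log-convexity bounds. For [y1] and [y2]
    at bounded distance the powers nearly cancel, and both outer expressions tend to 1. *)
Lemma Gamma_ratio_bounds (y1 y2 a : R) (h2 : 0 < y2) (h12 : y2 <= y1 + a)
  (h1 : 0 < y1) (ha : 0 <= a <= 1) :
  y1 / (y1 + a) <= (Gamma (y1 + a) * Gamma y2) / (Gamma y1 * Gamma (y2 + a))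
  <= (1 + a / y2) * (1 + Rabs (y1 - y2) / y2).
Proof.
  assert (g1 := Gamma_pos y1 h1). assert (g2 := Gamma_pos y2 h2).
  assert (g1a := Gamma_pos (y1 + a) ltac:(lra)).
  assert (g2a := Gamma_pos (y2 + a) ltac:(lra)).
  assert (u1 := Gamma_add_le y1 a h1 ha). assert (u2 := Gamma_add_le y2 a h2 ha).
  assert (l1 := Gamma_add_ge y1 a h1 ha). assert (l2 := Gamma_add_ge y2 a h2 ha).
  assert (p2 : 0 < Rpower y2 a) by apply exp_pos.
  assert (p2a : 0 < Rpower (y2 + a) a) by apply exp_pos.
  assert (q1 : 0 < y1 / (y1 + a)) by (apply Rdiv_lt_0_compat; lra).
  assert (gd : 0 < Gamma y1 * Gamma (y2 + a)) by now apply Rmult_lt_0_compat.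
  split.
  - apply Rmult_le_reg_r with (Gamma y1 * Gamma (y2 + a)); [easy |].
    unfold Rdiv at 2. rewrite Rmult_assoc, Rinv_l, Rmult_1_r by lra.
    assert (m : Rpower y2 a <= Rpower (y1 + a) a) by (apply Rle_Rpower_l; lra).
    apply Rle_trans with (y1 / (y1 + a) * (Gamma y1 * (Rpower y2 a * Gamma y2))).
    + apply Rmult_le_compat_l; [lra |]. apply Rmult_le_compat_l; lra.
    + apply Rle_trans with (y1 / (y1 + a) * Rpower (y1 + a) a * Gamma y1 * Gamma y2).
      * replace (y1 / (y1 + a) * (Gamma y1 * (Rpower y2 a * Gamma y2)))
          with (y1 / (y1 + a) * Rpower y2 a * Gamma y1 * Gamma y2) by ring.
        repeat (apply Rmult_le_compat_r; [lra |]). apply Rmult_le_compat_l; lra.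
      * apply Rmult_le_compat_r; lra.
  - apply Rmult_le_reg_r with (Gamma y1 * Gamma (y2 + a)); [easy |].
    unfold Rdiv at 1. rewrite Rmult_assoc, Rinv_l, Rmult_1_r by lra.
    set (D := 1 + Rabs (y1 - y2) / y2).
    assert (hD : 1 <= D).
    { unfold D. assert (0 <= Rabs (y1 - y2) / y2); [| lra].
      apply Rmult_le_pos; [apply Rabs_pos | apply Rlt_le, Rinv_0_lt_compat, h2]. }
    assert (hyD : y1 <= D * y2).
    { unfold D. replace ((1 + Rabs (y1 - y2) / y2) * y2) with (y2 + Rabs (y1 - y2))
        by (field; lra).
      assert (hh := Rle_abs (y1 - y2)). lra. }
    (* [y1 <= D (y2 + a)], and [D^a <= D] because [1 <= D] and [a <= 1]. *)
    assert (m : Rpower y1 a <= D * Rpower (y2 + a) a).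
    { apply Rle_trans with (Rpower (D * (y2 + a)) a).
      - apply Rle_Rpower_l; [lra |]. split; [easy |]. nra.
      - rewrite <- Rpower_mult_distr by lra. apply Rmult_le_compat_r; [lra |].
        rewrite <- (Rpower_1 D) at 2 by lra. apply Rle_Rpower; lra. }
    apply Rle_trans with (D * Rpower (y2 + a) a * Gamma y1 * Gamma y2).
    + apply Rmult_le_compat_r; [lra |].
      apply Rle_trans with (1 := u1). apply Rmult_le_compat_r; lra.
    + apply Rle_trans with ((1 + a / y2) * D * Gamma y1
        * (y2 / (y2 + a) * Rpower (y2 + a) a * Gamma y2)).
      * right. field. lra.
      * replace ((1 + a / y2) * D * (Gamma y1 * Gamma (y2 + a)))
          with ((1 + a / y2) * D * Gamma y1 * Gamma (y2 + a)) by ring.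
        apply Rmult_le_compat_l; [| easy].
        assert (0 <= a / y2).
        { apply Rmult_le_pos; [lra | apply Rlt_le, Rinv_0_lt_compat, h2]. }
        apply Rmult_le_pos; [apply Rmult_le_pos |]; lra.
Qed.

(** * Hypergeometric and binomial series *)

Lemma pochhammer_pos (x : R) (n : nat) (hx : 0 < x) : 0 < pochhammer x n.
Proof.
  induction n as [| n IH]; simpl; [lra |].
  assert (0 <= INR n) by apply pos_INR. apply Rmult_lt_0_compat; lra.
Qed.

Lemma pochhammer_add (x : R) (j n : nat) :
  pochhammer x (n + j) = pochhammer x j * pochhammer (x + INR j) n.
Proof.
  induction n as [| n IH]; simpl; [ring |].
  rewrite IH, plus_INR. ring.
Qed.

Lemma is_lim_seq_shifted_ratio (A C : R) (hC : 0 < C) :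
  is_lim_seq (fun n => (A + INR n) / (C + INR n)) 1.
Proof.
  apply is_lim_seq_ext with (fun n => 1 + (A - C) * / (C + INR n)).
  - intros n. assert (0 <= INR n) by apply pos_INR. field. lra.
  - replace (Finite 1) with (Finite (1 + (A - C) * 0)) by (f_equal; ring).
    apply is_lim_seq_plus'; [apply is_lim_seq_const |].
    apply (is_lim_seq_scal_l _ _ 0).
    change (Finite 0) with (Rbar_inv p_infty).
    apply is_lim_seq_inv; [| easy].
    apply (is_lim_seq_plus _ _ C p_infty); [apply is_lim_seq_const | apply is_lim_seq_INR | easy].
Qed.

Lemma CV_radius_ratio_1 (u : nat -> R) (hu : forall n, 0 < u n)
  (h : is_lim_seq (fun n => u (S n) / u n) 1) : CV_radius u = 1.
Proof.
  replace (Finite 1) with (Finite (/ 1)) by (f_equal; field).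
  apply CV_radius_finite_DAlembert; [| lra |].
  - intros n. specialize (hu n). lra.
  - apply is_lim_seq_ext with (2 := h). intros n. symmetry. apply Rabs_pos_eq.
    apply Rlt_le, Rdiv_lt_0_compat; apply hu.
Qed.

Lemma inside_radius_1 (u : nat -> R) (x : R) (hu : Rbar_le 1 (CV_radius u))
  (hx : Rabs x < 1) : Rbar_lt (Rabs x) (CV_radius u).
Proof. now apply Rbar_lt_le_trans with 1. Qed.

Definition hyp_coeff (A B C : R) (n : nat) : R :=
  pochhammer A n * pochhammer B n / (pochhammer C n * INR (fact n)).

Lemma hyp_coeff_S (A B C : R) (n : nat) (hC : 0 < C) :
  (INR n + 1) * (INR n + C) * hyp_coeff A B C (S n)
  = (INR n + A) * (INR n + B) * hyp_coeff A B C n.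
Proof.
  unfold hyp_coeff.
  change (fact (S n)) with (S n * fact n)%nat. rewrite mult_INR, S_INR. simpl.
  assert (0 <= INR n) by apply pos_INR. assert (h1 := pochhammer_pos C n hC).
  assert (h2 := INR_fact_lt_0 n). field. repeat split; lra.
Qed.

Lemma hyp_coeff_pos (A B C : R) (n : nat) (hA : 0 < A) (hB : 0 < B) (hC : 0 < C) :
  0 < hyp_coeff A B C n.
Proof.
  apply Rdiv_lt_0_compat; apply Rmult_lt_0_compat;
    try now apply pochhammer_pos. apply INR_fact_lt_0.
Qed.

Lemma hyp_coeff_radius (A B C : R) (hA : 0 < A) (hB : 0 < B) (hC : 0 < C) :
  CV_radius (hyp_coeff A B C) = 1.
Proof.
  apply CV_radius_ratio_1; [intros; now apply hyp_coeff_pos |].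
  apply is_lim_seq_ext with
    (fun n => (A + INR n) / (C + INR n) * ((B + INR n) / (1 + INR n))).
  - intros n. assert (h := hyp_coeff_S A B C n hC).
    assert (h1 := hyp_coeff_pos A B C n hA hB hC).
    assert (0 <= INR n) by apply pos_INR.
    apply Rmult_eq_reg_r with (hyp_coeff A B C n * ((C + INR n) * (1 + INR n))).
    + transitivity ((INR n + A) * (INR n + B) * hyp_coeff A B C n).
      * field. lra.
      * rewrite <- h. field. lra.
    + apply Rgt_not_eq. apply Rmult_lt_0_compat; [easy |].
      apply Rmult_lt_0_compat; lra.
  - replace (Finite 1) with (Finite (1 * 1)) by (f_equal; ring).
    apply is_lim_seq_mult'; apply is_lim_seq_shifted_ratio; lra.
Qed.

(** Comparison of the coefficients of [x^n] reduces the equation to [hyp_coeff_S]. The radius is a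
    hypothesis because the lemma is also applied to [A = - a], [B = j - a], where coefficients may
    vanish and the ratio test does not apply. *)
Lemma hyp_ode (A B C : R) (hC : 0 < C) (x : R) (hx : Rabs x < 1)
  (hr : Rbar_le 1 (CV_radius (hyp_coeff A B C))) :
  let h := hyp_coeff A B C in
  x * (1 - x) * PSeries (PS_derive (PS_derive h)) x
  + (C - (A + B + 1) * x) * PSeries (PS_derive h) x - A * B * PSeries h x = 0.
Proof.
  intros h.
  assert (ex : forall u, Rbar_le 1 (CV_radius u) -> ex_pseries u x)
    by (intros; now apply CV_radius_inside, inside_radius_1).
  assert (E : PSeries (PS_plus (PS_scal C (PS_derive h))
                         (PS_incr_1 (PS_derive (PS_derive h)))) x
            = PSeries (PS_plus (PS_plus (PS_scal (A * B) h)
                          (PS_scal (A + B + 1) (PS_incr_1 (PS_derive h))))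
                          (PS_incr_1 (PS_incr_1 (PS_derive (PS_derive h))))) x).
  { apply PSeries_ext. intros n.
    assert (hS := hyp_coeff_S A B C n hC). fold h in hS.
    unfold PS_plus, PS_scal, PS_incr_1, PS_derive, plus, scal, zero; simpl;
      unfold mult; simpl.
    destruct n as [| [| n]].
    - simpl in *. lra.
    - simpl in *. lra.
    - change (match n with O => 1 | S _ => INR n + 1 end) with (INR (S n)).
      rewrite !S_INR in *. lra. }
  rewrite !PSeries_plus, !PSeries_scal, !PSeries_incr_1 in E;
    repeat lazymatch goal with
      | |- ex_pseries (PS_plus _ _) _ => apply (ex_pseries_plus (V := R_NormedModule))
      | |- ex_pseries (PS_scal _ _) _ =>
          apply (ex_pseries_scal (V := R_NormedModule)); [apply Rmult_comm |]
      | |- ex_pseries (PS_incr_1 _) _ => apply (ex_pseries_incr_1 (V := R_NormedModule))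
      | |- ex_pseries _ _ => apply ex; now rewrite ?CV_radius_derive
      end.
  lra.
Qed.

(** The endpoint 0 is reached by continuity only: in [hyp_euler] one of the derivatives is known to
    vanish after division by a power of [x], hence for [x > 0]. *)
Lemma is_derive_0_const (f : R -> R) (b : R)
  (h : forall x, 0 < x < b -> is_derive f x 0)
  (hc : forall x, 0 <= x < b -> continuity_pt f x) :
  forall x, 0 <= x < b -> f x = f 0.
Proof.
  intros x hx.
  destruct (MVT_gen f 0 x (fun _ => 0)) as (c & _ & e).
  - intros y. rewrite Rmin_left, Rmax_right by lra. intros; apply h; lra.
  - intros y. rewrite Rmin_left, Rmax_right by lra. intros; apply hc; lra.
  - lra.
Qed.

Definition binom_coeff (s : R) (n : nat) : R := pochhammer s n / INR (fact n).

Lemma binom_coeff_pos (s : R) (n : nat) (hs : 0 < s) : 0 < binom_coeff s n.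
Proof. apply Rdiv_lt_0_compat; [now apply pochhammer_pos | apply INR_fact_lt_0]. Qed.

Lemma binom_coeff_S (s : R) (n : nat) :
  INR (S n) * binom_coeff s (S n) = (s + INR n) * binom_coeff s n.
Proof.
  unfold binom_coeff. change (fact (S n)) with (S n * fact n)%nat.
  rewrite mult_INR. simpl pochhammer.
  assert (h := INR_fact_lt_0 n). assert (0 < INR (S n)) by (apply lt_0_INR; lia).
  field. lra.
Qed.

Lemma binom_coeff_radius (s : R) (hs : 0 < s) : CV_radius (binom_coeff s) = 1.
Proof.
  rewrite <- (hyp_coeff_radius s 1 1) by lra. apply CV_radius_ext. intros n.
  unfold hyp_coeff, binom_coeff. rewrite pochhammer_1.
  assert (h := INR_fact_lt_0 n). field. lra.
Qed.

Lemma continuity_of_is_derive (f : R -> R) (x l : R) (h : is_derive f x l) :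
  continuity_pt f x.
Proof. apply continuity_pt_filterlim. now apply continuous_of_is_derive with l. Qed.

Lemma Rabs_lt_1 (x : R) (hx : 0 <= x < 1) : Rabs x < 1.
Proof. rewrite Rabs_pos_eq; lra. Qed.

Lemma PSeries_pos_ge_coeff0 (u : nat -> R) (x : R) (hu : forall n, 0 < u n)
  (hr : Rbar_le 1 (CV_radius u)) (hx : 0 <= x < 1) : u O <= PSeries u x.
Proof.
  rewrite <- (PSeries_0 u). unfold PSeries. apply Series_le.
  - intros n. split.
    + apply Rmult_le_pos; [apply Rlt_le, hu | apply pow_le; lra].
    + apply Rmult_le_compat_l; [apply Rlt_le, hu | apply pow_incr; lra].
  - apply ex_series_Rabs, CV_disk_inside, inside_radius_1; [easy |].
    now apply Rabs_lt_1.
Qed.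

(* The Wronskian-like quantity
   [t^C ((1-t)(F'G - FG') + p F G)] has zero derivative by the two
   hypergeometric equations; hence so has [F (1-t)^(-p) / G]. *)
Lemma hyp_euler (A B : R) (m : nat) (p : R)
  (hp : p = INR m + 1 - A - B)
  (hA' : 0 < INR m + 1 - A) (hB' : 0 < INR m + 1 - B)
  (hr : Rbar_le 1 (CV_radius (hyp_coeff A B (INR m + 1))))
  (t : R) (ht : 0 <= t < 1) :
  PSeries (hyp_coeff A B (INR m + 1)) t
  = Rpower (1 - t) p
    * PSeries (hyp_coeff (INR m + 1 - A) (INR m + 1 - B) (INR m + 1)) t.
Proof.
  assert (hm : 0 <= INR m) by apply pos_INR.
  set (C := INR m + 1). set (u := hyp_coeff A B C).
  set (v := hyp_coeff (C - A) (C - B) C).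
  assert (hC : 0 < C) by (unfold C; lra).
  assert (hru : Rbar_le 1 (CV_radius u)) by exact hr.
  assert (hrv : CV_radius v = 1) by (apply hyp_coeff_radius; unfold C; lra).
  assert (hrv' : Rbar_le 1 (CV_radius v)) by (rewrite hrv; apply Rle_refl).
  assert (hv : forall n, 0 < v n) by (intros; apply hyp_coeff_pos; unfold C; lra).
  assert (dS : forall w x, Rbar_le 1 (CV_radius w) -> 0 <= x < 1 ->
             is_derive (PSeries w) x (PSeries (PS_derive w) x)).
  { intros w x hw hx. apply is_derive_PSeries, inside_radius_1; [easy |].
    now apply Rabs_lt_1. }
  set (F := PSeries u). set (F1 := PSeries (PS_derive u)).
  set (F2 := PSeries (PS_derive (PS_derive u))).
  set (G := PSeries v). set (G1 := PSeries (PS_derive v)).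
  set (G2 := PSeries (PS_derive (PS_derive v))).
  assert (dF : forall x, 0 <= x < 1 -> is_derive F x (F1 x)) by (intros; now apply dS).
  assert (dG : forall x, 0 <= x < 1 -> is_derive G x (G1 x)) by (intros; now apply dS).
  assert (dF1 : forall x, 0 <= x < 1 -> is_derive F1 x (F2 x))
    by (intros; apply dS; [now rewrite CV_radius_derive | easy]).
  assert (dG1 : forall x, 0 <= x < 1 -> is_derive G1 x (G2 x))
    by (intros; apply dS; [now rewrite CV_radius_derive | easy]).
  assert (D : forall f f' : R -> R, (forall x, 0 <= x < 1 -> is_derive f x (f' x)) ->
            forall x, 0 <= x < 1 -> Derive (fun y => f y) x = f' x)
    by (intros f f' hf x hx; now apply is_derive_unique, hf).
  assert (DF := D _ _ dF). assert (DG := D _ _ dG).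
  assert (DF1 := D _ _ dF1). assert (DG1 := D _ _ dG1).
  assert (Gpos : forall x, 0 <= x < 1 -> 0 < G x).
  { intros x hx. apply Rlt_le_trans with (v O); [apply hv |].
    now apply PSeries_pos_ge_coeff0. }
  set (M := fun x => x ^ S m * ((1 - x) * (F1 x * G x - F x * G1 x) + p * (F x * G x))).
  assert (dM : forall x, 0 <= x < 1 -> is_derive M x 0).
  { intros x hx. assert (hx1 := Rabs_lt_1 x hx).
    assert (oF := hyp_ode A B C hC x hx1 hru).
    assert (oG := hyp_ode (C - A) (C - B) C hC x hx1 hrv').
    fold u in oF. fold v in oG. cbv zeta in oF, oG.
    fold F F1 F2 in oF. fold G G1 G2 in oG.
    replace 0 with ((INR (S m) * x ^ m)
        * ((1 - x) * (F1 x * G x - F x * G1 x) + p * (F x * G x))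
      + x ^ S m * ((-1 * (F1 x * G x - F x * G1 x)
          + (1 - x) * ((F2 x * G x + F1 x * G1 x) - (F1 x * G1 x + F x * G2 x)))
          + p * (F1 x * G x + F x * G1 x))).
    - assert (f0 := dF x hx). assert (g0 := dG x hx).
      assert (f1 := dF1 x hx). assert (g1 := dG1 x hx).
      unfold M. auto_derive.
      + repeat split; eexists; eassumption.
      + rewrite (DF x hx), (DG x hx), (DF1 x hx), (DG1 x hx).
        change (match m with O => 1 | S _ => INR m + 1 end) with (INR (S m)). simpl pow. ring.
    - rewrite S_INR. fold C.
      (* One factor [x] of [x^(m+1)] is spent to expose [x (1 - x) F2] and [x (1 - x) G2]. The two
         equations eliminate these, and the rest cancels precisely for [p = C - A - B]. *)
      transitivity (x ^ m * (C * ((1 - x) * (F1 x * G x - F x * G1 x) + p * (F x * G x))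
        - x * (F1 x * G x - F x * G1 x) + p * x * (F1 x * G x + F x * G1 x)
        + (x * (1 - x) * F2 x) * G x - (x * (1 - x) * G2 x) * F x)).
      { simpl pow. ring. }
      replace (x * (1 - x) * F2 x)
        with (- ((C - (A + B + 1) * x) * F1 x) + A * B * F x) by lra.
      replace (x * (1 - x) * G2 x)
        with (- ((C - (C - A + (C - B) + 1) * x) * G1 x)
              + (C - A) * (C - B) * G x) by lra.
      unfold C. rewrite hp. ring. }
  assert (M0 : forall x, 0 < x < 1 ->
    (1 - x) * (F1 x * G x - F x * G1 x) + p * (F x * G x) = 0).
  { intros x hx.
    assert (e : M x = M 0).
    { apply (is_derive_0_const M 1); [| | lra].
      - intros y hy. apply dM; lra.
      - intros y hy. now apply continuity_of_is_derive with 0, dM. }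
    (* [M 0 = 0] because the exponent [S m] is positive; for [x > 0] that power can be divided
       out. *)
    unfold M in e. rewrite (pow_i (S m)), Rmult_0_l in e by lia.
    apply Rmult_integral in e. destruct e as [e | e]; [| easy].
    exfalso. apply (pow_nonzero x (S m)); [lra | easy]. }
  set (H := fun x => F x * (Rpower (1 - x) (- p) * / G x)).
  assert (dH : forall x, 0 <= x < 1 -> is_derive H x
    (F1 x * (Rpower (1 - x) (- p) * / G x) + F x *
      ((- - p * (Rpower (1 - x) (- p) / (1 - x))) * / G x
        + Rpower (1 - x) (- p) * (- G1 x / (G x) ^ 2)))).
  { intros x hx. assert (g := Gpos x hx).
    assert (f0 := dF x hx). assert (g0 := dG x hx). unfold H, Rpower. auto_derive.
    - repeat split; try (eexists; eassumption); lra.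
    - rewrite (DF x hx), (DG x hx). change (1 + - x) with (1 - x). field. lra. }
  assert (e : H t = H 0).
  { apply (is_derive_0_const H 1); [| | easy].
    - intros x hx. assert (hx' : 0 <= x < 1) by lra.
      assert (g := Gpos x hx'). assert (d := dH x hx'). assert (m0 := M0 x hx).
      replace 0 with (F1 x * (Rpower (1 - x) (- p) * / G x) + F x *
      ((- - p * (Rpower (1 - x) (- p) / (1 - x))) * / G x
        + Rpower (1 - x) (- p) * (- G1 x / (G x) ^ 2))); [easy |].
      transitivity (Rpower (1 - x) (- p) / ((1 - x) * G x ^ 2)
         * ((1 - x) * (F1 x * G x - F x * G1 x) + p * (F x * G x))).
      + field. lra.
      + rewrite m0. ring.
    - intros x hx. eapply continuity_of_is_derive. now apply dH. }
  assert (H0 : H 0 = 1).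
  { unfold H, F, G. rewrite !PSeries_0, Rminus_0_r. unfold u, v, hyp_coeff, Rpower.
    simpl. rewrite ln_1, Rmult_0_r, exp_0. field. }
  rewrite H0 in e. unfold H in e. assert (g := Gpos t ht).
  rewrite Rpower_Ropp in e.
  assert (hpw : 0 < Rpower (1 - t) p) by apply exp_pos.
  change (F t = Rpower (1 - t) p * G t).
  transitivity (F t * (/ Rpower (1 - t) p * / G t) * (Rpower (1 - t) p * G t)).
  - field. lra.
  - rewrite e. ring.
Qed.

Lemma Series_dominated (u b : nat -> R) (h : forall n, Rabs (u n) <= b n)
  (hb : ex_series b) : ex_series u /\ Rabs (Series u) <= Series b.
Proof.
  split; [now apply (ex_series_le (V := R_CompleteNormedModule)) with b |].
  apply Rle_trans with (Series (fun n => Rabs (u n))).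
  - apply Series_Rabs. apply (ex_series_le (V := R_CompleteNormedModule)) with (2 := hb).
    intros n. change (Rabs (Rabs (u n)) <= b n). now rewrite Rabs_Rabsolu.
  - apply Series_le; [| exact hb]. intros n. split; [apply Rabs_pos | apply h].
Qed.

Lemma CV_radius_ge (u : nat -> R) (y : R) (h : ex_series (fun n => Rabs (u n * y ^ n))) :
  Rbar_le y (CV_radius u).
Proof. now apply (Lub_Rbar_correct (CV_disk u)). Qed.

Lemma CV_radius_dominated (u b : nat -> R) (hub : forall n, Rabs (u n) <= b n)
  (hb : CV_radius b = 1) : Rbar_le 1 (CV_radius u).
Proof.
  apply Rbar_not_lt_le. intros hlt.
  assert (h0 := CV_radius_ge_0 u).
  assert (hy : forall y, Rabs y < 1 -> Rbar_le y (CV_radius u)).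
  { intros y hy. apply CV_radius_ge.
    apply (ex_series_le (V := R_CompleteNormedModule)) with (fun n => Rabs (b n * y ^ n)).
    - intros n. change (Rabs (Rabs (u n * y ^ n)) <= Rabs (b n * y ^ n)).
      rewrite Rabs_Rabsolu, !Rabs_mult. apply Rmult_le_compat_r; [apply Rabs_pos |].
      apply Rle_trans with (1 := hub n). apply Rle_abs.
    - apply CV_disk_inside. now rewrite hb. }
  destruct (CV_radius u) as [x | |]; simpl in hlt, h0; try easy.
  assert (h := hy ((x + 1) / 2) ltac:(rewrite Rabs_pos_eq; lra)). simpl in h. lra.
Qed.

Lemma sin_cos_sq (t : R) : sin t ^ 2 + cos t ^ 2 = 1.
Proof. assert (h := sin2_cos2 t). unfold Rsqr in h. simpl. lra. Qed.

Lemma is_series_PSeries (u : nat -> R) (x : R) (hu : Rbar_le 1 (CV_radius u))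
  (hx : Rabs x < 1) : is_series (fun n => u n * x ^ n) (PSeries u x).
Proof. apply Series_correct, ex_series_Rabs, CV_disk_inside. now apply inside_radius_1. Qed.

Lemma is_series_moment (u : nat -> R) (x : R) (hu : Rbar_le 1 (CV_radius u))
  (hx : Rabs x < 1) :
  is_series (fun n => INR n * u n * x ^ n) (x * PSeries (PS_derive u) x).
Proof.
  rewrite <- PSeries_incr_1. apply is_series_ext with (fun n => PS_incr_1 (PS_derive u) n * x ^ n).
  - intros [| n]; [unfold PS_incr_1, zero; simpl; ring | easy].
  - apply is_series_PSeries; [| easy]. now rewrite CV_radius_incr_1, CV_radius_derive.
Qed.

Section binomial_modulus.
Context (s phi : R) (hs : 0 < s).

Let b := binom_coeff s.
(** Together with [q]: the real and imaginary parts of the coefficients, as a series in [r], of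
    [S = (1 - r e^(i phi))^(-s)]. *)
Let p (n : nat) : R := b n * cos (INR n * phi).
Let q (n : nat) : R := b n * sin (INR n * phi).

Lemma trig_coeff_radius (f : nat -> R) (hf : forall n, Rabs (f n) <= 1) :
  Rbar_le 1 (CV_radius (fun n => b n * f n)).
Proof.
  apply CV_radius_dominated with b; [| now apply binom_coeff_radius].
  intros n. assert (h := binom_coeff_pos s n hs). fold b in h.
  rewrite Rabs_mult, (Rabs_pos_eq (b n)) by lra.
  rewrite <- (Rmult_1_r (b n)) at 2. apply Rmult_le_compat_l; [lra | apply hf].
Qed.

Lemma p_radius : Rbar_le 1 (CV_radius p).
Proof. apply trig_coeff_radius. intros n. apply Rabs_le, COS_bound. Qed.

Lemma q_radius : Rbar_le 1 (CV_radius q).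
Proof. apply trig_coeff_radius. intros n. apply Rabs_le, SIN_bound. Qed.

(* [(1 - z) dS/dr = s e^(i phi) S] at [z = r e^(i phi)], for the real part; the
   imaginary part is the case of the pair [(q, -p)]. *)
Lemma trig_ode (f g : nat -> R) (r : R) (hr : Rabs r < 1)
  (hf : Rbar_le 1 (CV_radius f)) (hg : Rbar_le 1 (CV_radius g))
  (hrec : forall n, INR (S n) * f (S n)
            = (s + INR n) * (cos phi * f n - sin phi * g n)) :
  PSeries (PS_derive f) r
  - r * (cos phi * PSeries (PS_derive f) r - sin phi * PSeries (PS_derive g) r)
  = s * (cos phi * PSeries f r - sin phi * PSeries g r).
Proof.
  assert (A : is_series (fun n => PS_derive f n * r ^ n) (PSeries (PS_derive f) r))
    by (apply is_series_PSeries; [now rewrite CV_radius_derive | easy]).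
  assert (B := is_series_plus _ _ _ _
    (is_series_plus _ _ _ _ (is_series_scal (cos phi) _ _ (is_series_moment f r hf hr))
       (is_series_scal (- sin phi) _ _ (is_series_moment g r hg hr)))
    (is_series_plus _ _ _ _ (is_series_scal (s * cos phi) _ _ (is_series_PSeries f r hf hr))
       (is_series_scal (s * - sin phi) _ _ (is_series_PSeries g r hg hr)))).
  apply is_series_ext with (b := fun n => PS_derive f n * r ^ n) in B.
  - apply is_series_unique in A. apply is_series_unique in B. rewrite A in B.
    unfold plus, scal, mult in B; simpl in B; unfold mult in B; simpl in B. lra.
  - intros n. unfold PS_derive. rewrite hrec.
    unfold plus, scal, mult; simpl; unfold mult; simpl. ring.
Qed.

Lemma modulus_pos (r : R) (hr : 0 <= r < 1) : 0 < 1 - 2 * r * cos phi + r ^ 2.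
Proof.
  assert (h := COS_bound phi).
  assert (0 < (1 - r) ^ 2) by (apply pow_lt; lra).
  assert (0 <= r * (1 - cos phi)) by (apply Rmult_le_pos; lra). nra.
Qed.

(** This is [|S|^2 |1 - z|^(2 s) = 1] for [S = (1 - z)^(-s)], [z = r e^(i phi)]. The left side is 1
    at [r = 0], and the differential system for [(p, q)] makes its derivative in [r] vanish. *)
Lemma binom_modulus (r : R) (hr : 0 <= r < 1) :
  (PSeries p r ^ 2 + PSeries q r ^ 2) * Rpower (1 - 2 * r * cos phi + r ^ 2) s = 1.
Proof.
  set (f := fun r => (PSeries p r ^ 2 + PSeries q r ^ 2)
                     * Rpower (1 - 2 * r * cos phi + r ^ 2) s).
  assert (hp := p_radius). assert (hq := q_radius).
  assert (hd : forall x, 0 <= x < 1 -> is_derive f x 0).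
  { intros x hx. assert (hx1 := Rabs_lt_1 x hx). assert (hD := modulus_pos x hx).
    assert (e1 := trig_ode p q x hx1 hp hq).
    assert (e2 := trig_ode q (fun n => - p n) x hx1 hq).
    assert (hp' : Rbar_le 1 (CV_radius (fun n => - p n))).
    { rewrite <- (CV_radius_opp p) in hp. exact hp. }
    specialize (e2 hp').
    assert (eo : forall u y, PSeries (fun n => - u n) y = - PSeries u y)
      by (intros u y; exact (PSeries_opp u y)).
    assert (eo' : PSeries (PS_derive (fun n => - p n)) x = - PSeries (PS_derive p) x).
    { rewrite <- eo. apply PSeries_ext. intros n. unfold PS_derive. ring. }
    rewrite eo, eo' in e2.
    assert (rec1 : forall n, INR (S n) * p (S n)
              = (s + INR n) * (cos phi * p n - sin phi * q n)).
    { intros n. unfold p, q. rewrite <- Rmult_assoc. unfold b.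
      rewrite binom_coeff_S, (S_INR n).
      replace ((INR n + 1) * phi) with (phi + INR n * phi) by ring.
      rewrite cos_plus. ring. }
    assert (rec2 : forall n, INR (S n) * q (S n)
              = (s + INR n) * (cos phi * q n - sin phi * - p n)).
    { intros n. unfold p, q. rewrite <- Rmult_assoc. unfold b.
      rewrite binom_coeff_S, (S_INR n).
      replace ((INR n + 1) * phi) with (phi + INR n * phi) by ring.
      rewrite sin_plus. ring. }
    specialize (e1 rec1). specialize (e2 rec2).
    set (P := PSeries p x) in *. set (Q := PSeries q x) in *.
    set (P1 := PSeries (PS_derive p) x) in *. set (Q1 := PSeries (PS_derive q) x) in *.
    set (D := 1 - 2 * x * cos phi + x ^ 2) in *.
    assert (hcs := sin_cos_sq phi).
    assert (hDe : D = (1 - x * cos phi) ^ 2 + x ^ 2 * sin phi ^ 2).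
    { unfold D. replace (sin phi ^ 2) with (1 - cos phi ^ 2) by lra. ring. }
    (* With [D = |1 - z|^2], this is the real part of [conj((1 - z) S) (1 - z) S' = s e^(i phi) (1 -
       conj z) |S|^2]. *)
    assert (key : D * (P * P1 + Q * Q1) = s * (cos phi - x) * (P ^ 2 + Q ^ 2)).
    { transitivity (
        ((1 - x * cos phi) * P - x * sin phi * Q * -1)
          * (P1 - x * (cos phi * P1 - sin phi * Q1))
        + ((1 - x * cos phi) * Q - x * sin phi * P)
          * (Q1 - x * (cos phi * Q1 - sin phi * - P1))).
      - rewrite hDe. ring.
      - rewrite e1, e2.
        transitivity (s * (cos phi - x * (sin phi ^ 2 + cos phi ^ 2)) * (P ^ 2 + Q ^ 2));
          [ring | rewrite hcs; ring]. }
    assert (dP := is_derive_PSeries p x (inside_radius_1 p x hp hx1)).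
    assert (dQ := is_derive_PSeries q x (inside_radius_1 q x hq hx1)).
    assert (eP : Derive (fun y => PSeries p y) x = P1) by now apply is_derive_unique.
    assert (eQ : Derive (fun y => PSeries q y) x = Q1) by now apply is_derive_unique.
    replace 0 with (2 * Rpower D s / D
      * (D * (P * P1 + Q * Q1) - s * (cos phi - x) * (P ^ 2 + Q ^ 2)))
      by (rewrite key; field; lra).
    unfold f, Rpower. auto_derive.
    - repeat split; try (eexists; eassumption).
      replace (1 + - (2 * x * cos phi) + x * (x * 1)) with D by (unfold D; ring). easy.
    - rewrite eP, eQ. fold P Q.
      replace (1 + - (2 * x * cos phi) + x * (x * 1)) with D by (unfold D; ring).
      field. lra. }
  change (f r = 1). rewrite (is_derive_0_const f 1); [| | | easy].
  - unfold f. rewrite !PSeries_0.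
    assert (p0 : p O = 1).
    { unfold p, b, binom_coeff. simpl. rewrite Rmult_0_l, cos_0. field. }
    assert (q0 : q O = 0) by (unfold q; simpl; rewrite Rmult_0_l, sin_0; ring).
    rewrite p0, q0. replace (1 - 2 * 0 * cos phi + 0 ^ 2) with 1 by ring.
    unfold Rpower. rewrite ln_1, Rmult_0_r, exp_0. ring.
  - intros x hx. apply hd. lra.
  - intros x hx. now apply continuity_of_is_derive with 0, hd.
Qed.

End binomial_modulus.

(** At [phi = 0] the modulus identity only says that the product squares to 1; positivity of the
    coefficients excludes the value -1. *)
Lemma binom_series (s t : R) (hs : 0 < s) (ht : 0 <= t < 1) :
  PSeries (binom_coeff s) t * Rpower (1 - t) s = 1.
Proof.
  assert (h := binom_modulus s 0 hs t ht). rewrite cos_0 in h.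
  assert (eP : PSeries (fun n => binom_coeff s n * cos (INR n * 0)) t
               = PSeries (binom_coeff s) t).
  { apply PSeries_ext. intros n. rewrite Rmult_0_r, cos_0. ring. }
  assert (eQ : PSeries (fun n => binom_coeff s n * sin (INR n * 0)) t = 0).
  { rewrite (PSeries_ext _ (PS_scal 0 (binom_coeff s))), PSeries_scal; [ring |].
    intros n. rewrite Rmult_0_r, sin_0. unfold PS_scal, scal; simpl; unfold mult; simpl. ring. }
  rewrite eP, eQ in h.
  replace (1 - 2 * t * 1 + t ^ 2) with ((1 - t) * (1 - t)) in h by ring.
  rewrite <- Rpower_mult_distr in h by lra.
  assert (hp : 0 < Rpower (1 - t) s) by apply exp_pos.
  assert (hP : binom_coeff s 0 <= PSeries (binom_coeff s) t).
  { apply PSeries_pos_ge_coeff0; [intros; now apply binom_coeff_pos | | easy].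
    rewrite binom_coeff_radius by easy. apply Rle_refl. }
  assert (h0 := binom_coeff_pos s 0 hs).
  set (X := PSeries (binom_coeff s) t * Rpower (1 - t) s).
  assert (hX : 0 < X) by (apply Rmult_lt_0_compat; lra).
  assert (e : (X - 1) * (X + 1) = 0) by (unfold X; lra).
  apply Rmult_integral in e. lra.
Qed.

(** * The radial factors F_j *)

Definition fcoeff (a : R) (j : nat) : nat -> R :=
  hyp_coeff (- a) (INR j - a) (INR j + 1).

Definition Fser (a : R) (j : nat) : R -> R := PSeries (fcoeff a j).

Lemma INR_ge_1 (j : nat) (hj : (1 <= j)%nat) : 1 <= INR j.
Proof. apply (le_INR 1), hj. Qed.

Lemma ex_series_pos_bounded (u : nat -> R) (M : R) (hu : forall n, 0 <= u n)
  (hM : forall N, sum_n u N <= M) : ex_series u.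
Proof.
  destruct (ex_finite_lim_seq_incr (sum_n u) M) as [l hl]; [| exact hM |].
  - intros n. rewrite sum_Sn. unfold plus; simpl. specialize (hu (S n)). lra.
  - exists l. exact hl.
Qed.

Lemma pow_diff_bounds (s t : R) (n : nat) (hs : 0 <= s) (hst : s <= t) (ht : t <= 1) :
  0 <= t ^ n - s ^ n <= INR n * (t - s).
Proof.
  induction n as [| n IH]; [simpl; lra |].
  rewrite S_INR. simpl.
  assert (h0 : 0 <= s ^ n) by (apply pow_le; lra).
  assert (h1 : s ^ n <= 1) by (rewrite <- (pow1 n); apply pow_incr; lra).
  replace (t * t ^ n - s * s ^ n) with (t * (t ^ n - s ^ n) + (t - s) * s ^ n) by ring.
  split; [apply Rplus_le_le_0_compat; apply Rmult_le_pos; lra |].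
  assert (t * (t ^ n - s ^ n) <= 1 * (t ^ n - s ^ n)) by (apply Rmult_le_compat_r; lra).
  assert ((t - s) * s ^ n <= (t - s) * 1) by (apply Rmult_le_compat_l; lra).
  lra.
Qed.

Section radial_factor.
Context (a : R) (j : nat) (ha : 0 < a <= 1) (hj : (1 <= j)%nat).

Lemma fcoeff_0 : fcoeff a j 0 = 1.
Proof. unfold fcoeff, hyp_coeff. simpl. field. Qed.

Lemma fcoeff_S (n : nat) :
  (INR n + 1) * (INR n + INR j + 1) * fcoeff a j (S n)
  = (INR n - a) * (INR n + INR j - a) * fcoeff a j n.
Proof.
  assert (h := hyp_coeff_S (- a) (INR j - a) (INR j + 1) n
                 ltac:(assert (0 <= INR j) by apply pos_INR; lra)).
  fold (fcoeff a j) in h.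
  replace (INR n + INR j + 1) with (INR n + (INR j + 1)) by ring.
  rewrite h. ring.
Qed.

(** The recurrence multiplies by [n - a], which is negative at [n = 0] and nonnegative afterwards
    because [a <= 1]; the other factor [n + j - a] is never negative. So the sign changes once,
    right after the coefficient 1. *)
Lemma fcoeff_nonpos (n : nat) :
  fcoeff a j (S n) <= 0.
Proof.
  assert (h1 := INR_ge_1 j hj).
  induction n as [| n IH].
  - assert (h := fcoeff_S 0). rewrite fcoeff_0 in h. simpl INR in h.
    assert (0 <= a * (INR j - a)) by (apply Rmult_le_pos; lra).
    apply Rmult_le_reg_l with ((0 + 1) * (0 + INR j + 1)); [lra |]. lra.
  - assert (h := fcoeff_S (S n)).
    assert (h2 := INR_ge_1 (S n) ltac:(lia)).
    assert (0 <= (INR (S n) - a) * (INR (S n) + INR j - a))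
      by (apply Rmult_le_pos; lra).
    assert (0 < (INR (S n) + 1) * (INR (S n) + INR j + 1))
      by (apply Rmult_lt_0_compat; lra).
    apply Rmult_le_reg_l with ((INR (S n) + 1) * (INR (S n) + INR j + 1)); [easy |].
    rewrite h, Rmult_0_r.
    assert (0 <= (INR (S n) - a) * (INR (S n) + INR j - a) * - fcoeff a j (S n))
      by (apply Rmult_le_pos; lra).
    lra.
Qed.

(* From the recurrence,
   [(n+1)(n+1+j) c_(n+1) - n(n+j) c_n = - 2 a n c_n - a (j-a) c_n]. *)
Lemma fcoeff_telescope (N : nat) :
  (INR N + 1) * (INR N + INR j + 1) * fcoeff a j (S N)
  = - (2 * a) * sum_n (fun n => INR n * fcoeff a j n) N
    - a * (INR j - a) * sum_n (fcoeff a j) N.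
Proof.
  induction N as [| N IH].
  - rewrite !sum_O, fcoeff_S, fcoeff_0. simpl. ring.
  - rewrite !sum_Sn. unfold plus; simpl plus. rewrite fcoeff_S.
    rewrite S_INR. simpl. lra.
Qed.

(** The left side of [fcoeff_telescope] has the sign of a later coefficient. Dropping this
    nonpositive term and dividing by [2 a] leaves the factor [(j - a) / 2]. *)
Lemma fcoeff_moment_partial (N : nat) :
  sum_n (fun n => INR n * - fcoeff a j n) N
  <= (INR j - a) / 2 * sum_n (fcoeff a j) N.
Proof.
  assert (h1 := INR_ge_1 j hj). assert (hN : 0 <= INR N) by apply pos_INR.
  assert (h := fcoeff_telescope N). assert (hn := fcoeff_nonpos N).
  assert (e : sum_n (fun n => INR n * - fcoeff a j n) N
              = - sum_n (fun n => INR n * fcoeff a j n) N).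
  { clear. induction N as [| N IH].
    - rewrite !sum_O. simpl. ring.
    - rewrite !sum_Sn, IH. unfold plus; simpl. ring. }
  rewrite e.
  assert (0 <= (INR N + 1) * (INR N + INR j + 1) * - fcoeff a j (S N))
    by (apply Rmult_le_pos; [apply Rmult_le_pos; lra | lra]).
  apply Rmult_le_reg_l with (2 * a); [lra |]. lra.
Qed.

Lemma fcoeff_sum_le_1 (N : nat) :
  sum_n (fcoeff a j) N <= 1.
Proof.
  induction N as [| N IH].
  - rewrite sum_O, fcoeff_0. lra.
  - rewrite sum_Sn. unfold plus; simpl. assert (h := fcoeff_nonpos N). lra.
Qed.

Lemma fcoeff_moment_pos (n : nat) :
  0 <= INR n * - fcoeff a j n.
Proof.
  destruct n as [| n]; [simpl; lra |].
  apply Rmult_le_pos; [apply pos_INR |].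
  assert (h := fcoeff_nonpos n). lra.
Qed.

Lemma ex_series_fcoeff_moment :
  ex_series (fun n => INR n * - fcoeff a j n).
Proof.
  apply ex_series_pos_bounded with ((INR j - a) / 2).
  - intros n. now apply fcoeff_moment_pos.
  - intros N. apply Rle_trans with (1 := fcoeff_moment_partial N).
    rewrite <- (Rmult_1_r ((INR j - a) / 2)) at 2.
    assert (h1 := INR_ge_1 j hj).
    apply Rmult_le_compat_l; [lra | now apply fcoeff_sum_le_1].
Qed.

Lemma ex_series_fcoeff_abs :
  ex_series (fun n => Rabs (fcoeff a j n)).
Proof.
  apply (ex_series_incr_1 (V := R_NormedModule)).
  apply (ex_series_le (V := R_CompleteNormedModule))
    with (fun n => INR (S n) * - fcoeff a j (S n)).
  - intros n. assert (h := fcoeff_nonpos n).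
    change (Rabs (Rabs (fcoeff a j (S n))) <= INR (S n) * - fcoeff a j (S n)).
    rewrite Rabs_Rabsolu, Rabs_left1 by easy.
    assert (h1 := INR_ge_1 (S n) ltac:(lia)). nra.
  - apply (ex_series_incr_1 (V := R_NormedModule) (fun n => INR n * - fcoeff a j n)).
    now apply ex_series_fcoeff_moment.
Qed.

Lemma ex_series_fcoeff (t : R)
  (ht : 0 <= t <= 1) : ex_series (fun n => fcoeff a j n * t ^ n).
Proof.
  apply (ex_series_le (V := R_CompleteNormedModule))
    with (2 := ex_series_fcoeff_abs).
  intros n. change (Rabs (fcoeff a j n * t ^ n) <= Rabs (fcoeff a j n)).
  rewrite Rabs_mult, (Rabs_pos_eq (t ^ n)) by (apply pow_le; lra).
  rewrite <- (Rmult_1_r (Rabs (fcoeff a j n))) at 2.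
  apply Rmult_le_compat_l; [apply Rabs_pos |].
  rewrite <- (pow1 n). apply pow_incr. lra.
Qed.

Lemma fcoeff_radius :
  Rbar_le 1 (CV_radius (fcoeff a j)).
Proof.
  apply CV_radius_ge.
  apply (ex_series_ext (V := R_NormedModule) (fun n => Rabs (fcoeff a j n))).
  - intros n. now rewrite pow1, Rmult_1_r.
  - now apply ex_series_fcoeff_abs.
Qed.

Lemma Fser_1 : Fser a j 1 = Series (fcoeff a j).
Proof. apply Series_ext. intros n. rewrite pow1. ring. Qed.

Lemma Fser_0 : Fser a j 0 = 1.
Proof. unfold Fser. now rewrite PSeries_0, fcoeff_0. Qed.

Lemma fcoeff_moment :
  Series (fun n => INR n * - fcoeff a j n) <= (INR j - a) / 2 * Fser a j 1.
Proof.
  assert (h1 : ex_series (fcoeff a j))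
    by now apply ex_series_Rabs, ex_series_fcoeff_abs.
  rewrite Fser_1.
  apply (is_lim_seq_le (sum_n (fun n => INR n * - fcoeff a j n))
           (fun N => (INR j - a) / 2 * sum_n (fcoeff a j) N)
           (Series (fun n => INR n * - fcoeff a j n))
           ((INR j - a) / 2 * Series (fcoeff a j))).
  - intros N. now apply fcoeff_moment_partial.
  - apply Series_correct. now apply ex_series_fcoeff_moment.
  - apply (is_lim_seq_scal_l (sum_n (fcoeff a j)) ((INR j - a) / 2)
             (Finite (Series (fcoeff a j)))).
    now apply Series_correct.
Qed.

(** Termwise, [- c_n (t^n - s^n)] lies between 0 and [n (- c_n) (t - s)], and the first moment of
    the coefficients is already bounded. The estimate reaches [t = 1], which lets every value of
    [F_j] be compared with [F_j(1)]. *)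
Lemma Fser_slope (s t : R)
  (hs : 0 <= s) (hst : s <= t) (ht : t <= 1) :
  0 <= Fser a j s - Fser a j t <= (INR j - a) / 2 * Fser a j 1 * (t - s).
Proof.
  assert (es := ex_series_fcoeff s ltac:(lra)).
  assert (et := ex_series_fcoeff t ltac:(lra)).
  assert (ed : Fser a j s - Fser a j t
               = Series (fun n => fcoeff a j n * s ^ n - fcoeff a j n * t ^ n))
    by now rewrite Series_minus.
  rewrite ed.
  assert (hb : forall n, 0 <= fcoeff a j n * s ^ n - fcoeff a j n * t ^ n
                <= INR n * - fcoeff a j n * (t - s)).
  { intros n. assert (hd := pow_diff_bounds s t n hs hst ht).
    destruct n as [| n]; [simpl; lra |].
    assert (hn := fcoeff_nonpos n).
    replace (fcoeff a j (S n) * s ^ S n - fcoeff a j (S n) * t ^ S n)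
      with (- fcoeff a j (S n) * (t ^ S n - s ^ S n)) by ring.
    split; [apply Rmult_le_pos; lra |].
    replace (INR (S n) * - fcoeff a j (S n) * (t - s))
      with (- fcoeff a j (S n) * (INR (S n) * (t - s))) by ring.
    apply Rmult_le_compat_l; lra. }
  assert (em : ex_series (fun n => INR n * - fcoeff a j n * (t - s))).
  { apply (ex_series_scal_r (t - s) (fun n => INR n * - fcoeff a j n)).
    now apply ex_series_fcoeff_moment. }
  split.
  - rewrite <- (Rmult_0_l (Series (fun n => fcoeff a j n * s ^ n - fcoeff a j n * t ^ n))).
    rewrite <- Series_scal_l. apply Series_le.
    + intros n. specialize (hb n). lra.
    + now apply (ex_series_minus (V := R_NormedModule)).
  - apply Rle_trans with (Series (fun n => INR n * - fcoeff a j n * (t - s))).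
    + now apply Series_le.
    + rewrite (Series_scal_r (t - s) (fun n => INR n * - fcoeff a j n)).
      apply Rmult_le_compat_r; [lra | now apply fcoeff_moment].
Qed.

End radial_factor.

Lemma at_left_1_intro (P : R -> Prop) (d : R) (hd : 0 < d)
  (h : forall t, 0 <= t < 1 -> 1 - t < d -> P t) : at_left 1 P.
Proof.
  assert (hm : 0 < Rmin 1 d) by (apply Rmin_glb_lt; lra).
  exists (mkposreal _ hm). intros t ht ht1.
  assert (m1 := Rmin_l 1 d). assert (m2 := Rmin_r 1 d).
  apply Rabs_def2 in ht. unfold minus, plus, opp in ht; simpl in ht. apply h; lra.
Qed.

Lemma F_fun_lim (alpha : R) (j : nat) (ha : 0 < alpha <= 2) (hj : (1 <= j)%nat) :
  filterlim (F_fun alpha j) (at_left 1) (locally (Fser (alpha / 2) j 1)).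
Proof.
  set (a := alpha / 2). assert (haa : 0 < a <= 1) by (unfold a; lra).
  set (K := (INR j - a) / 2 * Fser a j 1).
  intros P [eps hP]. destruct eps as [eps heps].
  assert (hK0 := Rabs_pos K).
  (* The summand 1 keeps the divisor positive: [K] vanishes for [j = 1], [a = 1]. *)
  apply at_left_1_intro with (eps / (Rabs K + 1)); [apply Rdiv_lt_0_compat; lra |].
  intros t ht htd. apply hP.
  assert (h := Fser_slope a j haa hj t 1 ltac:(lra) ltac:(lra) ltac:(lra)).
  fold K in h. change (F_fun alpha j t) with (Fser a j t).
  change (Rabs (Fser a j t - Fser a j 1) < eps). rewrite Rabs_pos_eq by easy.
  apply Rle_lt_trans with (1 := proj2 h).
  assert (hK := Rle_abs K).
  assert (K * (1 - t) <= (Rabs K + 1) * (1 - t)) by (apply Rmult_le_compat_r; lra).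
  apply Rle_lt_trans with (1 := H).
  apply Rlt_le_trans with ((Rabs K + 1) * (eps / (Rabs K + 1))).
  - apply Rmult_lt_compat_l; lra.
  - right. field. lra.
Qed.

Lemma F_at_1_eq (alpha : R) (j : nat) (ha : 0 < alpha <= 2) (hj : (1 <= j)%nat) :
  F_at_1 alpha j = Fser (alpha / 2) j 1.
Proof.
  assert (h := F_fun_lim alpha j ha hj).
  apply (iota_unique (V := R_CompleteNormedModule)); [| exact h].
  intros y hy. exact (filterlim_locally_unique (F_fun alpha j) _ _ hy h).
Qed.

(** A geometric majorant lets the finitely many exceptional coefficients in [PSeries_ratio_lim]
    contribute at most [2 B], uniformly in [t]. *)
Lemma finite_geometric_bound (e : nat -> R) (N : nat) :
  exists B, 0 <= B /\ forall n, (n < N)%nat -> e n <= B * (1 / 2) ^ n.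
Proof.
  induction N as [| N (B & hB & h)].
  - exists 0. split; [lra | lia].
  - assert (hp : 0 < (1 / 2) ^ N) by (apply pow_lt; lra).
    assert (hq : 0 <= Rabs (e N) / (1 / 2) ^ N).
    { apply Rmult_le_pos; [apply Rabs_pos |]. now apply Rlt_le, Rinv_0_lt_compat. }
    exists (B + Rabs (e N) / (1 / 2) ^ N). split; [lra |].
    intros n hn. assert (hp' : 0 < (1 / 2) ^ n) by (apply pow_lt; lra).
    destruct (Nat.eq_dec n N) as [-> | hne].
    + replace ((B + Rabs (e N) / (1 / 2) ^ N) * (1 / 2) ^ N)
        with (B * (1 / 2) ^ N + Rabs (e N)) by (field; lra).
      assert (h1 := Rle_abs (e N)). assert (0 <= B * (1 / 2) ^ N) by nra. lra.
    + assert (h1 := h n ltac:(lia)). nra.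
Qed.

(** An Abelian theorem: beyond some index [g_n] is within [eps / 2 * d_n] of [K d_n], and the
    bounded contribution of the earlier terms is negligible against the denominator, which blows up
    at 1. *)
Lemma PSeries_ratio_lim (g d : nat -> R) (K : R) (hd : forall n, 0 < d n)
  (hrg : Rbar_le 1 (CV_radius g)) (hrd : Rbar_le 1 (CV_radius d))
  (hlim : is_lim_seq (fun n => g n / d n) K)
  (hinf : filterlim (fun t => / PSeries d t) (at_left 1) (locally 0)) :
  filterlim (fun t => PSeries g t / PSeries d t) (at_left 1) (locally K).
Proof.
  intros P [eps hP]. destruct eps as [eps heps].
  assert (h2 : 0 < eps / 2) by lra.
  apply is_lim_seq_spec in hlim. destruct (hlim (mkposreal _ h2)) as [N hN].
  simpl in hN.
  destruct (finite_geometric_bound (fun n => Rabs (g n - K * d n)) N) as (B & hB & hBn).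
  assert (he : forall n, Rabs (g n - K * d n) <= eps / 2 * d n + B * (1 / 2) ^ n).
  { intros n. assert (hdn := hd n).
    assert (hp' : 0 < (1 / 2) ^ n) by (apply pow_lt; lra).
    destruct (Nat.lt_ge_cases n N) as [hn | hn].
    - assert (h := hBn n hn). simpl in h. nra.
    - assert (h := hN n hn).
      replace (g n - K * d n) with ((g n / d n - K) * d n) by (field; lra).
      rewrite Rabs_mult, (Rabs_pos_eq (d n)) by lra. nra. }
  assert (h3 : 0 < eps / (2 * (2 * B + 1))) by (apply Rdiv_lt_0_compat; lra).
  destruct (hinf (fun y => Rabs y < eps / (2 * (2 * B + 1)))) as [del hdel].
  { exists (mkposreal _ h3). intros y hy.
    change (Rabs (y - 0) < eps / (2 * (2 * B + 1))) in hy. now rewrite Rminus_0_r in hy. }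
  apply at_left_1_intro with del; [apply cond_pos |]. intros t ht0 htd. apply hP.
  assert (hta := Rabs_lt_1 t ht0).
  assert (hD : 0 < PSeries d t).
  { apply Rlt_le_trans with (d O); [apply hd | now apply PSeries_pos_ge_coeff0]. }
  assert (hinv : / PSeries d t < eps / (2 * (2 * B + 1))).
  { apply Rle_lt_trans with (1 := Rle_abs _). apply hdel; [| lra].
    apply Rabs_def1; unfold minus, plus, opp; simpl; lra. }
  assert (eg : ex_series (fun n => g n * t ^ n))
    by (apply ex_series_Rabs, CV_disk_inside; now apply inside_radius_1).
  assert (ed : ex_series (fun n => d n * t ^ n))
    by (apply ex_series_Rabs, CV_disk_inside; now apply inside_radius_1).
  assert (eG : is_series (fun n => (1 / 2) ^ n) (/ (1 - 1 / 2)))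
    by (apply is_series_geom; rewrite Rabs_pos_eq; lra).
  assert (ek : ex_series (fun n => K * (d n * t ^ n)))
    by now apply (ex_series_scal_l K (fun n => d n * t ^ n)).
  assert (eb : ex_series (fun n => eps / 2 * (d n * t ^ n) + B * (1 / 2) ^ n)).
  { apply (ex_series_plus (V := R_NormedModule) (fun n => eps / 2 * (d n * t ^ n))
             (fun n => B * (1 / 2) ^ n)).
    - now apply (ex_series_scal_l (eps / 2) (fun n => d n * t ^ n)).
    - apply (ex_series_scal_l B (fun n => (1 / 2) ^ n)). eexists; exact eG. }
  assert (hle : forall n, Rabs (g n * t ^ n - K * (d n * t ^ n))
            <= eps / 2 * (d n * t ^ n) + B * (1 / 2) ^ n).
  { intros n. replace (g n * t ^ n - K * (d n * t ^ n)) with ((g n - K * d n) * t ^ n) by ring.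
    assert (hp1 : 0 <= t ^ n) by (apply pow_le; lra).
    assert (hp2 : t ^ n <= 1) by (rewrite <- (pow1 n); apply pow_incr; lra).
    assert (hp' : 0 < (1 / 2) ^ n) by (apply pow_lt; lra).
    rewrite Rabs_mult, (Rabs_pos_eq (t ^ n)) by easy.
    assert (h := he n). assert (hdn := hd n).
    apply Rle_trans with ((eps / 2 * d n + B * (1 / 2) ^ n) * t ^ n).
    - now apply Rmult_le_compat_r.
    - assert (0 <= B * (1 / 2) ^ n) by nra. nra. }
  assert (hmain : Rabs (PSeries g t - K * PSeries d t) <= eps / 2 * PSeries d t + 2 * B).
  { unfold PSeries. rewrite <- Series_scal_l, <- Series_minus by easy.
    apply Rle_trans with (1 := proj2 (Series_dominated _ _ hle eb)).
    rewrite Series_plus, (Series_scal_l (eps / 2)), (Series_scal_l B),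
      (is_series_unique (pow (1 / 2)) _ eG).
    - right. field.
    - now apply (ex_series_scal_l (eps / 2) (fun n => d n * t ^ n)).
    - apply (ex_series_scal_l B (fun n => (1 / 2) ^ n)). eexists; exact eG. }
  change (Rabs (PSeries g t / PSeries d t - K) < eps).
  replace (PSeries g t / PSeries d t - K)
    with ((PSeries g t - K * PSeries d t) * / PSeries d t) by (field; lra).
  assert (hi : 0 < / PSeries d t) by now apply Rinv_0_lt_compat.
  rewrite Rabs_mult, (Rabs_pos_eq (/ PSeries d t)) by lra.
  apply Rle_lt_trans with ((eps / 2 * PSeries d t + 2 * B) * / PSeries d t).
  - apply Rmult_le_compat_r; lra.
  - replace ((eps / 2 * PSeries d t + 2 * B) * / PSeries d t)
      with (eps / 2 + 2 * B * / PSeries d t) by (field; lra).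
    assert (2 * B * / PSeries d t <= (2 * B + 1) * / PSeries d t) by nra.
    assert ((2 * B + 1) * / PSeries d t < (2 * B + 1) * (eps / (2 * (2 * B + 1))))
      by (apply Rmult_lt_compat_l; lra).
    replace ((2 * B + 1) * (eps / (2 * (2 * B + 1)))) with (eps / 2) in H0
      by (field; lra).
    lra.
Qed.

Lemma Rpower_lim_0 (p : R) (hp : 0 < p) :
  filterlim (fun t => Rpower (1 - t) p) (at_left 1) (locally 0).
Proof.
  intros P [eps hP]. destruct (Rpower_small p eps hp (cond_pos eps)) as (d & hd & h).
  apply at_left_1_intro with d; [exact hd |]. intros t ht htd. apply hP.
  change (Rabs (Rpower (1 - t) p - 0) < eps).
  rewrite Rminus_0_r, Rabs_pos_eq by apply Rlt_le, exp_pos. apply h. lra.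
Qed.

Lemma Gamma_ratio_lim (a : R) (j : nat) (ha : 0 < a <= 1) :
  is_lim_seq (fun n => (Gamma (INR n + 1 + INR j + a) * Gamma (INR n + 1 + a))
     / (Gamma (INR n + 1 + INR j) * Gamma (INR n + 1 + a + a))) 1.
Proof.
  assert (hj : 0 <= INR j) by apply pos_INR.
  apply is_lim_seq_le_le with
    (fun n => (INR n + 1 + INR j) / (INR n + 1 + INR j + a))
    (fun n => (1 + a + a + INR n) / (1 + a + INR n)
              * ((1 + a + Rabs (INR j - a) + INR n) / (1 + a + INR n))).
  - intros n. assert (0 <= INR n) by apply pos_INR.
    assert (h := Gamma_ratio_bounds (INR n + 1 + INR j) (INR n + 1 + a) a
                   ltac:(lra) ltac:(lra) ltac:(lra) ltac:(lra)).
    replace (INR n + 1 + INR j - (INR n + 1 + a)) with (INR j - a) in h by ring.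
    split; [exact (proj1 h) |]. apply Rle_trans with (1 := proj2 h).
    right. field. lra.
  - apply is_lim_seq_ext with (fun n => (1 + INR j + INR n) / (1 + INR j + a + INR n)).
    + intros n. f_equal; ring.
    + apply is_lim_seq_shifted_ratio. lra.
  - replace (Finite 1) with (Finite (1 * 1)) by (f_equal; ring).
    apply is_lim_seq_mult'; apply is_lim_seq_shifted_ratio; lra.
Qed.

(* By Euler's transformation F_j is the quotient of a hypergeometric series by the
   binomial series of exponent [1 + 2 a], and the quotient of the coefficients
   converges to the value below. *)
Lemma Fser_gauss (a : R) (j : nat) (ha : 0 < a <= 1) (hj : (1 <= j)%nat) :
  Fser a j 1 = Gamma (INR j + 1) * Gamma (1 + 2 * a)
               / (Gamma (INR j + 1 + a) * Gamma (1 + a)).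
Proof.
  set (K := Gamma (INR j + 1) * Gamma (1 + 2 * a)
               / (Gamma (INR j + 1 + a) * Gamma (1 + a))).
  assert (hj1 := INR_ge_1 j hj).
  set (g := hyp_coeff (INR j + 1 - - a) (INR j + 1 - (INR j - a)) (INR j + 1)).
  set (d := binom_coeff (1 + 2 * a)).
  assert (hd : forall n, 0 < d n) by (intros; apply binom_coeff_pos; lra).
  assert (hrg : CV_radius g = 1) by (apply hyp_coeff_radius; lra).
  assert (hrd : CV_radius d = 1) by (apply binom_coeff_radius; lra).
  assert (hD : forall t, 0 <= t < 1 -> / PSeries d t = Rpower (1 - t) (1 + 2 * a)).
  { intros t ht. assert (h := binom_series (1 + 2 * a) t ltac:(lra) ht). fold d in h.
    assert (PSeries d t <> 0) by (intros e; rewrite e in h; lra).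
    apply Rmult_eq_reg_l with (PSeries d t); [| easy].
    rewrite h. field. easy. }
  assert (hloc : forall (P : R -> Prop), (forall t, 0 <= t < 1 -> P t) -> at_left 1 P).
  { intros P h. apply at_left_1_intro with 1; [lra |].
    intros t ht _. now apply h. }
  assert (L : filterlim (Fser a j) (at_left 1) (locally K)).
  { apply filterlim_ext_loc with (fun t => PSeries g t / PSeries d t).
    (* Here [C - A - B = 1 + 2 a], so Euler's power of [1 - t] is exactly the reciprocal of the
       binomial series [d]. *)
    - apply hloc. intros t ht. unfold Rdiv. rewrite hD by easy.
      unfold Fser, fcoeff.
      rewrite (hyp_euler (- a) (INR j - a) j (1 + 2 * a)); try easy; try lra.
      + fold g. ring.
      + now apply fcoeff_radius.
    - apply PSeries_ratio_lim; try easy.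
      + rewrite hrg. apply Rle_refl.
      + rewrite hrd. apply Rle_refl.
      + apply is_lim_seq_ext with (fun n => K *
          ((Gamma (INR n + 1 + INR j + a) * Gamma (INR n + 1 + a))
           / (Gamma (INR n + 1 + INR j) * Gamma (INR n + 1 + a + a)))).
        * intros n. assert (hn : 0 <= INR n) by apply pos_INR.
          unfold K, g, d, hyp_coeff, binom_coeff.
          replace (INR j + 1 - - a) with (INR j + 1 + a) by ring.
          replace (INR j + 1 - (INR j - a)) with (1 + a) by ring.
          replace (INR n + 1 + INR j + a) with (INR j + 1 + a + INR n) by ring.
          replace (INR n + 1 + a + a) with (1 + 2 * a + INR n) by ring.
          replace (INR n + 1 + a) with (1 + a + INR n) by ring.
          replace (INR n + 1 + INR j) with (INR j + 1 + INR n) by ring.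
          rewrite !Gamma_pochhammer by lra.
          assert (h1 := INR_fact_lt_0 n).
          assert (h2 := pochhammer_pos (INR j + 1) n ltac:(lra)).
          assert (h3 := pochhammer_pos (1 + 2 * a) n ltac:(lra)).
          assert (h4 := Gamma_pos (INR j + 1) ltac:(lra)).
          assert (h5 := Gamma_pos (INR j + 1 + a) ltac:(lra)).
          assert (h6 := Gamma_pos (1 + a) ltac:(lra)).
          assert (h7 := Gamma_pos (1 + 2 * a) ltac:(lra)).
          field. repeat split; lra.
        * replace (Finite K) with (Rbar_mult K 1) by (simpl; f_equal; ring).
          apply is_lim_seq_scal_l. now apply Gamma_ratio_lim.
      + apply filterlim_ext_loc with (fun t => Rpower (1 - t) (1 + 2 * a)).
        * apply hloc. intros t ht. symmetry. now apply hD.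
        * apply Rpower_lim_0. lra. }
  (* The Lipschitz estimate already provides the left limit [F_j(1)]; uniqueness of limits
     identifies it with [K]. *)
  assert (L' := F_fun_lim (2 * a) j ltac:(lra) hj).
  replace (2 * a / 2) with a in L' by field.
  apply (filterlim_locally_unique (Fser a j) _ _) with (2 := L).
  apply filterlim_ext with (2 := L'). intros t. unfold F_fun, hypergeometric.
  replace (2 * a / 2) with a by field. easy.
Qed.

Lemma Fser_1_pos (a : R) (j : nat) (ha : 0 < a <= 1) (hj : (1 <= j)%nat) :
  0 < Fser a j 1.
Proof.
  rewrite Fser_gauss by easy. assert (h := INR_ge_1 j hj).
  apply Rdiv_lt_0_compat; apply Rmult_lt_0_compat; apply Gamma_pos; lra.
Qed.

(** The kernel multiplies the boundary mode of frequency [j] by [c_alpha (a+1)_j / j!] times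
    [F_j(r^2) r^j]. This identity is why data weighted by [F_j(1)] give [F_j(|z|^2) z^j] with
    coefficient 1. *)
Lemma Fser_normalization (a : R) (j : nat) (ha : 0 < a <= 1) (hj : (1 <= j)%nat) :
  Gamma (a + 1) ^ 2 / Gamma (1 + 2 * a) * binom_coeff (a + 1) j * Fser a j 1 = 1.
Proof.
  assert (h := INR_ge_1 j hj).
  rewrite Fser_gauss by easy. unfold binom_coeff. rewrite <- (Gamma_nat_succ j).
  replace (INR j + 1 + a) with (a + 1 + INR j) by ring.
  rewrite (Rplus_comm 1 a), (Gamma_pochhammer (a + 1)) by lra.
  assert (h2 := pochhammer_pos (a + 1) j ltac:(lra)).
  assert (h4 := Gamma_pos (INR j + 1) ltac:(lra)).
  assert (h6 := Gamma_pos (a + 1) ltac:(lra)).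
  assert (h7 := Gamma_pos (1 + 2 * a) ltac:(lra)).
  field. repeat split; lra.
Qed.

(** The common factor [Gamma (1 + 2 a) / Gamma (1 + a)] cancels. What remains is the Gamma
    expression occurring in [M_bound] and [N_bound]. *)
Lemma Fser_ratio (a : R) (k : nat) (ha : 0 < a <= 1) (hk : (1 <= k)%nat) :
  Fser a k 1 / Fser a 1 1
  = Gamma (INR k + 1) * Gamma (2 + a) / Gamma (INR k + 1 + a).
Proof.
  assert (h := INR_ge_1 k hk).
  rewrite !Fser_gauss by (try easy; lia). simpl (INR 1).
  replace (Gamma (1 + 1)) with 1
    by (rewrite Gamma_succ, Gamma_1 by lra; ring).
  replace (1 + 1 + a) with (2 + a) by ring.
  assert (h4 := Gamma_pos (INR k + 1) ltac:(lra)).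
  assert (h5 := Gamma_pos (INR k + 1 + a) ltac:(lra)).
  assert (h6 := Gamma_pos (1 + a) ltac:(lra)).
  assert (h7 := Gamma_pos (1 + 2 * a) ltac:(lra)).
  assert (h8 := Gamma_pos (2 + a) ltac:(lra)).
  field. repeat split; lra.
Qed.

Lemma pochhammer_le (x y : R) (n : nat) (hx : 0 < x) (hxy : x <= y) :
  pochhammer x n <= pochhammer y n.
Proof.
  induction n as [| n IH]; simpl; [lra |].
  assert (0 <= INR n) by apply pos_INR. assert (h := pochhammer_pos x n hx).
  apply Rmult_le_compat; lra.
Qed.

(** For [k = m + 1] the quotient equals [(2)_m / (2 + a)_m], a product of factors at most 1. *)
Lemma Fser_1_antitone (a : R) (k : nat) (ha : 0 < a <= 1) (hk : (1 <= k)%nat) :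
  Fser a k 1 <= Fser a 1 1.
Proof.
  assert (h1 := Fser_1_pos a 1 ha (le_n 1)).
  assert (h : Fser a k 1 / Fser a 1 1 <= 1).
  { rewrite Fser_ratio by easy. destruct k as [| k]; [lia |].
    rewrite S_INR. assert (hn : 0 <= INR k) by apply pos_INR.
    replace (INR k + 1 + 1) with (2 + INR k) by ring.
    replace (2 + INR k + a) with (2 + a + INR k) by ring.
    rewrite !Gamma_pochhammer by lra.
    replace (Gamma 2) with 1
      by (replace 2 with (1 + 1) by ring; rewrite Gamma_succ, Gamma_1 by lra; ring).
    assert (h8 := Gamma_pos (2 + a) ltac:(lra)).
    assert (h9 := pochhammer_pos (2 + a) k ltac:(lra)).
    assert (h10 := pochhammer_le 2 (2 + a) k ltac:(lra) ltac:(lra)).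
    apply Rmult_le_reg_r with (pochhammer (2 + a) k * Gamma (2 + a)).
    - now apply Rmult_lt_0_compat.
    - transitivity (pochhammer 2 k * Gamma (2 + a)); [right; field; lra |].
      rewrite Rmult_1_l. apply Rmult_le_compat_r; lra. }
  apply Rmult_le_compat_r with (r := Fser a 1 1) in h; [| lra].
  replace (Fser a k 1 / Fser a 1 1 * Fser a 1 1) with (Fser a k 1) in h by (field; lra).
  lra.
Qed.

(** * Perturbation of the identity on the closed disk *)

Definition inner (z w : R * R) : R := fst z * fst w + snd z * snd w.
Definition dsq (z w : R * R) : R := (fst z - fst w) ^ 2 + (snd z - snd w) ^ 2.
Definition normsq (z : R * R) : R := fst z ^ 2 + snd z ^ 2.
Definition polar (r theta : R) : R * R := (r * cos theta, r * sin theta).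

(** The complex power [z^n] in real coordinates, in a form suited to induction on continuity and
    partial derivatives. *)
Fixpoint zpow (n : nat) (z : R * R) : R * R :=
  match n with
  | O => (1, 0)
  | S m => (fst z * fst (zpow m z) - snd z * snd (zpow m z),
            fst z * snd (zpow m z) + snd z * fst (zpow m z))
  end.

Lemma zpow_polar (n : nat) (r theta : R) :
  zpow n (polar r theta) = (r ^ n * cos (INR n * theta), r ^ n * sin (INR n * theta)).
Proof.
  induction n as [| n IH].
  - simpl. rewrite Rmult_0_l, cos_0, sin_0. f_equal; ring.
  - simpl zpow. rewrite IH, S_INR.
    replace ((INR n + 1) * theta) with (theta + INR n * theta) by ring.
    rewrite cos_plus, sin_plus. simpl. f_equal; ring.
Qed.

Lemma normsq_polar (r theta : R) : normsq (polar r theta) = r ^ 2.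
Proof.
  unfold normsq, polar; simpl fst; simpl snd.
  transitivity (r ^ 2 * (sin theta ^ 2 + cos theta ^ 2)); [ring |].
  rewrite sin_cos_sq. ring.
Qed.

(** The angle is confined to a compact interval so that [Omega_set_uniform] can attain a maximum
    over it. *)
Lemma unit_angle (x y : R) (h : x ^ 2 + y ^ 2 = 1) :
  exists theta, - PI <= theta <= PI /\ x = cos theta /\ y = sin theta.
Proof.
  assert (hx : -1 <= x <= 1) by nra.
  assert (hs : sin (acos x) = Rabs y).
  { rewrite sin_acos by easy. replace (1 - Rsqr x) with (Rsqr y)
      by (unfold Rsqr; simpl in h; lra).
    apply sqrt_Rsqr_abs. }
  assert (hb := acos_bound x).
  destruct (Rle_or_lt 0 y) as [hy | hy].
  - exists (acos x). rewrite cos_acos, hs, Rabs_pos_eq by easy.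
    repeat split; lra.
  - exists (- acos x). rewrite cos_neg, sin_neg, cos_acos, hs, Rabs_left by easy.
    repeat split; lra.
Qed.

Lemma normsq_pos (z : R * R) : 0 <= normsq z.
Proof. unfold normsq. nra. Qed.

Lemma polar_form (z : R * R) :
  exists theta, - PI <= theta <= PI /\ z = polar (sqrt (normsq z)) theta.
Proof.
  assert (hn := normsq_pos z). assert (hs := sqrt_sqrt _ hn).
  destruct (Rle_lt_or_eq_dec 0 _ hn) as [hpos | h0].
  - assert (hr := sqrt_lt_R0 _ hpos). set (r := sqrt (normsq z)) in *.
    destruct (unit_angle (fst z / r) (snd z / r)) as (theta & hb & hc & hsn).
    + replace ((fst z / r) ^ 2 + (snd z / r) ^ 2) with (normsq z / (r * r))
        by (unfold normsq; field; lra).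
      rewrite hs. field. lra.
    + exists theta. split; [easy |]. unfold polar. rewrite <- hc, <- hsn.
      destruct z as [x y]. simpl. f_equal; field; lra.
  - exists 0. split; [assert (h := PI_RGT_0); lra |].
    rewrite <- h0, sqrt_0. unfold polar. rewrite !Rmult_0_l.
    clear hn hs. unfold normsq in h0. destruct z as [x y]. simpl in h0.
    assert (hx : x = 0) by (apply Rsqr_0_uniq; unfold Rsqr; nra).
    assert (hy : y = 0) by (apply Rsqr_0_uniq; unfold Rsqr; nra).
    now rewrite hx, hy.
Qed.

Lemma dsq_pos (z w : R * R) : 0 <= dsq z w.
Proof. apply Rplus_le_le_0_compat; apply pow2_ge_0. Qed.

Lemma dsq_eq0 (z w : R * R) (h : dsq z w <= 0) : z = w.
Proof.
  unfold dsq in h. destruct z as [x y], w as [x' y']. simpl in h.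
  assert (h1 := Rle_0_sqr (x - x')). assert (h2 := Rle_0_sqr (y - y')).
  unfold Rsqr in h1, h2.
  assert (x - x' = 0) by (apply Rsqr_0_uniq; unfold Rsqr; lra).
  assert (y - y' = 0) by (apply Rsqr_0_uniq; unfold Rsqr; lra). f_equal; lra.
Qed.

Lemma dsq_polar (r s alpha beta : R) :
  dsq (polar r alpha) (polar s beta)
  = (r - s) ^ 2 + 2 * (r * s) * (1 - cos (alpha - beta)).
Proof.
  rewrite cos_minus. unfold dsq, polar. simpl fst. simpl snd.
  transitivity (r ^ 2 * (sin alpha ^ 2 + cos alpha ^ 2)
    + s ^ 2 * (sin beta ^ 2 + cos beta ^ 2)
    - 2 * (r * s) * (cos alpha * cos beta + sin alpha * sin beta)); [ring |].
  rewrite !sin_cos_sq. ring.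
Qed.

Lemma one_minus_cos_pos (t : R) : 0 <= 1 - cos t.
Proof. assert (h := COS_bound t). lra. Qed.

Lemma one_minus_cos_half (t : R) : 1 - cos t = 2 * sin (t / 2) ^ 2.
Proof.
  replace t with (2 * (t / 2)) at 1 by field. rewrite cos_2a_sin. simpl. ring.
Qed.

Lemma abs_sin_mult_le (n : nat) (t : R) : Rabs (sin (INR n * t)) <= INR n * Rabs (sin t).
Proof.
  induction n as [| n IH].
  - simpl. rewrite Rmult_0_l, sin_0, Rabs_R0. lra.
  - rewrite S_INR. replace ((INR n + 1) * t) with (INR n * t + t) by ring.
    rewrite sin_plus. apply Rle_trans with (1 := Rabs_triang _ _).
    rewrite !Rabs_mult.
    assert (h1 : Rabs (cos t) <= 1) by (apply Rabs_le; apply COS_bound).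
    assert (h2 : Rabs (cos (INR n * t)) <= 1) by (apply Rabs_le; apply COS_bound).
    assert (h3 := Rabs_pos (sin t)). assert (h4 := Rabs_pos (sin (INR n * t))).
    nra.
Qed.

Lemma one_minus_cos_mult (n : nat) (t : R) :
  1 - cos (INR n * t) <= INR n ^ 2 * (1 - cos t).
Proof.
  rewrite !one_minus_cos_half.
  replace (INR n * t / 2) with (INR n * (t / 2)) by field.
  assert (h := abs_sin_mult_le n (t / 2)).
  assert (h1 : sin (INR n * (t / 2)) ^ 2 <= (INR n * Rabs (sin (t / 2))) ^ 2).
  { rewrite <- (pow2_abs (sin (INR n * (t / 2)))). apply pow_incr.
    split; [apply Rabs_pos | easy]. }
  rewrite Rpow_mult_distr, pow2_abs in h1. lra.
Qed.

(** The law of cosines splits a squared distance into a radial and an angular part, which the map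
    [(r, theta) -> (p(r), n theta)] changes separately. The angular part gains at most [n^2] from
    [1 - cos], absorbed by [n p <= L r] at the two radii. *)
Lemma polar_lipschitz (p q r s d L : R) (n : nat) (hn : (1 <= n)%nat) (hL : 0 <= L)
  (hr : 0 <= r) (hs : 0 <= s) (hp : 0 <= INR n * p <= L * r) (hq : 0 <= INR n * q <= L * s)
  (hpq : Rabs (p - q) <= L * Rabs (r - s)) :
  (p - q) ^ 2 + 2 * (p * q) * (1 - cos (INR n * d))
  <= L ^ 2 * ((r - s) ^ 2 + 2 * (r * s) * (1 - cos d)).
Proof.
  assert (hc := one_minus_cos_mult n d). assert (hd := one_minus_cos_pos d).
  assert (q1 : (p - q) ^ 2 <= L ^ 2 * (r - s) ^ 2).
  { rewrite <- (pow2_abs (p - q)), <- (pow2_abs (r - s)), <- Rpow_mult_distr.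
    apply pow_incr. split; [apply Rabs_pos | easy]. }
  assert (hn1 := INR_ge_1 n hn).
  assert (p1 : 0 <= p) by (apply Rmult_le_reg_l with (INR n); lra).
  assert (p2 : 0 <= q) by (apply Rmult_le_reg_l with (INR n); lra).
  assert (q2 : p * q * (1 - cos (INR n * d)) <= L ^ 2 * (r * s) * (1 - cos d)).
  { apply Rle_trans with (p * q * (INR n ^ 2 * (1 - cos d))).
    - apply Rmult_le_compat_l; [now apply Rmult_le_pos | easy].
    - replace (p * q * (INR n ^ 2 * (1 - cos d)))
        with ((INR n * p) * (INR n * q) * (1 - cos d)) by ring.
      replace (L ^ 2 * (r * s) * (1 - cos d)) with ((L * r) * (L * s) * (1 - cos d)) by ring.
      apply Rmult_le_compat_r; [easy |]. apply Rmult_le_compat; lra. }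
  lra.
Qed.

Lemma Rabs_symmetric_bound (f : R -> R) (L : R) (S : R -> Prop)
  (h : forall r s, S r -> S s -> s <= r -> Rabs (f r - f s) <= L * (r - s)) (r s : R)
  (hr : S r) (hs : S s) : Rabs (f r - f s) <= L * Rabs (r - s).
Proof.
  destruct (Rle_or_lt s r) as [hle | hlt].
  - rewrite (Rabs_pos_eq (r - s)) by lra. now apply h.
  - rewrite Rabs_minus_sym, (Rabs_minus_sym r), (Rabs_pos_eq (s - r)) by lra.
    apply h; try easy; lra.
Qed.

(* The mapping u, extended continuously to the closed unit disk. *)
Definition Vmap (a c : R) (k : nat) (z : R * R) : R * R :=
  (Fser a 1 (normsq z) * fst z + c * (Fser a k (normsq z) * fst (zpow k z)),
   Fser a 1 (normsq z) * snd z - c * (Fser a k (normsq z) * snd (zpow k z))).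

(* [Vmap z = z - V1 z + c V2 z]. *)
Definition V1 (a : R) (z : R * R) : R * R :=
  ((1 - Fser a 1 (normsq z)) * fst z, (1 - Fser a 1 (normsq z)) * snd z).
Definition V2 (a : R) (k : nat) (z : R * R) : R * R :=
  (Fser a k (normsq z) * fst (zpow k z), - (Fser a k (normsq z) * snd (zpow k z))).

(** The radial profile of [V1], which keeps angles; [eta] is that of [V2], which multiplies them by
    [- k]. *)
Definition rho (a r : R) : R := r * (1 - Fser a 1 (r ^ 2)).
Definition eta (a : R) (k : nat) (r : R) : R := r ^ k * Fser a k (r ^ 2).

Lemma V1_polar (a r theta : R) : V1 a (polar r theta) = polar (rho a r) theta.
Proof. unfold V1. rewrite normsq_polar. unfold polar, rho. simpl fst. simpl snd. f_equal; ring. Qed.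

Lemma V2_polar (a : R) (k : nat) (r theta : R) :
  V2 a k (polar r theta) = polar (eta a k r) (- (INR k * theta)).
Proof.
  unfold V2. rewrite zpow_polar, normsq_polar. unfold polar, eta.
  rewrite cos_neg, sin_neg. simpl fst. simpl snd. f_equal; ring.
Qed.

(** A product rule for differences: [(r - s) (1 - F_1(r^2))] contributes at most [1 - A], and
    [s (F_1(s^2) - F_1(r^2))] at most [(1 - a) A] since [s (r + s) <= 2]. The sum is [1 - a A], with
    [A = F_1(1)]. *)
Lemma rho_slope (a r s : R) (ha : 0 < a <= 1) (hs : 0 <= s) (hsr : s <= r) (hr : r <= 1) :
  0 <= rho a r - rho a s <= (1 - a * Fser a 1 1) * (r - s).
Proof.
  assert (hA := Fser_1_pos a 1 ha (le_n 1)).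
  assert (h := Fser_slope a 1 ha (le_n 1) (s ^ 2) (r ^ 2)
                 ltac:(nra) ltac:(nra) ltac:(nra)).
  assert (h1 := Fser_slope a 1 ha (le_n 1) (r ^ 2) 1 ltac:(nra) ltac:(nra) ltac:(lra)).
  assert (h2 := Fser_slope a 1 ha (le_n 1) 0 (r ^ 2) ltac:(lra) ltac:(nra) ltac:(nra)).
  rewrite Fser_0 in h2. simpl INR in *.
  set (A := Fser a 1 1) in *. set (fr := Fser a 1 (r ^ 2)) in *.
  set (fs := Fser a 1 (s ^ 2)) in *.
  assert (e : rho a r - rho a s = (r - s) * (1 - fr) + s * (fs - fr))
    by (unfold rho; fold fr fs; ring).
  rewrite e. split; [apply Rplus_le_le_0_compat; apply Rmult_le_pos; lra |].
  assert (q1 : (r - s) * (1 - fr) <= (r - s) * (1 - A)) by (apply Rmult_le_compat_l; lra).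
  assert (q2 : s * (fs - fr) <= s * ((1 - a) / 2 * A * (r ^ 2 - s ^ 2)))
    by (apply Rmult_le_compat_l; lra).
  assert (q4 : 0 <= (1 - a) / 2 * A * (r - s)) by (repeat apply Rmult_le_pos; lra).
  assert (q5 : (1 - a) / 2 * A * (r - s) * (s * (r + s))
               <= (1 - a) / 2 * A * (r - s) * 2) by (apply Rmult_le_compat_l; nra).
  lra.
Qed.

Lemma rho_0 (a : R) : rho a 0 = 0.
Proof. unfold rho. ring. Qed.

(** A Lipschitz constant of [V2]. The factor is [1 + (1 - a)/2]: writing [k - a = (k - 1) + (1 - a)]
    in the slope of [F_k], the first part is compensated by the decay of [r^(k-1)] and the second
    costs at most [(1 - a)/2]. *)
Definition Lam (a : R) (k : nat) : R := INR k * Fser a k 1 * ((3 - a) / 2).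

Lemma pow_concave_bound (m : nat) (r : R) (hr : 0 <= r <= 1) :
  r ^ m * (1 + INR m * ((1 - r ^ 2) / 2)) <= 1.
Proof.
  induction m as [| m IH]; [simpl; lra |].
  rewrite S_INR. simpl (r ^ S m).
  assert (h0 : 0 <= r ^ m) by (apply pow_le; lra).
  assert (hm : 0 <= INR m) by apply pos_INR.
  assert (hq : 0 <= (1 - r ^ 2) / 2) by nra.
  set (q := (1 - r ^ 2) / 2) in *. set (X := r ^ m * (1 + INR m * q)) in *.
  assert (hX : r ^ m <= X).
  { unfold X. assert (0 <= INR m * q) by now apply Rmult_le_pos. nra. }
  replace (r * r ^ m * (1 + (INR m + 1) * q)) with (r * (X + r ^ m * q))
    by (unfold X; ring).
  apply Rle_trans with (r * (1 + 1 * q)).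
  - apply Rmult_le_compat_l; [lra |]. apply Rplus_le_compat; [easy |].
    apply Rmult_le_compat_r; lra.
  (* [r (1 + q) <= 1] means [r^3 - 3 r + 2 >= 0], and this polynomial is [(1 - r)^2 (r + 2)]. *)
  - assert (0 <= (1 - r) ^ 2 * (r + 2))
      by (apply Rmult_le_pos; [apply pow2_ge_0 | lra]).
    unfold q. lra.
Qed.

(* [k r^(k-1) g(r^2) <= Lam]: bound [g] by its chord estimate at [t = 1] and use
   [r^(k-1) (1 + (k-1)(1-r^2)/2) <= 1]. *)
Lemma eta_factor_bound (a : R) (k : nat) (r : R) (ha : 0 < a <= 1) (hr : 0 <= r <= 1) :
  INR (S k) * (r ^ k * Fser a (S k) (r ^ 2)) <= Lam a (S k).
Proof.
  assert (hg := Fser_1_pos a (S k) ha ltac:(lia)).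
  assert (h1 := Fser_slope a (S k) ha ltac:(lia) (r ^ 2) 1 ltac:(nra) ltac:(nra) ltac:(lra)).
  assert (hp := pow_concave_bound k r hr).
  assert (h0 : 0 <= r ^ k) by (apply pow_le; lra).
  assert (h01 : r ^ k <= 1) by (rewrite <- (pow1 k); apply pow_incr; lra).
  unfold Lam. rewrite Rmult_assoc.
  assert (hk : 0 <= INR (S k)) by apply pos_INR.
  apply Rmult_le_compat_l; [easy |].
  rewrite S_INR in h1. set (g1 := Fser a (S k) 1) in *.
  set (g := Fser a (S k) (r ^ 2)) in *.
  apply Rle_trans with (r ^ k * (g1 * (1 + INR k * ((1 - r ^ 2) / 2))
                                 + g1 * ((1 - a) * ((1 - r ^ 2) / 2)))).
  - apply Rmult_le_compat_l; [easy |]. lra.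
  - assert (q1 : g1 * (r ^ k * (1 + INR k * ((1 - r ^ 2) / 2))) <= g1 * 1)
      by (apply Rmult_le_compat_l; lra).
    assert (q2 : r ^ k * ((1 - r ^ 2) / 2) <= 1 / 2) by nra.
    assert (q3 : g1 * (1 - a) * (r ^ k * ((1 - r ^ 2) / 2)) <= g1 * (1 - a) * (1 / 2)).
    { apply Rmult_le_compat_l; [apply Rmult_le_pos; lra | easy]. }
    lra.
Qed.

Lemma Fser_pos (a : R) (k : nat) (t : R) (ha : 0 < a <= 1) (hk : (1 <= k)%nat)
  (ht : 0 <= t <= 1) : 0 < Fser a k t.
Proof.
  assert (h1 := Fser_1_pos a k ha hk).
  assert (h := Fser_slope a k ha hk t 1 ltac:(lra) ltac:(lra) ltac:(lra)). lra.
Qed.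

Lemma eta_bound (a : R) (k : nat) (r : R) (ha : 0 < a <= 1) (hk : (1 <= k)%nat)
  (hr : 0 <= r <= 1) : 0 <= INR k * eta a k r <= Lam a k * r.
Proof.
  destruct k as [| k]; [lia |].
  assert (hb := eta_factor_bound a k r ha hr).
  assert (hp := Fser_pos a (S k) (r ^ 2) ha ltac:(lia) ltac:(nra)).
  assert (h0 : 0 <= r ^ S k) by (apply pow_le; lra).
  assert (hk0 : 0 <= INR (S k)) by apply pos_INR.
  unfold eta. split.
  - apply Rmult_le_pos; [easy |]. apply Rmult_le_pos; lra.
  - apply Rmult_le_compat_r with (r := r) in hb; [| lra].
    replace (INR (S k) * (r ^ S k * Fser a (S k) (r ^ 2)))
      with (INR (S k) * (r ^ k * Fser a (S k) (r ^ 2)) * r) by (simpl (r ^ S k); ring).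
    exact hb.
Qed.

Lemma pow_diff_le (s r : R) (n : nat) (hs : 0 <= s) (hsr : s <= r) :
  0 <= r ^ S n - s ^ S n <= INR (S n) * r ^ n * (r - s).
Proof.
  induction n as [| n IH]; [simpl; lra |].
  rewrite (S_INR (S n)). change (r ^ S (S n)) with (r * r ^ S n).
  change (s ^ S (S n)) with (s * s ^ S n).
  assert (h1 : 0 <= s ^ S n) by (apply pow_le; lra).
  replace (r * r ^ S n - s * s ^ S n)
    with (r * (r ^ S n - s ^ S n) + (r - s) * s ^ S n) by ring.
  split; [apply Rplus_le_le_0_compat; apply Rmult_le_pos; lra |].
  assert (r * (r ^ S n - s ^ S n) <= r * (INR (S n) * r ^ n * (r - s)))
    by (apply Rmult_le_compat_l; lra).
  assert ((r - s) * s ^ S n <= (r - s) * r ^ S n) by (apply Rmult_le_compat_l; lra).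
  replace ((INR (S n) + 1) * r ^ S n * (r - s))
    with (r * (INR (S n) * r ^ n * (r - s)) + (r - s) * r ^ S n) by (simpl (r ^ S n); ring).
  lra.
Qed.

(** The increment is a difference of two nonnegative terms, from the growth of [r^k] and the
    decrease of [F_k]. Hence it suffices to bound each of them by [Lam a k * (r - s)]; the bounds
    need not be added. *)
Lemma eta_lipschitz (a : R) (k : nat) (r s : R) (ha : 0 < a <= 1) (hk : (1 <= k)%nat)
  (hs : 0 <= s) (hsr : s <= r) (hr : r <= 1) :
  Rabs (eta a k r - eta a k s) <= Lam a k * (r - s).
Proof.
  destruct k as [| k]; [lia |].
  assert (hb := eta_factor_bound a k r ha ltac:(lra)).
  assert (hp := Fser_pos a (S k) (r ^ 2) ha ltac:(lia) ltac:(nra)).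
  assert (hg := Fser_1_pos a (S k) ha ltac:(lia)).
  assert (h := Fser_slope a (S k) ha ltac:(lia) (s ^ 2) (r ^ 2)
                 ltac:(nra) ltac:(nra) ltac:(nra)).
  assert (hd := pow_diff_le s r k hs hsr).
  assert (h0 : 0 <= s ^ S k) by (apply pow_le; lra).
  assert (h01 : s ^ S k <= 1) by (rewrite <- (pow1 (S k)); apply pow_incr; lra).
  assert (hk1 := INR_ge_1 (S k) ltac:(lia)).
  set (fr := Fser a (S k) (r ^ 2)) in *. set (fs := Fser a (S k) (s ^ 2)) in *.
  replace (eta a (S k) r - eta a (S k) s)
    with ((r ^ S k - s ^ S k) * fr - s ^ S k * (fs - fr))
    by (unfold eta; fold fr fs; ring).
  assert (q1 : (r ^ S k - s ^ S k) * fr <= Lam a (S k) * (r - s)).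
  { apply Rle_trans with (INR (S k) * r ^ k * (r - s) * fr).
    - apply Rmult_le_compat_r; lra.
    - replace (INR (S k) * r ^ k * (r - s) * fr)
        with (INR (S k) * (r ^ k * fr) * (r - s)) by ring.
      apply Rmult_le_compat_r; lra. }
  assert (q2 : s ^ S k * (fs - fr) <= Lam a (S k) * (r - s)).
  { apply Rle_trans with (s ^ S k * ((INR (S k) - a) / 2 * Fser a (S k) 1 * (r ^ 2 - s ^ 2))).
    - apply Rmult_le_compat_l; lra.
    - set (g1 := Fser a (S k) 1) in *. unfold Lam. fold g1.
      replace (s ^ S k * ((INR (S k) - a) / 2 * g1 * (r ^ 2 - s ^ 2)))
        with (s ^ S k * (r + s) * ((INR (S k) - a) / 2 * g1 * (r - s))) by ring.
      apply Rle_trans with (2 * ((INR (S k) - a) / 2 * g1 * (r - s))).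
      + apply Rmult_le_compat_r; [repeat apply Rmult_le_pos; lra |].
        apply Rle_trans with (1 * (r + s)); [| lra].
        apply Rmult_le_compat_r; lra.
      + replace (2 * ((INR (S k) - a) / 2 * g1 * (r - s)))
          with ((INR (S k) - a) * (g1 * (r - s))) by field.
        replace (INR (S k) * g1 * ((3 - a) / 2) * (r - s))
          with (INR (S k) * ((3 - a) / 2) * (g1 * (r - s))) by ring.
        apply Rmult_le_compat_r; [apply Rmult_le_pos; lra |]. nra. }
  assert (q3 : 0 <= (r ^ S k - s ^ S k) * fr) by (apply Rmult_le_pos; lra).
  assert (q4 : 0 <= s ^ S k * (fs - fr)) by (apply Rmult_le_pos; lra).
  apply Rabs_le. lra.
Qed.

Lemma Lam_pos (a : R) (k : nat) (ha : 0 < a <= 1) (hk : (1 <= k)%nat) : 0 < Lam a k.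
Proof.
  assert (hg := Fser_1_pos a k ha hk). assert (h := INR_ge_1 k hk).
  unfold Lam. apply Rmult_lt_0_compat; [apply Rmult_lt_0_compat |]; lra.
Qed.

Lemma closed_disk_polar (z : R * R) (hz : normsq z <= 1) :
  exists r theta, 0 <= r <= 1 /\ z = polar r theta.
Proof.
  destruct (polar_form z) as (theta & _ & e).
  exists (sqrt (normsq z)), theta. split; [| exact e].
  split; [apply sqrt_pos |]. rewrite <- sqrt_1. now apply sqrt_le_1_alt.
Qed.

Lemma V2_lipschitz (a : R) (k : nat) (z w : R * R) (ha : 0 < a <= 1) (hk : (1 <= k)%nat)
  (hz : normsq z <= 1) (hw : normsq w <= 1) :
  dsq (V2 a k z) (V2 a k w) <= Lam a k ^ 2 * dsq z w.
Proof.
  destruct (closed_disk_polar z hz) as (r & al & hr & ->).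
  destruct (closed_disk_polar w hw) as (s & be & hs & ->).
  rewrite !V2_polar, !dsq_polar.
  replace (- (INR k * al) - - (INR k * be)) with (- (INR k * (al - be))) by ring.
  rewrite cos_neg. assert (hL := Lam_pos a k ha hk).
  apply polar_lipschitz; try easy; try lra; try now apply eta_bound.
  apply (Rabs_symmetric_bound (eta a k) (Lam a k) (fun x => 0 <= x <= 1)); try easy.
  intros x y hx hy hxy. apply eta_lipschitz; try easy; lra.
Qed.

Lemma a_Fser_1_le (a : R) (ha : 0 < a <= 1) : 0 < a * Fser a 1 1 <= 1.
Proof.
  assert (h := Fser_1_pos a 1 ha (le_n 1)).
  assert (h1 := Fser_slope a 1 ha (le_n 1) 0 1 ltac:(lra) ltac:(lra) ltac:(lra)).
  rewrite Fser_0 in h1. split; [apply Rmult_lt_0_compat; lra | nra].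
Qed.

Lemma V1_lipschitz (a : R) (z w : R * R) (ha : 0 < a <= 1)
  (hz : normsq z <= 1) (hw : normsq w <= 1) :
  dsq (V1 a z) (V1 a w) <= (1 - a * Fser a 1 1) ^ 2 * dsq z w.
Proof.
  destruct (closed_disk_polar z hz) as (r & al & hr & ->).
  destruct (closed_disk_polar w hw) as (s & be & hs & ->).
  rewrite !V1_polar, !dsq_polar.
  assert (hm := a_Fser_1_le a ha).
  assert (hr0 := rho_slope a r 0 ha ltac:(lra) ltac:(lra) ltac:(lra)).
  assert (hs0 := rho_slope a s 0 ha ltac:(lra) ltac:(lra) ltac:(lra)).
  rewrite rho_0 in hr0, hs0.
  assert (h := polar_lipschitz (rho a r) (rho a s) r s (al - be)
                 (1 - a * Fser a 1 1) 1 (le_n 1)).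
  simpl INR in h. rewrite !Rmult_1_l in h. apply h; try lra.
  apply (Rabs_symmetric_bound (rho a) _ (fun x => 0 <= x <= 1)); try easy.
  intros x y hx hy hxy.
  assert (hxy' := rho_slope a x y ha ltac:(lra) hxy ltac:(lra)).
  rewrite Rabs_pos_eq; lra.
Qed.

(** One minus the Lipschitz constant [(1 - a F_1(1)) + |c| Lam] of the perturbation; its positivity
    is the contraction condition. *)
Definition mono_const (a c : R) (k : nat) : R := a * Fser a 1 1 - Rabs c * Lam a k.

(** Cauchy-Schwarz from Lagrange's identity: [(x1 y1 + x2 y2)^2 + (x1 y2 - x2 y1)^2] is the product
    of the squared norms. *)
Lemma dot_bound (x1 x2 y1 y2 p q D : R) (hp : 0 <= p) (hq : 0 <= q) (hD : 0 <= D)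
  (hx : x1 ^ 2 + x2 ^ 2 <= p ^ 2 * D) (hy : y1 ^ 2 + y2 ^ 2 <= q ^ 2 * D) :
  Rabs (x1 * y1 + x2 * y2) <= p * q * D.
Proof.
  apply Rsqr_incr_0_var; [| repeat apply Rmult_le_pos; easy].
  unfold Rsqr. rewrite <- Rabs_mult, Rabs_pos_eq by apply (Rle_0_sqr (x1 * y1 + x2 * y2)).
  assert (h := pow2_ge_0 (x1 * y2 - x2 * y1)).
  assert (h1 : (x1 ^ 2 + x2 ^ 2) * (y1 ^ 2 + y2 ^ 2) <= (p ^ 2 * D) * (q ^ 2 * D)).
  { apply Rmult_le_compat; try easy; apply Rplus_le_le_0_compat; apply pow2_ge_0. }
  lra.
Qed.

Lemma Vmap_0 (a c : R) (k : nat) (hk : (1 <= k)%nat) : Vmap a c k (0, 0) = (0, 0).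
Proof. unfold Vmap. destruct k as [| k']; [lia |]. simpl. f_equal; ring. Qed.

Section perturbation_of_identity.
Context (a c : R) (k : nat) (ha : 0 < a <= 1) (hk : (1 <= k)%nat).

Lemma mono_const_le : mono_const a c k <= 1.
Proof.
  assert (h := a_Fser_1_le a ha).
  assert (h1 := Rmult_le_pos _ _ (Rabs_pos c) (Rlt_le _ _ (Lam_pos a k ha hk))).
  unfold mono_const. lra.
Qed.

Definition Vpert (z : R * R) : R * R :=
  (fst (Vmap a c k z) - fst z, snd (Vmap a c k z) - snd z).

(** The triangle inequality for [- V1 + c V2] in squared form; the cross term is controlled by
    [dot_bound]. *)
Lemma Vpert_contraction (z w : R * R) (hz : normsq z <= 1) (hw : normsq w <= 1) :
  dsq (Vpert z) (Vpert w) <= (1 - mono_const a c k) ^ 2 * dsq z w.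
Proof.
  assert (h1 := V1_lipschitz a z w ha hz hw).
  assert (h2 := V2_lipschitz a k z w ha hk hz hw).
  assert (hL := Lam_pos a k ha hk). assert (hm := a_Fser_1_le a ha).
  assert (hD := dsq_pos z w).
  assert (hp : 0 <= 1 - a * Fser a 1 1) by lra.
  assert (cs := dot_bound _ _ _ _ _ _ _ hp (Rlt_le _ _ hL) hD h1 h2).
  set (D := dsq z w) in *. unfold dsq in h1, h2.
  set (x1 := fst (V1 a z) - fst (V1 a w)) in *.
  set (x2 := snd (V1 a z) - snd (V1 a w)) in *.
  set (y1 := fst (V2 a k z) - fst (V2 a k w)) in *.
  set (y2 := snd (V2 a k z) - snd (V2 a k w)) in *.
  set (M := 1 - a * Fser a 1 1) in *.
  replace (dsq (Vpert z) (Vpert w))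
    with (x1 ^ 2 + x2 ^ 2 - 2 * c * (x1 * y1 + x2 * y2) + c ^ 2 * (y1 ^ 2 + y2 ^ 2))
    by (unfold x1, x2, y1, y2, dsq, Vpert, Vmap, V1, V2; cbn [fst snd]; ring).
  replace (1 - mono_const a c k) with (M + Rabs c * Lam a k)
    by (unfold mono_const, M; ring).
  assert (hc : - c * (x1 * y1 + x2 * y2) <= Rabs c * (M * Lam a k * D)).
  { apply Rle_trans with (1 := Rle_abs _). rewrite Rabs_mult, Rabs_Ropp.
    apply Rmult_le_compat_l; [apply Rabs_pos | exact cs]. }
  assert (hc2 : c ^ 2 * (y1 ^ 2 + y2 ^ 2) <= c ^ 2 * (Lam a k ^ 2 * D))
    by (apply Rmult_le_compat_l; [apply pow2_ge_0 | easy]).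
  rewrite <- (pow2_abs c) in hc2 at 2. lra.
Qed.

(** With [m] the constant, [D = z - w] and [DV] the difference of the images, the contraction gives
    [<DV, D> >= m |D|^2]. Then [|DV - m D|^2 >= 0] yields [|DV|^2 >= 2 m <DV, D> - m^2 |D|^2 >= m^2
    |D|^2]. *)
Lemma Vmap_expanding (z w : R * R) (hm : 0 < mono_const a c k)
  (hz : normsq z <= 1) (hw : normsq w <= 1) :
  mono_const a c k ^ 2 * dsq z w <= dsq (Vmap a c k z) (Vmap a c k w).
Proof.
  assert (h := Vpert_contraction z w hz hw). assert (hm1 := mono_const_le).
  assert (hD := dsq_pos z w). set (m := mono_const a c k) in *.
  assert (cs := dot_bound (fst z - fst w) (snd z - snd w) _ _ 1 (1 - m) (dsq z w)
                  ltac:(lra) ltac:(lra) hD ltac:(unfold dsq; lra) h).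
  unfold Vpert in cs. cbn [fst snd] in cs. unfold dsq in *.
  set (p := fst (Vmap a c k z)) in *. set (p' := fst (Vmap a c k w)) in *.
  set (q := snd (Vmap a c k z)) in *. set (q' := snd (Vmap a c k w)) in *.
  set (x := fst z) in *. set (x' := fst w) in *.
  set (y := snd z) in *. set (y' := snd w) in *.
  match type of cs with Rabs ?e <= _ => assert (h0 := Rle_abs (- e)) end.
  rewrite Rabs_Ropp in h0.
  assert (h1 := pow2_ge_0 (p - p' - m * (x - x'))).
  assert (h2 := pow2_ge_0 (q - q' - m * (y - y'))).
  assert (h3 : m * (m * ((x - x') ^ 2 + (y - y') ^ 2))
               <= m * ((p - p') * (x - x') + (q - q') * (y - y')))
    by (apply Rmult_le_compat_l; lra).
  lra.
Qed.

(** [Vmap] is the identity plus a nonexpansive map, so it is 2-Lipschitz; squaring gives 4. *)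
Lemma Vmap_lipschitz (z w : R * R) (hm : 0 < mono_const a c k)
  (hz : normsq z <= 1) (hw : normsq w <= 1) :
  dsq (Vmap a c k z) (Vmap a c k w) <= 4 * dsq z w.
Proof.
  assert (h := Vpert_contraction z w hz hw). assert (hm1 := mono_const_le).
  assert (hD := dsq_pos z w). set (m := mono_const a c k) in *.
  assert (h' : (1 - m) ^ 2 * dsq z w <= 1 * dsq z w)
    by (apply Rmult_le_compat_r; [easy | nra]).
  unfold Vpert in h. unfold dsq in *. cbn [fst snd] in h.
  set (p := fst (Vmap a c k z)) in *. set (p' := fst (Vmap a c k w)) in *.
  set (q := snd (Vmap a c k z)) in *. set (q' := snd (Vmap a c k w)) in *.
  assert (h1 := pow2_ge_0 (p - p' - 2 * (fst z - fst w))).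
  assert (h2 := pow2_ge_0 (q - q' - 2 * (snd z - snd w))). lra.
Qed.

End perturbation_of_identity.

(** * The boundary curve *)

(** The hypotrochoid [A e^(i theta) + B e^(-i k theta)]. *)
Definition gam (A B : R) (k : nat) (theta : R) : R * R :=
  (A * cos theta + B * cos (INR k * theta), A * sin theta - B * sin (INR k * theta)).

(* The outward normal of [gam]: its derivative rotated by a right angle. *)
Definition nrm (A B : R) (k : nat) (theta : R) : R * R :=
  (A * cos theta - INR k * B * cos (INR k * theta),
   A * sin theta + INR k * B * sin (INR k * theta)).

Definition support_gap (A B : R) (k : nat) (w : R * R) (theta : R) : R :=
  inner w (nrm A B k theta) - inner (gam A B k theta) (nrm A B k theta).

Definition Omega_set (A B : R) (k : nat) (w : R * R) : Prop :=
  forall theta, support_gap A B k w theta < 0.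

Lemma inner_gam_nrm (A B : R) (k : nat) (phi theta : R) :
  inner (gam A B k phi) (nrm A B k theta)
  = A ^ 2 * cos (phi - theta) - INR k * A * B * cos (phi + INR k * theta)
    + A * B * cos (INR k * phi + theta)
    - INR k * B ^ 2 * cos (INR k * phi - INR k * theta).
Proof.
  rewrite !cos_minus, !cos_plus. unfold inner, gam, nrm. simpl fst. simpl snd. ring.
Qed.

(** Raising [k] by one adds [4 sin(d/2) sin(k d/2) cos(..)], which is at most [2 k (1 - cos d)] in
    absolute value; these bounds sum to [k (k - 1) (1 - cos d)]. *)
Lemma cos_second_difference (k : nat) (b d : R) :
  Rabs ((cos b - cos (b + INR k * d)) - INR k * (cos b - cos (b + d)))
  <= INR k * (INR k - 1) * (1 - cos d).
Proof.
  induction k as [| k IH].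
  - simpl. rewrite Rmult_0_l, Rplus_0_r.
    replace (cos b - cos b - 0 * (cos b - cos (b + d))) with 0 by ring.
    rewrite Rabs_R0. lra.
  - rewrite S_INR.
    set (T := (cos (b + INR k * d) - cos (b + (INR k + 1) * d)) - (cos b - cos (b + d))).
    replace (cos b - cos (b + (INR k + 1) * d) - (INR k + 1) * (cos b - cos (b + d)))
      with ((cos b - cos (b + INR k * d)) - INR k * (cos b - cos (b + d)) + T)
      by (unfold T; ring).
    assert (hT : Rabs T <= 2 * INR k * (1 - cos d)).
    { assert (e : T = 4 * sin (d / 2) * sin (INR k * (d / 2))
                      * cos (b + d / 2 + INR k * (d / 2))).
      { unfold T. rewrite !form2.
        replace ((b + INR k * d - (b + (INR k + 1) * d)) / 2) with (- (d / 2)) by field.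
        replace ((b - (b + d)) / 2) with (- (d / 2)) by field.
        rewrite sin_neg.
        replace ((b + INR k * d + (b + (INR k + 1) * d)) / 2)
          with (b + d / 2 + 2 * (INR k * (d / 2))) by field.
        replace ((b + (b + d)) / 2) with (b + d / 2) by field.
        assert (f := form4 (b + d / 2 + 2 * (INR k * (d / 2))) (b + d / 2)).
        replace ((b + d / 2 + 2 * (INR k * (d / 2)) - (b + d / 2)) / 2)
          with (INR k * (d / 2)) in f by field.
        replace ((b + d / 2 + 2 * (INR k * (d / 2)) + (b + d / 2)) / 2)
          with (b + d / 2 + INR k * (d / 2)) in f by field.
        transitivity (2 * sin (d / 2) *
          (sin (b + d / 2 + 2 * (INR k * (d / 2))) - sin (b + d / 2))); [ring |].
        rewrite f. ring. }
      rewrite e, one_minus_cos_half, !Rabs_mult, (Rabs_pos_eq 4) by lra.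
      assert (h := abs_sin_mult_le k (d / 2)).
      assert (hc : Rabs (cos (b + d / 2 + INR k * (d / 2))) <= 1)
        by (apply Rabs_le; apply COS_bound).
      assert (hs := Rabs_pos (sin (d / 2))).
      assert (hs2 := Rabs_pos (sin (INR k * (d / 2)))).
      rewrite <- (pow2_abs (sin (d / 2))).
      apply Rle_trans with (4 * Rabs (sin (d / 2)) * Rabs (sin (INR k * (d / 2))) * 1).
      - apply Rmult_le_compat_l; [apply Rmult_le_pos; lra | easy].
      - assert (4 * Rabs (sin (d / 2)) * Rabs (sin (INR k * (d / 2)))
                <= 4 * Rabs (sin (d / 2)) * (INR k * Rabs (sin (d / 2))))
          by (apply Rmult_le_compat_l; lra).
        simpl. lra. }
    apply Rle_trans with (1 := Rabs_triang _ _).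
    replace ((INR k + 1) * (INR k + 1 - 1) * (1 - cos d))
      with (INR k * (INR k - 1) * (1 - cos d) + 2 * INR k * (1 - cos d)) by ring.
    lra.
Qed.

(** The first two expressions factor, with [b = |B|], as [(A - K^2 b) (A + K b)] and
    [(A - K b) (A + b)]. The first governs curvature and supporting lines, the second the position
    of the origin, the third the radial direction. *)
Lemma convexity_condition (A B K : R) (hA : K ^ 2 * Rabs B < A) (hK : 1 <= K) :
  0 < A ^ 2 - K ^ 3 * B ^ 2 - A * Rabs B * (K * (K - 1)) /\
  0 < A ^ 2 - K * B ^ 2 - A * Rabs B * (K - 1) /\ K * Rabs B < A /\ 0 < A.
Proof.
  assert (hb := Rabs_pos B). rewrite <- (pow2_abs B). set (b := Rabs B) in *.
  assert (h1 : K * b <= K ^ 2 * b) by (apply Rmult_le_compat_r; nra).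
  assert (h2 : 0 <= K * b) by (apply Rmult_le_pos; lra).
  repeat split; try lra.
  - replace (A ^ 2 - K ^ 3 * b ^ 2 - A * b * (K * (K - 1)))
      with ((A - K ^ 2 * b) * (A + K * b)) by ring.
    apply Rmult_lt_0_compat; lra.
  - replace (A ^ 2 - K * b ^ 2 - A * b * (K - 1)) with ((A - K * b) * (A + b)) by ring.
    apply Rmult_lt_0_compat; lra.
Qed.

Lemma scaled_cos_bound (p B t : R) (hp : 0 <= p) : Rabs (p * B * cos t) <= p * Rabs B.
Proof.
  rewrite !Rabs_mult, (Rabs_pos_eq p) by easy.
  rewrite <- (Rmult_1_r (p * Rabs B)) at 2.
  apply Rmult_le_compat_l; [apply Rmult_le_pos; [easy | apply Rabs_pos] |].
  apply Rabs_le, COS_bound.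
Qed.

Section hypocycloid_facts.
Context (A B : R) (k : nat) (hk : (1 <= k)%nat) (hA : INR k ^ 2 * Rabs B < A).

(** The whole curve is compared with each of its tangents. With [X = 1 - cos d], the gap is [A^2 X]
    plus two terms that are bounded by multiples of the same [X]; [convexity_condition] says that
    [A^2 X] dominates. *)
Lemma gam_support (phi theta : R) :
  inner (gam A B k phi) (nrm A B k theta) <= inner (gam A B k theta) (nrm A B k theta).
Proof.
  assert (hK := INR_ge_1 k hk). set (K := INR k) in *.
  destruct (convexity_condition A B K hA hK) as (c1 & _ & _ & c4).
  rewrite !inner_gam_nrm. fold K.
  replace phi with (theta + (phi - theta)) by ring. set (d := phi - theta).
  set (b := theta + K * theta).
  replace (theta + d - theta) with d by ring.
  replace (theta + d + K * theta) with (b + d) by (unfold b; ring).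
  replace (K * (theta + d) + theta) with (b + K * d) by (unfold b; ring).
  replace (K * (theta + d) - K * theta) with (K * d) by ring.
  replace (theta - theta) with 0 by ring.
  replace (K * theta - K * theta) with 0 by ring.
  replace (K * theta + theta) with b by (unfold b; ring).
  rewrite cos_0.
  assert (h1 := cos_second_difference k b d). assert (h2 := one_minus_cos_mult k d).
  fold K in h1, h2. assert (hd := one_minus_cos_pos d).
  set (br := (cos b - cos (b + K * d)) - K * (cos b - cos (b + d))) in *.
  set (X := 1 - cos d) in *.
  assert (hb := Rabs_pos B).
  assert (q1 : - (A * Rabs B * (K * (K - 1) * X)) <= A * B * br).
  { assert (Rabs (A * B * br) <= A * Rabs B * (K * (K - 1) * X)).
    { rewrite !Rabs_mult, (Rabs_pos_eq A) by lra.
      apply Rmult_le_compat_l; [apply Rmult_le_pos; lra | easy]. }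
    assert (h := Rle_abs (- (A * B * br))). rewrite Rabs_Ropp in h. lra. }
  assert (q2 : K * B ^ 2 * (1 - cos (K * d)) <= K * B ^ 2 * (K ^ 2 * X)).
  { apply Rmult_le_compat_l; [| easy]. apply Rmult_le_pos; [lra | apply pow2_ge_0]. }
  assert (q3 : 0 <= (A ^ 2 - K ^ 3 * B ^ 2 - A * Rabs B * (K * (K - 1))) * X)
    by (apply Rmult_le_pos; lra).
  assert (e : A ^ 2 * 1 - K * A * B * cos b + A * B * cos b - K * B ^ 2 * 1
    - (A ^ 2 * cos d - K * A * B * cos (b + d) + A * B * cos (b + K * d)
       - K * B ^ 2 * cos (K * d))
    = A ^ 2 * X - K * B ^ 2 * (1 - cos (K * d)) + A * B * br)
    by (unfold X, br; ring).
  lra.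
Qed.

Lemma gam_nrm_pos (theta : R) : 0 < inner (gam A B k theta) (nrm A B k theta).
Proof.
  assert (hK := INR_ge_1 k hk). set (K := INR k) in *.
  destruct (convexity_condition A B K hA hK) as (_ & c2 & _ & c4).
  rewrite inner_gam_nrm. fold K.
  replace (theta - theta) with 0 by ring.
  replace (K * theta - K * theta) with 0 by ring.
  rewrite (Rplus_comm (K * theta)), cos_0.
  assert (hx := scaled_cos_bound (A * (K - 1)) B (theta + K * theta)
                  ltac:(apply Rmult_le_pos; lra)).
  assert (h := Rle_abs (A * (K - 1) * B * cos (theta + K * theta))). lra.
Qed.

(** Moving from [gam theta] in the direction [e^(i theta)] leaves the half-plane of the tangent
    there. In [Vmap_onto] this excludes points [gam theta + lambda e^(i theta)] with [lambda >= 0]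
    from the domain. *)
Lemma cis_nrm_pos (theta : R) : 0 < inner (polar 1 theta) (nrm A B k theta).
Proof.
  assert (hK := INR_ge_1 k hk). set (K := INR k) in *.
  destruct (convexity_condition A B K hA hK) as (_ & _ & c3 & c4).
  replace (inner (polar 1 theta) (nrm A B k theta))
    with (A * (sin theta ^ 2 + cos theta ^ 2) - K * B * cos (theta + K * theta))
    by (rewrite cos_plus; unfold inner, polar, nrm; simpl fst; simpl snd; fold K; ring).
  rewrite sin_cos_sq.
  assert (hx := scaled_cos_bound K B (theta + K * theta) ltac:(lra)).
  assert (h := Rle_abs (K * B * cos (theta + K * theta))). lra.
Qed.

Definition nrm' (theta : R) : R * R :=
  (- A * sin theta + INR k ^ 2 * B * sin (INR k * theta),
   A * cos theta + INR k ^ 2 * B * cos (INR k * theta)).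

(** The term with the derivative of [gam] disappears because the tangent is orthogonal to [nrm];
    only the derivative [nrm'] of the normal survives. *)
Lemma is_derive_support_gap (w : R * R) (theta : R) :
  is_derive (support_gap A B k w) theta
    (inner (fst w - fst (gam A B k theta), snd w - snd (gam A B k theta)) (nrm' theta)).
Proof.
  replace (inner (fst w - fst (gam A B k theta), snd w - snd (gam A B k theta)) (nrm' theta))
    with (inner w (nrm' theta) - inner (gam A B k theta) (nrm' theta))
    by (unfold inner; simpl; ring).
  unfold support_gap, inner, gam, nrm, nrm'. simpl fst. simpl snd.
  auto_derive; [easy |]. ring.
Qed.

(** The normal turns strictly counterclockwise, that is, the curvature is positive. Linear
    independence of [nrm] and [nrm'] is what [support_gap_max_0] uses. *)
Lemma nrm_nrm'_det (theta : R) :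
  0 < fst (nrm A B k theta) * snd (nrm' theta) - snd (nrm A B k theta) * fst (nrm' theta).
Proof.
  assert (hK := INR_ge_1 k hk). set (K := INR k) in *.
  destruct (convexity_condition A B K hA hK) as (c1 & _ & _ & c4).
  unfold nrm, nrm'. simpl fst. simpl snd. fold K.
  match goal with |- 0 < ?x => replace x with
    (A ^ 2 * (sin theta ^ 2 + cos theta ^ 2)
     - K ^ 3 * B ^ 2 * (sin (K * theta) ^ 2 + cos (K * theta) ^ 2)
     + A * B * (K * (K - 1)) * cos (theta + K * theta))
    by (rewrite cos_plus; ring) end.
  rewrite !sin_cos_sq.
  assert (hx := scaled_cos_bound (A * (K * (K - 1))) B (theta + K * theta)
                  ltac:(repeat apply Rmult_le_pos; lra)).
  assert (h := Rle_abs (- (A * (K * (K - 1)) * B * cos (theta + K * theta)))).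
  rewrite Rabs_Ropp in h. lra.
Qed.

(* At a point where the support gap attains the maximum 0, [w - gam theta] is
   orthogonal to [nrm] and, by the first order condition, to its derivative. *)
Lemma support_gap_max_0 (w : R * R) (theta : R)
  (h0 : support_gap A B k w theta = 0) (hmax : forall phi, support_gap A B k w phi <= 0) :
  w = gam A B k theta.
Proof.
  assert (hd := is_derive_support_gap w theta).
  assert (e : inner (fst w - fst (gam A B k theta), snd w - snd (gam A B k theta))
                (nrm' theta) = 0).
  { apply is_derive_Reals in hd.
    set (pr := exist _ _ hd : derivable_pt (support_gap A B k w) theta).
    assert (h := deriv_maximum (support_gap A B k w) (theta - 1) (theta + 1) theta pr
                   ltac:(lra) ltac:(lra)).
    apply h. intros x _ _. rewrite h0. apply hmax. }
  assert (hdet := nrm_nrm'_det theta).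
  unfold support_gap, inner in h0. unfold inner in e. cbn [fst snd] in e.
  set (n1 := fst (nrm A B k theta)) in *. set (n2 := snd (nrm A B k theta)) in *.
  set (m1 := fst (nrm' theta)) in *. set (m2 := snd (nrm' theta)) in *.
  set (g1 := fst (gam A B k theta)) in *. set (g2 := snd (gam A B k theta)) in *.
  assert (h1 : (fst w - g1) * (n1 * m2 - n2 * m1) = 0).
  { transitivity (m2 * (fst w * n1 + snd w * n2 - (g1 * n1 + g2 * n2))
      - n2 * ((fst w - g1) * m1 + (snd w - g2) * m2)); [ring | rewrite h0, e; ring]. }
  assert (h2 : (snd w - g2) * (n1 * m2 - n2 * m1) = 0).
  { transitivity (n1 * ((fst w - g1) * m1 + (snd w - g2) * m2)
      - m1 * (fst w * n1 + snd w * n2 - (g1 * n1 + g2 * n2))); [ring | rewrite h0, e; ring]. }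
  apply Rmult_integral in h1. apply Rmult_integral in h2.
  destruct w as [w1 w2]. rewrite (surjective_pairing (gam A B k theta)).
  fold g1 g2. cbn [fst snd] in *. f_equal; lra.
Qed.

Lemma support_gap_gam (phi theta : R) : support_gap A B k (gam A B k phi) theta <= 0.
Proof. unfold support_gap. assert (h := gam_support phi theta). lra. Qed.

Lemma nrm_bound (theta : R) :
  Rabs (fst (nrm A B k theta)) <= 2 * A /\ Rabs (snd (nrm A B k theta)) <= 2 * A.
Proof.
  assert (hK := INR_ge_1 k hk).
  destruct (convexity_condition A B (INR k) hA hK) as (_ & _ & c3 & c4).
  assert (hb := Rabs_pos B).
  assert (ht : forall t : R, Rabs t <= 1 -> Rabs (A * t) <= A).
  { intros t h. rewrite Rabs_mult, (Rabs_pos_eq A) by lra.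
    rewrite <- (Rmult_1_r A) at 2. apply Rmult_le_compat_l; lra. }
  assert (ht' : forall t : R, Rabs t <= 1 -> Rabs (INR k * B * t) <= A).
  { intros t h. rewrite !Rabs_mult, (Rabs_pos_eq (INR k)) by lra.
    apply Rle_trans with (INR k * Rabs B * 1); [| lra].
    apply Rmult_le_compat_l; [apply Rmult_le_pos; lra | easy]. }
  assert (hc : forall t, Rabs (cos t) <= 1) by (intros; apply Rabs_le, COS_bound).
  assert (hs : forall t, Rabs (sin t) <= 1) by (intros; apply Rabs_le, SIN_bound).
  unfold nrm; simpl fst; simpl snd. split.
  - assert (h1 := ht _ (hc theta)). assert (h2 := ht' _ (hc (INR k * theta))).
    apply Rle_trans with (1 := Rabs_triang _ _). rewrite Rabs_Ropp. lra.
  - assert (h1 := ht _ (hs theta)). assert (h2 := ht' _ (hs (INR k * theta))).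
    apply Rle_trans with (1 := Rabs_triang _ _). lra.
Qed.

(** The gap is affine in [w] with gradient [nrm], bounded independently of [theta]. So one
    neighbourhood serves all half-planes: two coordinates, each [2 A] times [m / (4 A)]. *)
Lemma support_gap_continuous (w : C) (m : R) (hm : 0 < m) :
  locally (T := C_UniformSpace) w (fun w' => forall theta,
    Rabs (support_gap A B k w' theta - support_gap A B k w theta) < m).
Proof.
  assert (hK := INR_ge_1 k hk).
  destruct (convexity_condition A B (INR k) hA hK) as (_ & _ & _ & c4).
  assert (hd : 0 < m / (4 * A)) by (apply Rdiv_lt_0_compat; lra).
  exists (mkposreal _ hd). intros w' [e1 e2] theta.
  change (Rabs (fst w' - fst w) < m / (4 * A)) in e1.
  change (Rabs (snd w' - snd w) < m / (4 * A)) in e2.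
  destruct (nrm_bound theta) as [h1 h2]. unfold support_gap, inner.
  set (n1 := fst (nrm A B k theta)) in *. set (n2 := snd (nrm A B k theta)) in *.
  match goal with |- Rabs ?x < _ =>
    replace x with ((fst w' - fst w) * n1 + (snd w' - snd w) * n2) by ring end.
  apply Rle_lt_trans with (1 := Rabs_triang _ _). rewrite !Rabs_mult.
  assert (q1 : Rabs (fst w' - fst w) * Rabs n1 <= Rabs (fst w' - fst w) * (2 * A))
    by (apply Rmult_le_compat_l; [apply Rabs_pos | easy]).
  assert (q2 : Rabs (snd w' - snd w) * Rabs n2 <= Rabs (snd w' - snd w) * (2 * A))
    by (apply Rmult_le_compat_l; [apply Rabs_pos | easy]).
  apply Rmult_lt_compat_r with (r := 2 * A) in e1; [| lra].
  apply Rmult_lt_compat_r with (r := 2 * A) in e2; [| lra].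
  replace (m / (4 * A) * (2 * A)) with (m / 2) in e1, e2 by (field; lra). lra.
Qed.

Lemma zpow_cis (n : nat) (t : R) :
  zpow n (cos t, sin t) = (cos (INR n * t), sin (INR n * t)).
Proof.
  replace (cos t, sin t) with (polar 1 t) by (unfold polar; f_equal; ring).
  rewrite zpow_polar, pow1. f_equal; ring.
Qed.

(** Cosine and sine of [n s] are the coordinates of the [n]-th power of [(cos s, sin s)], hence
    depend on the point of the circle only. *)
Lemma same_angle_mult (n : nat) (s t : R) (hc : cos s = cos t) (hs : sin s = sin t) :
  cos (INR n * s) = cos (INR n * t) /\ sin (INR n * s) = sin (INR n * t).
Proof.
  assert (h := zpow_cis n s). rewrite hc, hs, zpow_cis in h.
  injection h as h1 h2. now split.
Qed.

(** Infinitely many strict inequalities become one uniform margin by compactness: the gap attains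
    its maximum on [[-PI, PI]], and every angle is represented there. *)
Lemma Omega_set_uniform (w : R * R) (hw : Omega_set A B k w) :
  exists m, 0 < m /\ forall theta, support_gap A B k w theta <= - m.
Proof.
  destruct (continuity_ab_maj (support_gap A B k w) (- PI) PI) as (t0 & ht0 & _).
  - assert (h := PI_RGT_0). lra.
  - intros t _. eapply continuity_of_is_derive. apply is_derive_support_gap.
  - exists (- support_gap A B k w t0). split.
    + assert (h := hw t0). lra.
    + intros theta. destruct (unit_angle (cos theta) (sin theta)) as (s & hs & ec & es).
      * rewrite Rplus_comm. apply sin_cos_sq.
      * replace (support_gap A B k w theta) with (support_gap A B k w s).
        -- rewrite Ropp_involutive. now apply ht0.
        -- destruct (same_angle_mult k s theta (eq_sym ec) (eq_sym es)) as [e1 e2].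
           unfold support_gap, gam, nrm. now rewrite e1, e2, ec, es.
Qed.

Lemma Omega_set_open : open (T := C_UniformSpace) (Omega_set A B k).
Proof.
  intros w hw. destruct (Omega_set_uniform w hw) as (m & hm & h).
  generalize (support_gap_continuous w m hm). apply filter_imp. intros w' hl theta.
  specialize (hl theta). apply Rabs_def2 in hl. specialize (h theta). lra.
Qed.

Lemma Omega_set_convex : convex (Omega_set A B k).
Proof.
  intros z w t hz hw ht theta. specialize (hz theta). specialize (hw theta).
  replace (support_gap A B k (RtoC (1 - t) * z + RtoC t * w)%C theta)
    with ((1 - t) * support_gap A B k z theta + t * support_gap A B k w theta).
  - destruct (Rle_lt_or_eq_dec 0 t (proj1 ht)) as [h | h]; [nra | subst t; lra].
  - unfold support_gap, inner. destruct z as [z1 z2], w as [w1 w2]. simpl. ring.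
Qed.

Lemma Omega_set_0 : Omega_set A B k (0, 0).
Proof.
  intros theta. assert (h := gam_nrm_pos theta). unfold support_gap.
  unfold inner at 1. simpl fst at 1. simpl snd at 1. lra.
Qed.

(** A boundary point has all gaps [<= 0] by uniform continuity and, being outside the open set, some
    gap [>= 0]; there the maximum 0 is attained. Conversely a point of the curve has gap 0 at its
    own angle, while shrinking it towards the origin makes all gaps negative. *)
Lemma boundary_Omega_set (w : C) :
  boundary (Omega_set A B k) w <-> exists theta, w = gam A B k theta.
Proof.
  split.
  - intros [h1 h2].
    assert (hn : ~ Omega_set A B k w) by (intros hw; now apply h1, Omega_set_open).
    apply not_all_ex_not in hn. destruct hn as [theta hth]. apply Rnot_lt_le in hth.
    assert (hle : forall phi, support_gap A B k w phi <= 0).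
    { intros phi. apply Rnot_lt_le. intros hpos. apply h2.
      generalize (support_gap_continuous w _ hpos). apply filter_imp. intros w' hl hw'.
      specialize (hl phi). specialize (hw' phi). apply Rabs_def2 in hl. lra. }
    exists theta. apply support_gap_max_0; [| exact hle].
    apply Rle_antisym; [apply hle | exact hth].
  - intros [theta ->]. split.
    + intros h. apply (locally_singleton (T := C_UniformSpace)) in h.
      specialize (h theta). unfold support_gap in h. lra.
    + intros [eps h].
      set (g := gam A B k theta) in *.
      set (M := Rabs (fst g) + Rabs (snd g) + 1).
      assert (hM : 0 < M)
        by (unfold M; assert (q1 := Rabs_pos (fst g)); assert (q2 := Rabs_pos (snd g)); lra).
      (* [s <= 1/2] keeps [1 - s] nonnegative, and [s * M < eps] keeps the shrunk point in the ball,
         [M] exceeding both coordinates of [g] in absolute value. *)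
      set (s := Rmin (1 / 2) (eps / (2 * M))).
      assert (heps := cond_pos eps).
      assert (hs : 0 < s).
      { apply Rmin_glb_lt; [lra |]. apply Rdiv_lt_0_compat; lra. }
      assert (hs1 : s <= 1 / 2) by apply Rmin_l.
      assert (hs2 : s * M < eps).
      { apply Rle_lt_trans with (eps / (2 * M) * M).
        - apply Rmult_le_compat_r; [lra | apply Rmin_r].
        - replace (eps / (2 * M) * M) with (eps / 2) by (field; lra). lra. }
      apply (h ((1 - s) * fst g, (1 - s) * snd g)).
      * assert (hbd : forall x : R, Rabs x <= M -> Rabs ((1 - s) * x - x) < eps).
        { intros x hx. replace ((1 - s) * x - x) with (- (s * x)) by ring.
          rewrite Rabs_Ropp, Rabs_mult, (Rabs_pos_eq s) by lra.
          apply Rle_lt_trans with (s * M); [apply Rmult_le_compat_l; lra | easy]. }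
        assert (q1 := Rabs_pos (fst g)). assert (q2 := Rabs_pos (snd g)).
        split.
        -- change (Rabs ((1 - s) * fst g - fst g) < eps). apply hbd. unfold M. lra.
        -- change (Rabs ((1 - s) * snd g - snd g) < eps). apply hbd. unfold M. lra.
      * intros phi. assert (hg := support_gap_gam theta phi).
        assert (hp := gam_nrm_pos phi). fold g in hg.
        replace (support_gap A B k ((1 - s) * fst g, (1 - s) * snd g) phi)
          with ((1 - s) * support_gap A B k g phi
                - s * inner (gam A B k phi) (nrm A B k phi))
          by (unfold support_gap, inner; simpl; ring).
        assert (0 < s * inner (gam A B k phi) (nrm A B k phi))
          by now apply Rmult_lt_0_compat.
        assert (0 <= (1 - s) * - support_gap A B k g phi) by (apply Rmult_le_pos; lra).
        lra.
Qed.

End hypocycloid_facts.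

(** * Injectivity and image *)

Definition proj_disk (z : R * R) : R * R :=
  (fst z / Rmax 1 (sqrt (normsq z)), snd z / Rmax 1 (sqrt (normsq z))).

Lemma proj_disk_polar (r theta : R) (hr : 0 <= r) :
  proj_disk (polar r theta) = polar (Rmin r 1) theta.
Proof.
  unfold proj_disk. rewrite normsq_polar, sqrt_pow2 by easy. unfold polar. simpl.
  unfold Rmax, Rmin. destruct (Rle_dec 1 r), (Rle_dec r 1); f_equal;
    try (replace r with 1 by lra); try (field; lra).
Qed.

Lemma proj_disk_normsq (z : R * R) : normsq (proj_disk z) <= 1.
Proof.
  destruct (polar_form z) as (t & _ & e). rewrite e, proj_disk_polar by apply sqrt_pos.
  rewrite normsq_polar. assert (h := sqrt_pos (normsq z)).
  assert (h1 := Rmin_r (sqrt (normsq z)) 1).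
  assert (h2 : 0 <= Rmin (sqrt (normsq z)) 1) by (apply Rmin_glb; lra). nra.
Qed.

Lemma proj_disk_id (z : R * R) (hz : normsq z <= 1) : proj_disk z = z.
Proof.
  destruct (closed_disk_polar z hz) as (r & t & hr & ->).
  rewrite proj_disk_polar, Rmin_left by lra. easy.
Qed.

(** The projection keeps the angle and replaces [r] by [Rmin r 1], which is 1-Lipschitz and at most
    [r]: the case [n = 1], [L = 1] of [polar_lipschitz]. *)
Lemma proj_disk_nonexpansive (z w : R * R) : dsq (proj_disk z) (proj_disk w) <= dsq z w.
Proof.
  destruct (polar_form z) as (t & _ & ez). destruct (polar_form w) as (s & _ & ew).
  set (r1 := sqrt (normsq z)) in *. set (r2 := sqrt (normsq w)) in *.
  assert (h1 : 0 <= r1) by apply sqrt_pos. assert (h2 : 0 <= r2) by apply sqrt_pos.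
  rewrite ez, ew, !proj_disk_polar, !dsq_polar by easy.
  assert (h := polar_lipschitz (Rmin r1 1) (Rmin r2 1) r1 r2 (t - s) 1 1 (le_n 1)).
  simpl INR in h. rewrite !Rmult_1_l, pow1, Rmult_1_l in h.
  apply h; try lra; unfold Rmin; destruct (Rle_dec r1 1), (Rle_dec r2 1); try lra;
    unfold Rabs; repeat destruct Rcase_abs; lra.
Qed.

Lemma geometric_steps_converge (x : nat -> R) (C q : R) (hq : 0 <= q < 1)
  (h : forall n, Rabs (x (S n) - x n) <= C * q ^ n) : exists l : R, is_lim_seq x l.
Proof.
  assert (e : ex_series (fun n => x (S n) - x n)).
  { apply (ex_series_le (V := R_CompleteNormedModule)) with (fun n => C * q ^ n).
    - exact h.
    - apply (ex_series_scal_l C (fun n => q ^ n)). exists (/ (1 - q)).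
      apply is_series_geom. rewrite Rabs_pos_eq; lra. }
  destruct e as [l hl]. exists (l + x O). apply is_lim_seq_incr_1.
  apply is_lim_seq_ext with (fun n => sum_n (fun n => x (S n) - x n) n + x O).
  - intros n. induction n as [| n IH].
    + rewrite sum_O. ring.
    + rewrite sum_Sn. unfold plus; simpl. lra.
  - apply (is_lim_seq_plus' _ _ l (x O)); [exact hl | apply is_lim_seq_const].
Qed.

Lemma dsq_le_coord (z w : R * R) (e : R) (he : 0 <= e) (h : dsq z w <= e ^ 2) :
  Rabs (fst z - fst w) <= e /\ Rabs (snd z - snd w) <= e.
Proof.
  unfold dsq in h.
  assert (h1 := pow2_ge_0 (fst z - fst w)). assert (h2 := pow2_ge_0 (snd z - snd w)).
  split; apply Rsqr_incr_0_var; try easy; unfold Rsqr;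
    rewrite <- Rabs_mult, Rabs_pos_eq by apply Rle_0_sqr; simpl in *; lra.
Qed.

Lemma contraction_fixed_point (T : R * R -> R * R) (q : R) (hq : 0 <= q < 1)
  (hT : forall z w, dsq (T z) (T w) <= q ^ 2 * dsq z w) : exists z, T z = z.
Proof.
  set (zn := fix zn (n : nat) : R * R :=
               match n with O => (0, 0) | S m => T (zn m) end).
  set (C := sqrt (dsq (zn 1%nat) (zn O))).
  assert (hC : C ^ 2 = dsq (zn 1%nat) (zn O)) by (apply pow2_sqrt, dsq_pos).
  assert (hC0 : 0 <= C) by apply sqrt_pos.
  assert (hs : forall n, dsq (zn (S n)) (zn n) <= (C * q ^ n) ^ 2).
  { intros n. induction n as [| n IH].
    - simpl (q ^ 0). rewrite Rmult_1_r, hC. lra.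
    - apply Rle_trans with (1 := hT _ _).
      apply Rle_trans with (q ^ 2 * (C * q ^ n) ^ 2).
      + apply Rmult_le_compat_l; [apply pow2_ge_0 | exact IH].
      + right. simpl. ring. }
  assert (hpos : forall n, 0 <= C * q ^ n)
    by (intros; apply Rmult_le_pos; [easy | apply pow_le; lra]).
  destruct (geometric_steps_converge (fun n => fst (zn n)) C q hq) as [lx hx].
  { intros n. now apply (dsq_le_coord (zn (S n)) (zn n)). }
  destruct (geometric_steps_converge (fun n => snd (zn n)) C q hq) as [ly hy].
  { intros n. now apply (dsq_le_coord (zn (S n)) (zn n)). }

  set (z := (lx, ly)). exists z. symmetry. apply dsq_eq0.
  assert (h0 : is_lim_seq (fun n => dsq (zn n) z) 0).
  { replace (Finite 0) with (Finite ((lx - lx) ^ 2 + (ly - ly) ^ 2)) by (f_equal; ring).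
    assert (hsq : forall (x : nat -> R) (l m : R), is_lim_seq x l ->
              is_lim_seq (fun n => (x n - m) ^ 2) ((l - m) ^ 2)).
    { intros x l m hx'. apply (is_lim_seq_continuous (fun t => (t - m) ^ 2)); [| exact hx'].
      apply derivable_continuous_pt. reg. }
    apply is_lim_seq_plus'; [now apply (hsq (fun n => fst (zn n)))
                            | now apply (hsq (fun n => snd (zn n)))]. }
  (* The limit is compared with its image through the iterate [S n]; the right side tends to 0, so
     [z] is fixed. *)
  assert (hle : forall n, dsq z (T z) <= 2 * (dsq (zn (S n)) z + q ^ 2 * dsq (zn n) z)).
  { intros n. assert (h1 := hT (zn n) z). change (T (zn n)) with (zn (S n)) in h1.
    apply Rle_trans with (2 * (dsq (zn (S n)) z + dsq (zn (S n)) (T z))); [| lra].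
    unfold dsq.
    assert (sq : forall x y w : R, (x - y) ^ 2 <= 2 * ((w - x) ^ 2 + (w - y) ^ 2))
      by (intros x y w; assert (h := pow2_ge_0 (w - x + (w - y))); lra).
    assert (s1 := sq (fst z) (fst (T z)) (fst (zn (S n)))).
    assert (s2 := sq (snd z) (snd (T z)) (snd (zn (S n)))). lra. }
  apply (is_lim_seq_le (fun _ => dsq z (T z))
           (fun n => 2 * (dsq (zn (S n)) z + q ^ 2 * dsq (zn n) z)) (dsq z (T z)) 0).
  - exact hle.
  - apply is_lim_seq_const.
  - replace (Finite 0) with (Rbar_mult 2 (0 + q ^ 2 * 0)) by (simpl; f_equal; ring).
    apply is_lim_seq_scal_l. apply is_lim_seq_plus'.
    + now apply (is_lim_seq_incr_1 (fun n => dsq (zn n) z)).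
    + apply (is_lim_seq_scal_l _ (q ^ 2) 0). exact h0.
Qed.

Section univalence.
Context (a c : R) (k : nat) (ha : 0 < a <= 1) (hk : (1 <= k)%nat)
  (hconv : INR k ^ 2 * Rabs (c * Fser a k 1) < Fser a 1 1)
  (hmono : 0 < mono_const a c k).

Local Notation V := (Vmap a c k).
Local Notation A := (Fser a 1 1).
Local Notation B := (c * Fser a k 1).
Local Notation Om := (Omega_set A B k).
Local Notation g := (gam A B k).

Lemma Vmap_circle (theta : R) : V (polar 1 theta) = g theta.
Proof.
  unfold Vmap, gam. rewrite normsq_polar, zpow_polar, !pow1. unfold polar. simpl.
  f_equal; ring.
Qed.

Lemma Vmap_injective (z w : R * R) (hz : normsq z <= 1) (hw : normsq w <= 1)
  (h : V z = V w) : z = w.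
Proof.
  assert (hm := Vmap_expanding a c k ha hk z w hmono hz hw). rewrite h in hm.
  apply dsq_eq0, Rmult_le_reg_l with (mono_const a c k ^ 2); [now apply pow_lt |].
  apply Rle_trans with (1 := hm). unfold dsq. lra.
Qed.

(* A fixed point of [z |-> proj (w - (V z - z))], which is a contraction. *)
Lemma Vmap_variational (w : R * R) :
  exists z lambda, normsq z <= 1 /\ 0 <= lambda /\ (lambda = 0 \/ normsq z = 1) /\
    w = (fst (V z) + lambda * fst z, snd (V z) + lambda * snd z).
Proof.
  set (Q := fun z => (fst w - fst (Vpert a c k z), snd w - snd (Vpert a c k z))).
  (* The inner projection extends the map to the whole plane, since [Vpert] is known to contract on
     the closed disk only; it acts trivially at the fixed point. *)
  destruct (contraction_fixed_point (fun z => proj_disk (Q (proj_disk z)))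
              (1 - mono_const a c k)) as [z hz].
  - assert (h := mono_const_le a c k ha hk). lra.
  - intros z z'. apply Rle_trans with (1 := proj_disk_nonexpansive _ _).
    apply Rle_trans with ((1 - mono_const a c k) ^ 2 * dsq (proj_disk z) (proj_disk z')).
    + apply Rle_trans with (2 := Vpert_contraction a c k ha hk _ _
        (proj_disk_normsq z) (proj_disk_normsq z')).
      right. unfold dsq, Q. cbn [fst snd]. ring.
    + apply Rmult_le_compat_l; [apply pow2_ge_0 | apply proj_disk_nonexpansive].
  - assert (hz1 : normsq z <= 1) by (rewrite <- hz; apply proj_disk_normsq).
    rewrite (proj_disk_id z hz1) in hz. set (y := Q z) in *.
    assert (hw : w = (fst (V z) + (fst y - fst z), snd (V z) + (snd y - snd z))).
    { rewrite (surjective_pairing w) at 1.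
      unfold y, Q, Vpert. cbn [fst snd]. f_equal; ring. }
    destruct (Rle_or_lt (normsq y) 1) as [hy | hy].
    + rewrite (proj_disk_id y hy) in hz.
      exists z, 0. split; [easy |]. split; [lra |]. split; [now left |].
      rewrite hw at 1. rewrite hz. f_equal; ring.
    (* Here [y] lies outside the disk and [z] is its radial projection, so [y = r z] and
       [lambda = r - 1]. *)
    + destruct (polar_form y) as (t & _ & ey). set (r := sqrt (normsq y)) in *.
      assert (hr : 1 < r).
      { unfold r. rewrite <- sqrt_1 at 1. apply sqrt_lt_1_alt. lra. }
      rewrite ey, proj_disk_polar, Rmin_right in hz by lra.
      exists z, (r - 1). split; [easy |]. split; [lra |].
      split; [right; rewrite <- hz, normsq_polar; ring |].
      rewrite hw at 1. rewrite ey, <- hz. unfold polar. cbn [fst snd]. f_equal; ring.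
Qed.

Lemma unit_polar (z : R * R) (hz : normsq z = 1) : exists theta, z = polar 1 theta.
Proof.
  destruct (polar_form z) as (t & _ & e). rewrite hz, sqrt_1 in e. now exists t.
Qed.

Lemma Vmap_onto (w : R * R) (hw : Om w) : exists z, normsq z < 1 /\ V z = w.
Proof.
  destruct (Vmap_variational w) as (z & l & hz & hl & hc & e).
  destruct (Rle_lt_or_eq_dec _ _ hz) as [h | h].
  - exists z. split; [easy |]. destruct hc as [-> | hc]; [| lra].
    rewrite e, !Rmult_0_l, !Rplus_0_r. apply surjective_pairing.
  - exfalso. destruct (unit_polar z h) as [t ->]. rewrite Vmap_circle in e.
    specialize (hw t). assert (hp := cis_nrm_pos A B k hk hconv t).
    assert (hn : 0 <= l * inner (polar 1 t) (nrm A B k t))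
      by (apply Rmult_le_pos; lra).
    assert (e' : support_gap A B k w t = l * inner (polar 1 t) (nrm A B k t)).
    { rewrite e. unfold support_gap, inner. cbn [fst snd]. ring. }
    lra.
Qed.

Lemma Vmap_scale_lipschitz (z : R * R) (s t : R) (hz : normsq z <= 1)
  (hs : 0 <= s <= 1) (ht : 0 <= t <= 1) :
  dsq (V (s * fst z, s * snd z)) (V (t * fst z, t * snd z))
  <= 4 * (s - t) ^ 2.
Proof.
  assert (hn : forall r, 0 <= r <= 1 -> normsq (r * fst z, r * snd z) <= 1).
  { intros r hr. replace (normsq (r * fst z, r * snd z)) with (r ^ 2 * normsq z)
      by (unfold normsq; cbn [fst snd]; ring).
    assert (h := normsq_pos z). assert (r ^ 2 <= 1) by nra.
    assert (r ^ 2 * normsq z <= 1 * normsq z) by (apply Rmult_le_compat_r; lra). lra. }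
  apply Rle_trans with (1 := Vmap_lipschitz a c k ha hk _ _ hmono (hn s hs) (hn t ht)).
  apply Rmult_le_compat_l; [lra |].
  replace (dsq (s * fst z, s * snd z) (t * fst z, t * snd z)) with ((s - t) ^ 2 * normsq z)
    by (unfold dsq, normsq; cbn [fst snd]; ring).
  assert (h := pow2_ge_0 (s - t)).
  assert ((s - t) ^ 2 * normsq z <= (s - t) ^ 2 * 1) by (apply Rmult_le_compat_l; lra).
  lra.
Qed.

Lemma ball_of_dsq (z w : C) (e : posreal) (h : dsq w z < e ^ 2) :
  ball (M := C_UniformSpace) z e w.
Proof.
  assert (he := cond_pos e). unfold dsq in h.
  assert (h1 := pow2_ge_0 (fst w - fst z)). assert (h2 := pow2_ge_0 (snd w - snd z)).
  split.
  - change (Rabs (fst w - fst z) < e). apply Rsqr_incrst_0; try lra; [| apply Rabs_pos].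
    rewrite <- Rsqr_abs. unfold Rsqr. simpl in *. lra.
  - change (Rabs (snd w - snd z) < e). apply Rsqr_incrst_0; try lra; [| apply Rabs_pos].
    rewrite <- Rsqr_abs. unfold Rsqr. simpl in *. lra.
Qed.

(* Along the segment from 0 to [z] the image cannot leave the domain: at the exit
   time it would be on the boundary curve, which only the unit circle reaches. *)
Lemma Vmap_into (z : R * R) (hz : normsq z < 1) : Om (V z).
Proof.
  apply NNPP. intros hn.
  set (P := fun s => V (s * fst z, s * snd z)).
  assert (P1 : P 1 = V z).
  { unfold P. rewrite !Rmult_1_l. now rewrite <- surjective_pairing. }
  assert (P0 : P 0 = (0, 0)).
  { unfold P. rewrite !Rmult_0_l. now apply Vmap_0. }
  assert (hcl : forall s (e : posreal), 0 <= s <= 1 -> exists d : posreal,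
            forall t, 0 <= t <= 1 -> Rabs (t - s) < d ->
              ball (M := C_UniformSpace) (P s) e (P t)).
  { intros s e hs. assert (he := cond_pos e).
    assert (hd : 0 < e / 2) by lra.
    exists (mkposreal _ hd). intros t ht hts. simpl in hts. apply ball_of_dsq.
    apply Rle_lt_trans with (1 := Vmap_scale_lipschitz z t s ltac:(lra) ht hs).
    rewrite <- pow2_abs. assert (hx := Rabs_pos (t - s)). nra. }
  (* The times up to which the path from 0 has stayed in the domain; the supremum [s] is the
     candidate exit time. *)
  set (E := fun s => 0 <= s <= 1 /\ forall t, 0 <= t <= s -> Om (P t)).
  destruct (completeness E) as [s [hub hlub]].
  { exists 1. intros s [hs _]. lra. }
  { exists 0. split; [lra |]. intros t ht. replace t with 0 by lra. rewrite P0.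
    now apply Omega_set_0. }
  assert (hs0 : 0 <= s).
  { apply hub. split; [lra |]. intros t ht. replace t with 0 by lra. rewrite P0.
    now apply Omega_set_0. }
  assert (hs1 : s <= 1) by (apply hlub; intros t [ht _]; lra).
  assert (hbelow : forall t, 0 <= t < s -> Om (P t)).
  { intros t ht. apply NNPP. intros hnt. assert (s <= t); [| lra].
    apply hlub. intros x [hx1 hx2]. apply Rnot_lt_le. intros hlt.
    apply hnt, hx2. lra. }
  assert (hs : Om (P s)).
  { apply NNPP. intros hns.
    assert (hspos : 0 < s).
    { destruct hs0 as [h | h]; [easy |]. exfalso. apply hns. rewrite <- h, P0.
      now apply Omega_set_0. }
    (* [P s] is outside but a limit of the points [P t], [t < s]. As a point of the curve it is also
       the image of a point of the circle, against injectivity. *)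
    assert (hb : boundary Om (P s)).
    { split.
      - intros h. now apply (locally_singleton (T := C_UniformSpace)) in h.
      - intros [e h]. destruct (hcl s e ltac:(lra)) as [d hd].
        assert (hdp := cond_pos d).
        set (t := Rmax 0 (s - d / 2)).
        assert (ht0 : 0 <= t) by apply Rmax_l.
        assert (ht1 : s - d / 2 <= t) by apply Rmax_r.
        assert (ht2 : t < s) by (apply Rmax_lub_lt; lra).
        apply (h (P t)); [| apply hbelow; lra].
        apply hd; [lra |]. apply Rabs_def1; lra. }
    apply (boundary_Omega_set A B k hk hconv) in hb. destruct hb as [t ht].
    rewrite <- Vmap_circle in ht. unfold P in ht.
    assert (hss : normsq (s * fst z, s * snd z) < 1).
    { replace (normsq (s * fst z, s * snd z)) with (s ^ 2 * normsq z)
        by (unfold normsq; cbn [fst snd]; ring).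
      assert (h := normsq_pos z). assert (s ^ 2 <= 1) by nra.
      assert (s ^ 2 * normsq z <= 1 * normsq z) by (apply Rmult_le_compat_r; lra). lra. }
    apply Vmap_injective in ht; [| lra | rewrite normsq_polar; lra].
    rewrite ht, normsq_polar in hss. lra. }
  destruct (Rle_lt_or_eq_dec _ _ hs1) as [hlt | heq].
  (* If [s < 1], openness at [P s] would let the path stay inside beyond the supremum. *)
  - destruct (Omega_set_open A B k hk hconv _ hs) as [e he].
    destruct (hcl s e ltac:(lra)) as [d hd]. assert (hdp := cond_pos d).
    set (s' := Rmin 1 (s + d / 2)).
    assert (h1 : s' <= 1) by apply Rmin_l. assert (h2 : s' <= s + d / 2) by apply Rmin_r.
    assert (h3 : s < s') by (apply Rmin_glb_lt; lra).
    assert (s' <= s); [| lra].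
    apply hub. split; [lra |]. intros t ht.
    destruct (Rlt_or_le t s) as [hts | hts]; [apply hbelow; lra |].
    apply he, hd; [lra |]. apply Rabs_def1; lra.
  - rewrite heq, P1 in hs. easy.
Qed.

End univalence.

(** * Poisson integrals of trigonometric data *)

Lemma sum_n_abs_tail (u be : nat -> R) (h : forall n, Rabs (u n) <= be n) (N m : nat) :
  Rabs (sum_n u (N + m) - sum_n u N) <= sum_n be (N + m) - sum_n be N.
Proof.
  induction m as [| m IH].
  - rewrite Nat.add_0_r. unfold Rminus. rewrite !Rplus_opp_r, Rabs_R0. lra.
  - rewrite Nat.add_succ_r, !sum_Sn.
    change (@plus R_AbelianMonoid) with Rplus.
    replace (sum_n u (N + m) + u (S (N + m)) - sum_n u N)
      with ((sum_n u (N + m) - sum_n u N) + u (S (N + m))) by ring.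
    apply Rle_trans with (1 := Rabs_triang _ _).
    assert (h1 := h (S (N + m))). lra.
Qed.

Lemma Series_tail_bound (u be : nat -> R) (h : forall n, Rabs (u n) <= be n)
  (hbe : ex_series be) (N : nat) :
  Rabs (Series u - sum_n u N) <= Series be - sum_n be N.
Proof.
  assert (hu : ex_series u) by now apply (ex_series_le (V := R_CompleteNormedModule)) with be.
  assert (lu : is_lim_seq (fun m => sum_n u (m + N)) (Series u))
    by (apply (is_lim_seq_incr_n (sum_n u)), Series_correct, hu).
  assert (lb : is_lim_seq (fun m => sum_n be (m + N)) (Series be))
    by (apply (is_lim_seq_incr_n (sum_n be)), Series_correct, hbe).
  apply (is_lim_seq_le (fun m => Rabs (sum_n u (m + N) - sum_n u N))
           (fun m => sum_n be (m + N) - sum_n be N)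
           (Rabs (Series u - sum_n u N)) (Series be - sum_n be N)).
  - intros m. rewrite Nat.add_comm. now apply sum_n_abs_tail.
  - apply (is_lim_seq_abs _ (Finite (Series u - sum_n u N))).
    apply is_lim_seq_minus'; [exact lu | apply is_lim_seq_const].
  - apply is_lim_seq_minus'; [exact lb | apply is_lim_seq_const].
Qed.

(** The Weierstrass M-test: the tail of [be] bounds the remainder independently of [t], and uniform
    convergence permits termwise integration. *)
Lemma is_RInt_Series (F : nat -> R -> R) (be I : nat -> R) (x y : R)
  (hF : forall n t, Rabs (F n t) <= be n) (hbe : ex_series be)
  (hI : forall n, is_RInt (F n) x y (I n)) :
  ex_series I /\ is_RInt (fun t => Series (fun n => F n t)) x y (Series I).
Proof.
  destruct (filterlim_RInt (V := R_CompleteNormedModule)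
    (fun N t => sum_n (fun n => F n t) N) x y eventually _
    (fun t => Series (fun n => F n t)) (fun N => sum_n I N)) as (If & h1 & h2).
  - intros N. induction N as [| N IH].
    + rewrite sum_O. apply is_RInt_ext with (F O); [| apply hI].
      intros t _. now rewrite sum_O.
    + rewrite sum_Sn.
      apply is_RInt_ext with (fun t => plus (sum_n (fun n => F n t) N) (F (S N) t)).
      * intros t _. now rewrite sum_Sn.
      * apply (is_RInt_plus (V := R_NormedModule)); [exact IH | apply hI].
  - intros P [eps hP].
    assert (hl : is_lim_seq (sum_n be) (Series be)) by exact (Series_correct be hbe).
    apply is_lim_seq_spec in hl.
    destruct (hl eps) as [N hN]. exists N. intros n hn. apply hP. intros t.
    change (Rabs (sum_n (fun n => F n t) n - Series (fun n => F n t)) < eps).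
    rewrite Rabs_minus_sym.
    apply Rle_lt_trans with (Series be - sum_n be n).
    + apply (Series_tail_bound (fun n => F n t) be); easy.
    + specialize (hN n hn). rewrite Rabs_minus_sym in hN.
      apply Rle_lt_trans with (1 := Rle_abs _) (2 := hN).
  - assert (hs : is_series I If) by exact h1.
    split; [now exists If |]. now rewrite (is_series_unique _ _ hs).
Qed.

Lemma is_series_single (u : nat -> R) (N : nat) (h : forall n, n <> N -> u n = 0) :
  is_series u (u N).
Proof.
  assert (h1 : forall n, sum_n u n = if Nat.ltb n N then 0 else u N).
  { intros n. induction n as [| n IH].
    - rewrite sum_O. destruct N; simpl; [easy | now apply h].
    - rewrite sum_Sn, IH. change (@plus R_AbelianMonoid) with Rplus.
      destruct (Nat.ltb_spec n N), (Nat.ltb_spec (S n) N); try lia.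
      + rewrite (h (S n)) by lia. apply Rplus_0_r.
      + replace N with (S n) by lia. apply Rplus_0_l.
      + rewrite (h (S n)) by lia. apply Rplus_0_r. }
  apply (is_lim_seq_spec (sum_n u) (u N)). intros eps. exists N. intros n hn.
  rewrite h1. destruct (Nat.ltb_spec n N); [lia |].
  unfold Rminus. rewrite Rplus_opp_r, Rabs_R0. apply cond_pos.
Qed.

Lemma sin_period_Z (x : R) (m : Z) : sin (x + IZR m * (2 * PI)) = sin x.
Proof.
  destruct (Z_le_gt_dec 0 m) as [h | h].
  - rewrite <- (Z2Nat.id m h), <- INR_IZR_INZ.
    rewrite <- (sin_period x (Z.to_nat m)). f_equal. ring.
  - replace m with (- Z.of_nat (Z.to_nat (- m)))%Z by lia.
    rewrite opp_IZR, <- INR_IZR_INZ. set (n := Z.to_nat (- m)).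
    rewrite <- (sin_period (x + - INR n * (2 * PI)) n). f_equal. ring.
Qed.

Lemma is_RInt_cos_period (be : R) (m : Z) :
  is_RInt (fun t => cos (be + IZR m * t)) 0 (2 * PI)
    (if Z.eq_dec m 0 then 2 * PI * cos be else 0).
Proof.
  destruct (Z.eq_dec m 0) as [-> | hm].
  - apply is_RInt_ext with (fun _ => cos be).
    + intros t _. f_equal. ring.
    + replace (2 * PI * cos be) with (scal (2 * PI - 0) (cos be))
        by (unfold scal; simpl; unfold mult; simpl; ring).
      apply (is_RInt_const (V := R_NormedModule)).
  - assert (hm' : IZR m <> 0) by now apply eq_IZR_contrapositive.
    replace 0 with (minus (sin (be + IZR m * (2 * PI)) / IZR m)
                      (sin (be + IZR m * 0) / IZR m)) at 2.
    + apply (is_RInt_derive (fun t => sin (be + IZR m * t) / IZR m)).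
      * intros t _. auto_derive; [easy | field; easy].
      * intros t _. apply (ex_derive_continuous (V := R_NormedModule)). auto_derive. easy.
    + rewrite sin_period_Z, Rmult_0_r, Rplus_0_r. unfold minus, plus, opp; simpl. ring.
Qed.

Section poisson_moment.
Context (s r theta psi : R) (j : nat) (hs : 0 < s) (hr : 0 <= r < 1).

Let b := binom_coeff s.
Let D (tau : R) : R := 1 - 2 * r * cos (theta - tau) + r ^ 2.

Lemma binom_abs_series : ex_series (fun n => b n * r ^ n).
Proof.
  apply ex_series_Rabs, CV_disk_inside, inside_radius_1.
  - unfold b. rewrite binom_coeff_radius by easy. apply Rle_refl.
  - now apply Rabs_lt_1.
Qed.

Lemma binom_term_pos (n : nat) : 0 <= b n * r ^ n.
Proof.
  apply Rmult_le_pos; [apply Rlt_le, binom_coeff_pos, hs | apply pow_le; lra].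
Qed.

Lemma binom_trig_bound (n : nat) (x : R) (hx : Rabs x <= 1) :
  Rabs (b n * r ^ n * x) <= b n * r ^ n.
Proof.
  assert (h := binom_term_pos n). rewrite Rabs_mult, (Rabs_pos_eq _ h).
  rewrite <- (Rmult_1_r (b n * r ^ n)) at 2. now apply Rmult_le_compat_l.
Qed.

(* [|S|^2 cos eta = Re (e^(i eta) S conj S)] with S = (1 - z)^(-s). *)
Lemma modulus_double_series (phi x : R) :
  Series (fun n => b n * r ^ n *
    Series (fun m => b m * r ^ m * cos ((INR m - INR n) * phi + x)))
  = / Rpower (1 - 2 * r * cos phi + r ^ 2) s * cos x.
Proof.
  set (P := PSeries (fun n => b n * cos (INR n * phi)) r).
  set (Q := PSeries (fun n => b n * sin (INR n * phi)) r).
  assert (eP : P = Series (fun n => b n * r ^ n * cos (INR n * phi)))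
    by (apply Series_ext; intros; ring).
  assert (eQ : Q = Series (fun n => b n * r ^ n * sin (INR n * phi)))
    by (apply Series_ext; intros; ring).
  assert (xP : ex_series (fun n => b n * r ^ n * cos (INR n * phi))).
  { apply (ex_series_le (V := R_CompleteNormedModule)) with (2 := binom_abs_series).
    intros n. apply binom_trig_bound, Rabs_le, COS_bound. }
  assert (xQ : ex_series (fun n => b n * r ^ n * sin (INR n * phi))).
  { apply (ex_series_le (V := R_CompleteNormedModule)) with (2 := binom_abs_series).
    intros n. apply binom_trig_bound, Rabs_le, SIN_bound. }
  assert (lin : forall c d : R,
    ex_series (fun n => c * (b n * r ^ n * cos (INR n * phi))) /\
    ex_series (fun n => d * (b n * r ^ n * sin (INR n * phi)))).
  { intros c d. split.
    - now apply (ex_series_scal_l c (fun n => b n * r ^ n * cos (INR n * phi))).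
    - now apply (ex_series_scal_l d (fun n => b n * r ^ n * sin (INR n * phi))). }
  assert (comb : forall c d : R,
    Series (fun n => c * (b n * r ^ n * cos (INR n * phi))
                     + d * (b n * r ^ n * sin (INR n * phi))) = c * P + d * Q).
  { intros c d. destruct (lin c d) as [l1 l2].
    rewrite (Series_plus _ _ l1 l2), !Series_scal_l, eP, eQ. easy. }
  assert (inn : forall n : nat,
    Series (fun m => b m * r ^ m * cos ((INR m - INR n) * phi + x))
    = cos (x - INR n * phi) * P + - sin (x - INR n * phi) * Q).
  { intros n. rewrite <- comb. apply Series_ext. intros m.
    replace ((INR m - INR n) * phi + x) with (INR m * phi + (x - INR n * phi)) by ring.
    rewrite cos_plus. ring. }
  transitivity (Series (fun n =>
    (cos x * P - sin x * Q) * (b n * r ^ n * cos (INR n * phi))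
    + (sin x * P + cos x * Q) * (b n * r ^ n * sin (INR n * phi)))).
  - apply Series_ext. intros n. rewrite inn, cos_minus, sin_minus. ring.
  - rewrite comb. assert (h := binom_modulus s phi hs r hr). fold b in h. fold P Q in h.
    assert (hp : 0 < Rpower (1 - 2 * r * cos phi + r ^ 2) s) by apply exp_pos.
    apply Rmult_eq_reg_r with (Rpower (1 - 2 * r * cos phi + r ^ 2) s); [| lra].
    transitivity ((P ^ 2 + Q ^ 2) * Rpower (1 - 2 * r * cos phi + r ^ 2) s * cos x);
      [ring |].
    rewrite h. field. lra.
Qed.

(** In the double series of [|S|^2] the term [(m, n)] has frequency [m - n]; integration against
    frequency [j] keeps [m = n + j] alone. The phase [psi] covers sine as well as cosine data. *)
Lemma is_RInt_binom_modulus :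
  is_RInt (fun tau => / Rpower (D tau) s * cos (INR j * tau - psi)) 0 (2 * PI)
    (2 * PI * cos (INR j * theta - psi) * r ^ j
     * Series (fun n => b n * b (n + j)%nat * (r ^ 2) ^ n)).
Proof.
  set (W := 2 * PI * cos (INR j * theta - psi)).
  set (F := fun n m tau => b m * r ^ m *
     cos ((INR m - INR n) * (theta - tau) + (INR j * tau - psi))).
  assert (hin : forall n, is_RInt (fun tau => Series (fun m => F n m tau)) 0 (2 * PI)
                  (b (n + j)%nat * r ^ (n + j) * W)).
  { intros n.
    set (I := fun m => b m * r ^ m * (if Nat.eq_dec m (n + j) then W else 0)).
    destruct (is_RInt_Series (F n) (fun m => b m * r ^ m) I 0 (2 * PI)) as [_ h].
    - intros m t. apply binom_trig_bound, Rabs_le, COS_bound.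
    - exact binom_abs_series.
    - intros m. unfold I.
      apply (is_RInt_scal (V := R_NormedModule)
        (fun tau => cos ((INR m - INR n) * (theta - tau) + (INR j * tau - psi)))).
      assert (hz := is_RInt_cos_period ((INR m - INR n) * theta - psi)
                      (Z.of_nat (n + j) - Z.of_nat m)).
      apply is_RInt_ext with (f := fun t => cos ((INR m - INR n) * theta - psi
                  + IZR (Z.of_nat (n + j) - Z.of_nat m) * t)).
      + intros t _. rewrite minus_IZR, <- !INR_IZR_INZ, plus_INR. f_equal. ring.
      + destruct (Z.eq_dec (Z.of_nat (n + j) - Z.of_nat m) 0) as [e | e],
          (Nat.eq_dec m (n + j)) as [e' | e']; try lia; [| exact hz].
        replace W with (2 * PI * cos ((INR m - INR n) * theta - psi)); [exact hz |].
        unfold W. rewrite e', plus_INR. f_equal. f_equal. ring.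
    - assert (hs1 := is_series_single I (n + j)%nat).
      rewrite (is_series_unique I (I (n + j)%nat)) in h.
      + unfold I in h. destruct (Nat.eq_dec (n + j) (n + j)); [exact h | easy].
      + apply hs1. intros m hm. unfold I. destruct (Nat.eq_dec m (n + j)); [easy | ring]. }
  set (B0 := Series (fun m => b m * r ^ m)).
  destruct (is_RInt_Series (fun n tau => b n * r ^ n * Series (fun m => F n m tau))
    (fun n => b n * r ^ n * B0)
    (fun n => b n * r ^ n * (b (n + j)%nat * r ^ (n + j) * W)) 0 (2 * PI)) as [_ h].
  - intros n t. rewrite Rabs_mult, (Rabs_pos_eq _ (binom_term_pos n)).
    apply Rmult_le_compat_l; [apply binom_term_pos |].
    apply Series_dominated; [| exact binom_abs_series].
    intros m. apply binom_trig_bound, Rabs_le, COS_bound.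
  - apply (ex_series_scal_r B0 (fun n => b n * r ^ n)). exact binom_abs_series.
  - intros n. apply (is_RInt_scal (V := R_NormedModule)
      (fun tau => Series (fun m => F n m tau))). apply hin.
  - apply is_RInt_ext with
      (f := fun t => Series (fun n => b n * r ^ n * Series (fun m => F n m t))).
    + intros t _. apply modulus_double_series.
    + replace (W * r ^ j * Series (fun n => b n * b (n + j)%nat * (r ^ 2) ^ n))
        with (Series (fun n => b n * r ^ n * (b (n + j)%nat * r ^ (n + j) * W)));
        [exact h |].
      rewrite <- Series_scal_l. apply Series_ext. intros n.
      rewrite pow_add, <- pow_mult. replace (2 * n)%nat with (n + n)%nat by lia.
      rewrite pow_add. ring.
Qed.

End poisson_moment.

(** It identifies the surviving diagonal sum as a hypergeometric series with parameters [s + j],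
    [s], [j + 1]. *)
Lemma binom_coeff_add (s : R) (n j : nat) :
  binom_coeff s n * binom_coeff s (n + j)
  = binom_coeff s j * hyp_coeff (s + INR j) s (INR j + 1) n.
Proof.
  unfold binom_coeff, hyp_coeff.
  rewrite <- (pochhammer_1 (n + j)), !pochhammer_add, pochhammer_1.
  rewrite (Rplus_comm 1).
  assert (h1 := INR_fact_lt_0 n). assert (h2 := INR_fact_lt_0 j).
  assert (h3 := pochhammer_pos (INR j + 1) n
                  ltac:(assert (0 <= INR j) by apply pos_INR; lra)).
  field. lra.
Qed.

(** For [s = a + 1] the diagonal sum is the Euler transform of [F_j]; the resulting power of
    [1 - r^2] in the denominator is the one in the numerator of the kernel. *)
Lemma poisson_moment (a r theta psi : R) (j : nat) (ha : 0 < a <= 1) (hj : (1 <= j)%nat)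
  (hr : 0 <= r < 1) :
  is_RInt (fun tau => / Rpower (1 - 2 * r * cos (theta - tau) + r ^ 2) (a + 1)
                      * cos (INR j * tau - psi)) 0 (2 * PI)
    (2 * PI * cos (INR j * theta - psi) * r ^ j
     * (binom_coeff (a + 1) j * (Fser a j (r ^ 2) / Rpower (1 - r ^ 2) (1 + 2 * a)))).
Proof.
  assert (h := is_RInt_binom_modulus (a + 1) r theta psi j ltac:(lra) hr).
  replace (binom_coeff (a + 1) j * (Fser a j (r ^ 2) / Rpower (1 - r ^ 2) (1 + 2 * a)))
    with (Series (fun n => binom_coeff (a + 1) n * binom_coeff (a + 1) (n + j) * (r ^ 2) ^ n));
    [exact h |].
  assert (hj1 := INR_ge_1 j hj).
  unfold Fser, fcoeff.
  rewrite (hyp_euler (- a) (INR j - a) j (1 + 2 * a)); try easy; try lra.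
  - transitivity (Series (fun n => binom_coeff (a + 1) j *
      (hyp_coeff (INR j + 1 - - a) (INR j + 1 - (INR j - a)) (INR j + 1) n * (r ^ 2) ^ n))).
    + apply Series_ext. intros n. rewrite binom_coeff_add.
      replace (INR j + 1 - - a) with (a + 1 + INR j) by ring.
      replace (INR j + 1 - (INR j - a)) with (a + 1) by ring. ring.
    + rewrite Series_scal_l. unfold PSeries.
      assert (hp : 0 < Rpower (1 - r ^ 2) (1 + 2 * a)) by apply exp_pos.
      field. lra.
  - now apply fcoeff_radius.
  - nra.
Qed.

(** * The differential equation *)

Lemma Cmod_sq (z : C) : Cmod z ^ 2 = normsq z.
Proof.
  unfold Cmod. rewrite pow2_sqrt; [easy |]. exact (normsq_pos z).
Qed.

Lemma unit_disk_normsq (z : C) : unit_disk z <-> normsq z < 1.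
Proof.
  unfold unit_disk. rewrite <- Cmod_sq. assert (h := Cmod_ge_0 z). split; intros; nra.
Qed.

Lemma continuous_fst_C (z : C) : continuous (T := C_UniformSpace) (U := R_UniformSpace) fst z.
Proof. destruct z. apply (continuous_fst (U := R_UniformSpace) (V := R_UniformSpace)). Qed.

Lemma continuous_snd_C (z : C) : continuous (T := C_UniformSpace) (U := R_UniformSpace) snd z.
Proof. destruct z. apply (continuous_snd (U := R_UniformSpace) (V := R_UniformSpace)). Qed.

Definition ctsC (h : C -> R) (z : C) : Prop :=
  continuous (T := C_UniformSpace) (U := R_UniformSpace) h z.

Lemma ctsC_plus (f g : C -> R) (z : C) (hf : ctsC f z) (hg : ctsC g z) :
  ctsC (fun w => f w + g w) z.
Proof. exact (continuous_plus (U := C_UniformSpace) (V := R_NormedModule) f g z hf hg). Qed.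

Lemma ctsC_mult (f g : C -> R) (z : C) (hf : ctsC f z) (hg : ctsC g z) :
  ctsC (fun w => f w * g w) z.
Proof. exact (continuous_mult (U := C_UniformSpace) (K := R_AbsRing) f g z hf hg). Qed.

Lemma ctsC_const (c : R) (z : C) : ctsC (fun _ => c) z.
Proof. apply continuous_const. Qed.

Lemma ctsC_opp (f : C -> R) (z : C) (hf : ctsC f z) : ctsC (fun w => - f w) z.
Proof. exact (continuous_opp (U := C_UniformSpace) (V := R_NormedModule) f z hf). Qed.

Lemma ctsC_minus (f g : C -> R) (z : C) (hf : ctsC f z) (hg : ctsC g z) :
  ctsC (fun w => f w - g w) z.
Proof. apply ctsC_plus; [easy | now apply ctsC_opp]. Qed.

Ltac solve_ctsC :=
  lazymatch goal with
  | |- ctsC (fun w => @?f w + @?g w) ?z => apply (ctsC_plus f g z); cbv beta; solve_ctsC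
  | |- ctsC (fun w => @?f w - @?g w) ?z => apply (ctsC_minus f g z); cbv beta; solve_ctsC
  | |- ctsC (fun w => @?f w * @?g w) ?z => apply (ctsC_mult f g z); cbv beta; solve_ctsC
  | |- ctsC (fun _ => ?c) ?z => apply (ctsC_const c z)
  | |- _ => assumption
  end.

Lemma ctsC_normsq (z : C) : ctsC normsq z.
Proof.
  apply (ctsC_plus (fun w => fst w ^ 2) (fun w => snd w ^ 2)).
  - apply (ctsC_mult fst (fun w => fst w * 1)); [apply continuous_fst_C |].
    apply ctsC_mult; [apply continuous_fst_C | apply ctsC_const].
  - apply (ctsC_mult snd (fun w => snd w * 1)); [apply continuous_snd_C |].
    apply ctsC_mult; [apply continuous_snd_C | apply ctsC_const].
Qed.

Lemma unit_disk_open (z : C) (hz : unit_disk z) : locally (T := C_UniformSpace) z unit_disk.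
Proof.
  apply unit_disk_normsq in hz.
  assert (h := ctsC_normsq z (fun y => y < 1) (open_lt 1 _ hz)).
  destruct h as [e he]. exists e. intros w hw. apply unit_disk_normsq. now apply he.
Qed.

Lemma locally_fst (z : C) (P : C -> Prop) (h : locally (T := C_UniformSpace) z P) :
  locally (fst z) (fun t => P (t, snd z)).
Proof.
  destruct h as [e he]. exists e. intros t ht. apply he. split; [exact ht |].
  apply ball_center.
Qed.

Lemma locally_snd (z : C) (P : C -> Prop) (h : locally (T := C_UniformSpace) z P) :
  locally (snd z) (fun t => P (fst z, t)).
Proof.
  destruct h as [e he]. exists e. intros t ht. apply he. split; [apply ball_center |].
  exact ht.
Qed.

Definition is_dx (h hx : C -> R) (z : C) : Prop :=
  is_derive (fun t => h (t, snd z)) (fst z) (hx z).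
Definition is_dy (h hy : C -> R) (z : C) : Prop :=
  is_derive (fun t => h (fst z, t)) (snd z) (hy z).

Lemma is_dx_ext (f h hx : C -> R) (z : C) (hz : unit_disk z)
  (e : forall w, unit_disk w -> f w = h w) (hd : is_dx h hx z) : is_dx f hx z.
Proof.
  apply (is_derive_ext_loc (fun t => h (t, snd z))); [| exact hd].
  generalize (locally_fst z _ (unit_disk_open z hz)). apply filter_imp.
  intros t ht. now rewrite e.
Qed.

Lemma is_dy_ext (f h hy : C -> R) (z : C) (hz : unit_disk z)
  (e : forall w, unit_disk w -> f w = h w) (hd : is_dy h hy z) : is_dy f hy z.
Proof.
  apply (is_derive_ext_loc (fun t => h (fst z, t))); [| exact hd].
  generalize (locally_snd z _ (unit_disk_open z hz)). apply filter_imp.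
  intros t ht. now rewrite e.
Qed.

Lemma Dx_eq (f fx : C -> R) (z : C) (h : is_dx f fx z) : Defs.Dx f z = fx z.
Proof. apply is_derive_unique. exact h. Qed.

Lemma Dy_eq (f fy : C -> R) (z : C) (h : is_dy f fy z) : Dy f z = fy z.
Proof. apply is_derive_unique. exact h. Qed.

Lemma ctsC_ext (f g : C -> R) (z : C) (hz : unit_disk z)
  (e : forall w, unit_disk w -> f w = g w) (hg : ctsC g z) : ctsC f z.
Proof.
  apply (continuous_ext_loc (T := C_UniformSpace) (U := R_UniformSpace) f g); [| exact hg].
  generalize (unit_disk_open z hz). apply filter_imp. intros w hw. now rewrite e.
Qed.

Lemma is_dx_mult (f fx g gx : C -> R) (z : C) (hf : is_dx f fx z) (hg : is_dx g gx z) :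
  is_dx (fun w => f w * g w) (fun w => fx w * g w + f w * gx w) z.
Proof.
  unfold is_dx in *. destruct z as [x y].
  exact (is_derive_mult _ _ _ _ _ hf hg Rmult_comm).
Qed.

Lemma is_dy_mult (f fy g gy : C -> R) (z : C) (hf : is_dy f fy z) (hg : is_dy g gy z) :
  is_dy (fun w => f w * g w) (fun w => fy w * g w + f w * gy w) z.
Proof.
  unfold is_dy in *. destruct z as [x y].
  exact (is_derive_mult _ _ _ _ _ hf hg Rmult_comm).
Qed.

Lemma is_dx_plus (f fx g gx : C -> R) (z : C) (hf : is_dx f fx z) (hg : is_dx g gx z) :
  is_dx (fun w => f w + g w) (fun w => fx w + gx w) z.
Proof. exact (is_derive_plus _ _ _ _ _ hf hg). Qed.

Lemma is_dy_plus (f fy g gy : C -> R) (z : C) (hf : is_dy f fy z) (hg : is_dy g gy z) :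
  is_dy (fun w => f w + g w) (fun w => fy w + gy w) z.
Proof. exact (is_derive_plus _ _ _ _ _ hf hg). Qed.

Lemma is_dx_eq (f fx gx : C -> R) (z : C) (h : is_dx f fx z) (e : fx z = gx z) :
  is_dx f gx z.
Proof. unfold is_dx in *. now rewrite <- e. Qed.

Lemma is_dy_eq (f fy gy : C -> R) (z : C) (h : is_dy f fy z) (e : fy z = gy z) :
  is_dy f gy z.
Proof. unfold is_dy in *. now rewrite <- e. Qed.

Lemma is_dx_minus (f fx g gx : C -> R) (z : C) (hf : is_dx f fx z) (hg : is_dx g gx z) :
  is_dx (fun w => f w - g w) (fun w => fx w - gx w) z.
Proof. exact (is_derive_minus _ _ _ _ _ hf hg). Qed.

Lemma is_dy_minus (f fy g gy : C -> R) (z : C) (hf : is_dy f fy z) (hg : is_dy g gy z) :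
  is_dy (fun w => f w - g w) (fun w => fy w - gy w) z.
Proof. exact (is_derive_minus _ _ _ _ _ hf hg). Qed.

Lemma is_dx_scal (c : R) (f fx : C -> R) (z : C) (hf : is_dx f fx z) :
  is_dx (fun w => c * f w) (fun w => c * fx w) z.
Proof. exact (is_derive_scal _ _ c _ hf). Qed.

Lemma is_dy_scal (c : R) (f fy : C -> R) (z : C) (hf : is_dy f fy z) :
  is_dy (fun w => c * f w) (fun w => c * fy w) z.
Proof. exact (is_derive_scal _ _ c _ hf). Qed.

Lemma is_d_const (c : R) (z : C) :
  is_dx (fun _ => c) (fun _ => 0) z /\ is_dy (fun _ => c) (fun _ => 0) z.
Proof. split; unfold is_dx, is_dy; auto_derive; easy. Qed.

Lemma is_d_fst (c : R) (z : C) :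
  is_dx (fun w => c * fst w) (fun _ => c) z /\ is_dy (fun w => c * fst w) (fun _ => 0) z.
Proof. split; unfold is_dx, is_dy; cbn [fst snd]; auto_derive; try easy; ring. Qed.

Lemma is_d_snd (c : R) (z : C) :
  is_dx (fun w => c * snd w) (fun _ => 0) z /\ is_dy (fun w => c * snd w) (fun _ => c) z.
Proof. split; unfold is_dx, is_dy; cbn [fst snd]; auto_derive; try easy; ring. Qed.

Definition C1_data (h hx hy : C -> R) : Prop :=
  forall z, unit_disk z -> is_dx h hx z /\ is_dy h hy z /\ ctsC hx z /\ ctsC hy z.

Lemma C1_on_of_data (f h hx hy : C -> R) (hd : C1_data h hx hy)
  (e : forall w, unit_disk w -> f w = h w) :
  C1_on unit_disk f /\ (forall w, unit_disk w -> Defs.Dx f w = hx w)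
  /\ (forall w, unit_disk w -> Dy f w = hy w).
Proof.
  assert (ex : forall w, unit_disk w -> is_dx f hx w)
    by (intros w hw; apply (is_dx_ext f h); try easy; now apply hd).
  assert (ey : forall w, unit_disk w -> is_dy f hy w)
    by (intros w hw; apply (is_dy_ext f h); try easy; now apply hd).
  assert (dx : forall w, unit_disk w -> Defs.Dx f w = hx w)
    by (intros w hw; now apply Dx_eq, ex).
  assert (dy : forall w, unit_disk w -> Dy f w = hy w)
    by (intros w hw; now apply Dy_eq, ey).
  repeat split; try assumption.
  - eexists. now apply ex.
  - eexists. now apply ey.
  - apply (ctsC_ext _ hx); try easy. now apply hd.
  - apply (ctsC_ext _ hy); try easy. now apply hd.
Qed.

(* The last clause is [T_alpha h = 0] multiplied by [(1-|z|^2)^(alpha+1)], for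
   [alpha = 2 a]. *)
Definition C2_solution (a : R) (h : C -> R) : Prop :=
  exists hx hy hxx hxy hyy,
    C1_data h hx hy /\ C1_data hx hxx hxy /\ C1_data hy hxy hyy /\
    forall z, unit_disk z ->
      - a ^ 2 * h z + a * (fst z * hx z + snd z * hy z)
      + (1 - normsq z) * ((hxx z + hyy z) / 4) = 0.

Lemma C1_data_combine (c d : R) (f fx fy g gx gy : C -> R)
  (hf : C1_data f fx fy) (hg : C1_data g gx gy) :
  C1_data (fun z => c * f z + d * g z) (fun z => c * fx z + d * gx z)
    (fun z => c * fy z + d * gy z).
Proof.
  intros z hz. destruct (hf z hz) as (f1 & f2 & f3 & f4).
  destruct (hg z hz) as (g1 & g2 & g3 & g4). split; [| split; [| split]].
  - apply is_dx_plus; now apply is_dx_scal.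
  - apply is_dy_plus; now apply is_dy_scal.
  - apply ctsC_plus; apply ctsC_mult; try assumption; apply ctsC_const.
  - apply ctsC_plus; apply ctsC_mult; try assumption; apply ctsC_const.
Qed.

Lemma C2_solution_combine (a c d : R) (f g : C -> R)
  (hf : C2_solution a f) (hg : C2_solution a g) :
  C2_solution a (fun z => c * f z + d * g z).
Proof.
  destruct hf as (fx & fy & fxx & fxy & fyy & f1 & f2 & f3 & f4).
  destruct hg as (gx & gy & gxx & gxy & gyy & g1 & g2 & g3 & g4).
  exists (fun z => c * fx z + d * gx z), (fun z => c * fy z + d * gy z),
    (fun z => c * fxx z + d * gxx z), (fun z => c * fxy z + d * gxy z),
    (fun z => c * fyy z + d * gyy z).
  split; [now apply C1_data_combine |]. split; [now apply C1_data_combine |].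
  split; [now apply C1_data_combine |].
  intros z hz. specialize (f4 z hz). specialize (g4 z hz).
  transitivity (c * (- a ^ 2 * f z + a * (fst z * fx z + snd z * fy z)
    + (1 - normsq z) * ((fxx z + fyy z) / 4))
    + d * (- a ^ 2 * g z + a * (fst z * gx z + snd z * gy z)
    + (1 - normsq z) * ((gxx z + gyy z) / 4))); [field | rewrite f4, g4; ring].
Qed.

(** Harmonicity is encoded by taking [- Pxx] as the second derivative in [y]; the last clause is
    Euler's relation for degree [m]. *)
Definition harmonic_homogeneous (m : R) (P Px Py Pxx Pxy : C -> R) : Prop :=
  forall z,
    (is_dx P Px z /\ is_dy P Py z /\ is_dx Px Pxx z /\ is_dy Px Pxy z /\
     is_dx Py Pxy z /\ is_dy Py (fun w => - Pxx w) z) /\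
    (ctsC P z /\ ctsC Px z /\ ctsC Py z /\ ctsC Pxx z /\ ctsC Pxy z) /\
    fst z * Px z + snd z * Py z = m * P z.

Lemma continuous_zpow (n : nat) (z : C) :
  ctsC (fun w => fst (zpow n w)) z /\ ctsC (fun w => snd (zpow n w)) z.
Proof.
  induction n as [| n [IH1 IH2]].
  - split; apply ctsC_const.
  - assert (c1 := continuous_fst_C z). assert (c2 := continuous_snd_C z). split.
    + apply (ctsC_minus (fun w => fst w * fst (zpow n w)) (fun w => snd w * snd (zpow n w)));
        now apply ctsC_mult.
    + apply (ctsC_plus (fun w => fst w * snd (zpow n w)) (fun w => snd w * fst (zpow n w)));
        now apply ctsC_mult.
Qed.

(** The factor [INR n] makes the relation hold also at [n = 0], where [pred n] is 0. *)
Lemma zpow_S_pred (n : nat) (z : C) :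
  INR n * (fst z * fst (zpow (pred n) z) - snd z * snd (zpow (pred n) z))
    = INR n * fst (zpow n z) /\
  INR n * (fst z * snd (zpow (pred n) z) + snd z * fst (zpow (pred n) z))
    = INR n * snd (zpow n z).
Proof. destruct n; [simpl; split; ring | now split]. Qed.

Lemma is_derive_zpow (n : nat) (z : C) :
  is_dx (fun w => fst (zpow n w)) (fun w => INR n * fst (zpow (pred n) w)) z /\
  is_dy (fun w => fst (zpow n w)) (fun w => - INR n * snd (zpow (pred n) w)) z /\
  is_dx (fun w => snd (zpow n w)) (fun w => INR n * snd (zpow (pred n) w)) z /\
  is_dy (fun w => snd (zpow n w)) (fun w => INR n * fst (zpow (pred n) w)) z.
Proof.
  induction n as [| n (h1 & h2 & h3 & h4)].
  - destruct (is_d_const 1 z) as [d1 d2]. destruct (is_d_const 0 z) as [d3 d4].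
    split; [| split; [| split]]; (eapply is_dx_eq || eapply is_dy_eq);
      try eassumption; simpl; ring.
  - destruct (zpow_S_pred n z) as [e1 e2].
    assert (d1 : is_dx (fun w => fst w) (fun _ => 1) z)
      by (unfold is_dx, is_dy; cbn [fst snd]; auto_derive; easy).
    assert (d2 : is_dy (fun w => fst w) (fun _ => 0) z)
      by (unfold is_dx, is_dy; cbn [fst snd]; auto_derive; easy).
    assert (d3 : is_dx (fun w => snd w) (fun _ => 0) z)
      by (unfold is_dx, is_dy; cbn [fst snd]; auto_derive; easy).
    assert (d4 : is_dy (fun w => snd w) (fun _ => 1) z)
      by (unfold is_dx, is_dy; cbn [fst snd]; auto_derive; easy).
    cbn [zpow fst snd pred]. rewrite S_INR. split; [| split; [| split]].
    + refine (is_dx_eq _ _ _ _ (is_dx_minus _ _ _ _ _ (is_dx_mult _ _ _ _ _ d1 h1)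
               (is_dx_mult _ _ _ _ _ d3 h3)) _).
      cbv beta. lra.
    + refine (is_dy_eq _ _ _ _ (is_dy_minus _ _ _ _ _ (is_dy_mult _ _ _ _ _ d2 h2)
               (is_dy_mult _ _ _ _ _ d4 h4)) _).
      cbv beta. lra.
    + refine (is_dx_eq _ _ _ _ (is_dx_plus _ _ _ _ _ (is_dx_mult _ _ _ _ _ d1 h3)
               (is_dx_mult _ _ _ _ _ d3 h1)) _).
      cbv beta. lra.
    + refine (is_dy_eq _ _ _ _ (is_dy_plus _ _ _ _ _ (is_dy_mult _ _ _ _ _ d2 h4)
               (is_dy_mult _ _ _ _ _ d4 h2)) _).
      cbv beta. lra.
Qed.

Lemma harmonic_re_zpow (n : nat) :
  harmonic_homogeneous (INR n) (fun w => fst (zpow n w))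
    (fun w => INR n * fst (zpow (pred n) w))
    (fun w => - INR n * snd (zpow (pred n) w))
    (fun w => INR n * (INR (pred n) * fst (zpow (pred (pred n)) w)))
    (fun w => - INR n * (INR (pred n) * snd (zpow (pred (pred n)) w))).
Proof.
  intros z. destruct (is_derive_zpow n z) as (h1 & h2 & _ & _).
  destruct (is_derive_zpow (pred n) z) as (k1 & k2 & k3 & k4).
  destruct (continuous_zpow n z) as (c1 & _).
  destruct (continuous_zpow (pred n) z) as (d1 & d2).
  destruct (continuous_zpow (pred (pred n)) z) as (e1 & e2).
  split; [| split].
  - split; [exact h1 |].
    split; [exact h2 |].
    split; [exact (is_derive_scal _ _ (INR n) _ k1) |].
    split; [refine (is_dy_eq _ _ _ _ (is_dy_scal (INR n) _ _ _ k2) _); cbv beta; ring |].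
    split; [exact (is_derive_scal _ _ (- INR n) _ k3) |].
    refine (is_dy_eq _ _ _ _ (is_dy_scal (- INR n) _ _ _ k4) _). cbv beta. ring.
  - split; [| split; [| split; [| split]]]; solve_ctsC.
  - destruct (zpow_S_pred n z) as [e _]. rewrite <- e. ring.
Qed.

Lemma harmonic_im_zpow (n : nat) :
  harmonic_homogeneous (INR n) (fun w => snd (zpow n w))
    (fun w => INR n * snd (zpow (pred n) w))
    (fun w => INR n * fst (zpow (pred n) w))
    (fun w => INR n * (INR (pred n) * snd (zpow (pred (pred n)) w)))
    (fun w => INR n * (INR (pred n) * fst (zpow (pred (pred n)) w))).
Proof.
  intros z. destruct (is_derive_zpow n z) as (_ & _ & h1 & h2).
  destruct (is_derive_zpow (pred n) z) as (k1 & k2 & k3 & k4).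
  destruct (continuous_zpow n z) as (_ & c1).
  destruct (continuous_zpow (pred n) z) as (d1 & d2).
  destruct (continuous_zpow (pred (pred n)) z) as (e1 & e2).
  split; [| split].
  - split; [exact h1 |]. split; [exact h2 |].
    split; [exact (is_derive_scal _ _ (INR n) _ k3) |].
    split; [exact (is_derive_scal _ _ (INR n) _ k4) |].
    split; [exact (is_derive_scal _ _ (INR n) _ k1) |].
    refine (is_dy_eq _ _ _ _ (is_dy_scal (INR n) _ _ _ k2) _). cbv beta. ring.
  - split; [| split; [| split; [| split]]]; solve_ctsC.
  - destruct (zpow_S_pred n z) as [_ e]. rewrite <- e. ring.
Qed.

Lemma is_dx_normsq_comp (f f' : R -> R) (z : C) (h : is_derive f (normsq z) (f' (normsq z))) :
  is_dx (fun w => f (normsq w)) (fun w => 2 * fst w * f' (normsq w)) z.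
Proof.
  unfold is_dx. apply (is_derive_comp f (fun t => normsq (t, snd z))).
  - rewrite <- surjective_pairing. exact h.
  - unfold normsq. cbn [fst snd]. auto_derive; [easy | ring].
Qed.

Lemma is_dy_normsq_comp (f f' : R -> R) (z : C) (h : is_derive f (normsq z) (f' (normsq z))) :
  is_dy (fun w => f (normsq w)) (fun w => 2 * snd w * f' (normsq w)) z.
Proof.
  unfold is_dy. apply (is_derive_comp f (fun t => normsq (fst z, t))).
  - rewrite <- surjective_pairing. exact h.
  - unfold normsq. cbn [fst snd]. auto_derive; [easy | ring].
Qed.

(** Shaped for second derivatives: the first derivatives of [f0(|z|^2) P] have this form with [l]
    equal to [2 x] or [2 y] and [Q] a derivative of [P]. *)
Lemma is_dx_radial (l lx P Px Q Qx : C -> R) (f0 f1 f2 : R -> R) (z : C)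
  (h0 : is_derive f0 (normsq z) (f1 (normsq z))) (h1 : is_derive f1 (normsq z) (f2 (normsq z)))
  (hl : is_dx l lx z) (hP : is_dx P Px z) (hQ : is_dx Q Qx z) :
  is_dx (fun w => l w * f1 (normsq w) * P w + f0 (normsq w) * Q w)
    (fun w => (lx w * f1 (normsq w) + l w * (2 * fst w * f2 (normsq w))) * P w
       + l w * f1 (normsq w) * Px w
       + (2 * fst w * f1 (normsq w) * Q w + f0 (normsq w) * Qx w)) z.
Proof.
  exact (is_dx_plus _ _ _ _ _
    (is_dx_mult _ _ _ _ _ (is_dx_mult _ _ _ _ _ hl (is_dx_normsq_comp f1 f2 z h1)) hP)
    (is_dx_mult _ _ _ _ _ (is_dx_normsq_comp f0 f1 z h0) hQ)).
Qed.

Lemma is_dy_radial (l ly P Py Q Qy : C -> R) (f0 f1 f2 : R -> R) (z : C)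
  (h0 : is_derive f0 (normsq z) (f1 (normsq z))) (h1 : is_derive f1 (normsq z) (f2 (normsq z)))
  (hl : is_dy l ly z) (hP : is_dy P Py z) (hQ : is_dy Q Qy z) :
  is_dy (fun w => l w * f1 (normsq w) * P w + f0 (normsq w) * Q w)
    (fun w => (ly w * f1 (normsq w) + l w * (2 * snd w * f2 (normsq w))) * P w
       + l w * f1 (normsq w) * Py w
       + (2 * snd w * f1 (normsq w) * Q w + f0 (normsq w) * Qy w)) z.
Proof.
  exact (is_dy_plus _ _ _ _ _
    (is_dy_mult _ _ _ _ _ (is_dy_mult _ _ _ _ _ hl (is_dy_normsq_comp f1 f2 z h1)) hP)
    (is_dy_mult _ _ _ _ _ (is_dy_normsq_comp f0 f1 z h0) hQ)).
Qed.

(** With [t = |z|^2], a quarter of the Laplacian of [F(t) P] is [(t F'' + (j + 1) F') P], and the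
    Euler operator gives [(2 t F' + j F) P]. The equation becomes the hypergeometric equation with
    parameters [- a], [j - a], [j + 1]. *)
Lemma radial_harmonic_solution (a : R) (j : nat) (ha : 0 < a <= 1) (hj : (1 <= j)%nat)
  (P Px Py Pxx Pxy : C -> R) (hP : harmonic_homogeneous (INR j) P Px Py Pxx Pxy) :
  C2_solution a (fun z => Fser a j (normsq z) * P z).
Proof.
  set (S0 := PSeries (fcoeff a j)). set (S1 := PSeries (PS_derive (fcoeff a j))).
  set (S2 := PSeries (PS_derive (PS_derive (fcoeff a j)))).
  assert (hr := fcoeff_radius a j ha hj).
  assert (hr1 : Rbar_le 1 (CV_radius (PS_derive (fcoeff a j))))
    by now rewrite CV_radius_derive.
  assert (hr2 : Rbar_le 1 (CV_radius (PS_derive (PS_derive (fcoeff a j)))))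
    by now rewrite !CV_radius_derive.
  assert (hin : forall z, unit_disk z -> Rabs (normsq z) < 1).
  { intros z hz. apply unit_disk_normsq in hz. assert (h := normsq_pos z).
    now apply Rabs_lt_1. }
  assert (d0 : forall z, unit_disk z -> is_derive S0 (normsq z) (S1 (normsq z)))
    by (intros; apply is_derive_PSeries, inside_radius_1; [easy | now apply hin]).
  assert (d1 : forall z, unit_disk z -> is_derive S1 (normsq z) (S2 (normsq z)))
    by (intros; apply is_derive_PSeries, inside_radius_1; [easy | now apply hin]).
  assert (cS : forall u z, Rbar_le 1 (CV_radius u) -> unit_disk z ->
            ctsC (fun w => PSeries u (normsq w)) z).
  { intros u z hu hz. apply (continuous_comp normsq (PSeries u)); [apply ctsC_normsq |].
    apply continuity_pt_filterlim, PSeries_continuity, inside_radius_1; [easy | now apply hin]. }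
  set (hx := fun w : C => 2 * fst w * S1 (normsq w) * P w + S0 (normsq w) * Px w).
  set (hy := fun w : C => 2 * snd w * S1 (normsq w) * P w + S0 (normsq w) * Py w).
  set (hxx := fun w : C =>
    2 * S1 (normsq w) * P w + 2 * fst w * (2 * fst w * S2 (normsq w)) * P w
    + 2 * (2 * fst w * S1 (normsq w)) * Px w + S0 (normsq w) * Pxx w).
  set (hxy := fun w : C =>
    2 * fst w * (2 * snd w * S2 (normsq w)) * P w + 2 * fst w * S1 (normsq w) * Py w
    + 2 * snd w * S1 (normsq w) * Px w + S0 (normsq w) * Pxy w).
  set (hyy := fun w : C =>
    2 * S1 (normsq w) * P w + 2 * snd w * (2 * snd w * S2 (normsq w)) * P w
    + 2 * (2 * snd w * S1 (normsq w)) * Py w - S0 (normsq w) * Pxx w).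
  exists hx, hy, hxx, hxy, hyy.
  assert (cts : forall z, unit_disk z ->
            ctsC hx z /\ ctsC hy z /\ ctsC hxx z /\ ctsC hxy z /\ ctsC hyy z).
  { intros z hz. destruct (hP z) as (_ & (p0 & p1 & p2 & p3 & p4) & _).
    assert (q0 : ctsC (fun w => S0 (normsq w)) z) by now apply cS.
    assert (q1 : ctsC (fun w => S1 (normsq w)) z) by now apply cS.
    assert (q2 : ctsC (fun w => S2 (normsq w)) z) by now apply cS.
    assert (c1 := continuous_fst_C z). assert (c2 := continuous_snd_C z).
    unfold hx, hy, hxx, hxy, hyy.
    split; [| split; [| split; [| split]]]; solve_ctsC. }
  assert (hP' := fun z => proj1 (hP z)).
  split; [| split; [| split]];
    try (intros z hz; destruct (cts z hz) as (k1 & k2 & k3 & k4 & k5);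
         destruct (hP' z) as (l1 & l2 & l3 & l4 & l5 & l6);
         split; [| split; [| split]]; try assumption).
  - apply is_dx_mult; [apply (is_dx_normsq_comp S0 S1); now apply d0 | assumption].
  - apply is_dy_mult; [apply (is_dy_normsq_comp S0 S1); now apply d0 | assumption].
  - refine (is_dx_eq _ _ _ _ (is_dx_radial _ _ _ _ _ _ S0 S1 S2 z (d0 z hz) (d1 z hz)
      (proj1 (is_d_fst 2 z)) l1 l3) _). unfold hxx. cbv beta. ring.
  - refine (is_dy_eq _ _ _ _ (is_dy_radial _ _ _ _ _ _ S0 S1 S2 z (d0 z hz) (d1 z hz)
      (proj2 (is_d_fst 2 z)) l2 l4) _). unfold hxy. cbv beta. ring.
  - refine (is_dx_eq _ _ _ _ (is_dx_radial _ _ _ _ _ _ S0 S1 S2 z (d0 z hz) (d1 z hz)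
      (proj1 (is_d_snd 2 z)) l1 l5) _). unfold hxy. cbv beta. ring.
  - refine (is_dy_eq _ _ _ _ (is_dy_radial _ _ _ _ _ _ S0 S1 S2 z (d0 z hz) (d1 z hz)
      (proj2 (is_d_snd 2 z)) l2 l6) _). unfold hyy. cbv beta. ring.
  - intros z hz. destruct (hP z) as (_ & _ & eu).
    assert (hj1 := INR_ge_1 j hj).
    assert (ode := hyp_ode (- a) (INR j - a) (INR j + 1) ltac:(lra) (normsq z) (hin z hz) hr).
    cbv zeta in ode. fold (fcoeff a j) in ode. fold S0 S1 S2 in ode.
    unfold hx, hy, hxx, hyy. change (Fser a j) with S0.
    set (t := normsq z) in *.
    transitivity (P z * (t * (1 - t) * S2 t
        + (INR j + 1 - (- a + (INR j - a) + 1) * t) * S1 t - - a * (INR j - a) * S0 t)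
      + (a * S0 t + (1 - t) * S1 t) * (fst z * Px z + snd z * Py z - INR j * P z)
      + (a * 2 * S1 t * P z + (1 - t) * S2 t * P z) * (fst z ^ 2 + snd z ^ 2 - t)).
    + field.
    + rewrite ode, eu. change (fst z ^ 2 + snd z ^ 2) with t. ring.
Qed.

(** The coefficients of [T_op] become real in Cartesian form, as [z d/dz + conj(z) d/d(conj z)] is
    [x d/dx + y d/dy]. So the two components decouple, and a common power of [1 - |z|^2] factors
    out. *)
Lemma real_kernel_harmonic_of_solutions (alpha : R) (u : C -> C)
  (f g : C -> R) (hf : C2_solution (alpha / 2) f) (hg : C2_solution (alpha / 2) g)
  (hu : forall z, unit_disk z -> u z = (f z, g z)) : real_kernel_harmonic alpha u.
Proof.
  destruct hf as (fx & fy & fxx & fxy & fyy & f1 & f2 & f3 & f4).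
  destruct hg as (gx & gy & gxx & gxy & gyy & g1 & g2 & g3 & g4).
  destruct (C1_on_of_data (fun z => Re (u z)) f fx fy f1) as (a1 & a2 & a3).
  { intros w hw. now rewrite hu. }
  destruct (C1_on_of_data (fun z => Im (u z)) g gx gy g1) as (b1 & b2 & b3).
  { intros w hw. now rewrite hu. }
  split.
  - split; (split; [assumption |]); split.
    + now apply (C1_on_of_data _ fx fxx fxy).
    + now apply (C1_on_of_data _ fy fxy fyy).
    + now apply (C1_on_of_data _ gx gxx gxy).
    + now apply (C1_on_of_data _ gy gxy gyy).
  - intros z hz.
    assert (ex : forall w, unit_disk w -> CDx u w = (fx w, gx w)).
    { intros w hw. unfold CDx. now rewrite a2, b2. }
    assert (ey : forall w, unit_disk w -> CDy u w = (fy w, gy w)).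
    { intros w hw. unfold CDy. now rewrite a3, b3. }
    assert (eb : forall w, unit_disk w ->
      dzbar u w = (1 / 2 * fx w + - (1 / 2) * gy w, 1 / 2 * gx w + 1 / 2 * fy w)).
    { intros w hw. unfold dzbar. rewrite ex, ey by easy. unfold Cmult, Cplus, Ci, RtoC.
      simpl. f_equal; field. }
    assert (ea : dz u z = (1 / 2 * fx z + 1 / 2 * gy z, 1 / 2 * gx z + - (1 / 2) * fy z)).
    { unfold dz. rewrite ex, ey by easy. unfold Cmult, Cplus, Cminus, Copp, Ci, RtoC.
      simpl. f_equal; field. }
    destruct (C1_on_of_data (fun w => Re (dzbar u w)) _ _ _
                (C1_data_combine (1 / 2) (- (1 / 2)) _ _ _ _ _ _ f2 g3)) as (_ & p1 & p2).
    { intros w hw. now rewrite eb. }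
    destruct (C1_on_of_data (fun w => Im (dzbar u w)) _ _ _
                (C1_data_combine (1 / 2) (1 / 2) _ _ _ _ _ _ g2 f3)) as (_ & q1 & q2).
    { intros w hw. now rewrite eb. }
    assert (el : dz (dzbar u) z = ((fxx z + fyy z) / 4, (gxx z + gyy z) / 4)).
    { unfold dz, CDx, CDy. rewrite p1, p2, q1, q2 by easy.
      unfold Cmult, Cplus, Cminus, Copp, Ci, RtoC. simpl. f_equal; field. }
    specialize (f4 z hz). specialize (g4 z hz).
    assert (hz' := hz). apply unit_disk_normsq in hz'.
    unfold T_op. rewrite el, ea, (eb z hz), (hu z hz), Cmod_sq.
    set (rho := 1 - normsq z) in *.
    assert (hrho : 0 < rho) by (unfold rho; lra).
    replace (Rpower rho (- alpha)) with (Rpower rho (- alpha - 1) * rho).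
    + set (k := Rpower rho (- alpha - 1)).
      destruct z as [x y]. unfold Cmult, Cplus, Cconj, RtoC. cbn [fst snd] in *.
      apply injective_projections; cbn [fst snd].
      * transitivity (k * (- (alpha / 2) ^ 2 * f (x, y)
          + alpha / 2 * (x * fx (x, y) + y * fy (x, y))
          + rho * ((fxx (x, y) + fyy (x, y)) / 4))); [field | rewrite f4; ring].
      * transitivity (k * (- (alpha / 2) ^ 2 * g (x, y)
          + alpha / 2 * (x * gx (x, y) + y * gy (x, y))
          + rho * ((gxx (x, y) + gyy (x, y)) / 4))); [field | rewrite g4; ring].
    + rewrite <- (Rpower_1 rho) at 2 by easy. rewrite <- Rpower_plus. f_equal. ring.
Qed.

(** * Proof of the proposition *)

(** By [Fser_ratio], [M_bound] is [F_1(1) / (k^2 F_k(1))]. *)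
Lemma convexity_bound (a c : R) (k : nat) (ha : 0 < a <= 1) (hk : (1 <= k)%nat)
  (hM : Rabs c < M_bound (2 * a) k) :
  INR k ^ 2 * Rabs (c * Fser a k 1) < Fser a 1 1.
Proof.
  assert (hk1 := INR_ge_1 k hk). unfold M_bound in hM.
  replace (2 * a / 2) with a in hM by field.
  assert (hA := Fser_1_pos a 1 ha (le_n 1)). assert (hB := Fser_1_pos a k ha hk).
  assert (hq := Fser_ratio a k ha hk).
  assert (g1 := Gamma_pos (INR k + 1) ltac:(lra)).
  assert (g2 := Gamma_pos (2 + a) ltac:(lra)).
  assert (g3 := Gamma_pos (INR k + 1 + a) ltac:(lra)).
  assert (hk2 : 0 < INR k ^ 2) by (apply pow_lt; lra).
  replace (Gamma (INR k + 1 + a) / (INR k ^ 2 * Gamma (INR k + 1) * Gamma (2 + a)))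
    with (Fser a 1 1 / (INR k ^ 2 * Fser a k 1)) in hM.
  - rewrite Rabs_mult, (Rabs_pos_eq (Fser a k 1)) by lra.
    assert (hp : 0 < INR k ^ 2 * Fser a k 1) by now apply Rmult_lt_0_compat.
    apply Rmult_lt_compat_r with (r := INR k ^ 2 * Fser a k 1) in hM; [| easy].
    replace (Fser a 1 1 / (INR k ^ 2 * Fser a k 1) * (INR k ^ 2 * Fser a k 1))
      with (Fser a 1 1) in hM by (field; lra).
    lra.
  - replace (Fser a k 1) with (Fser a 1 1 * (Fser a k 1 / Fser a 1 1)) by (field; lra).
    rewrite hq. field. repeat split; lra.
Qed.

(** With [A = F_1(1)], [g = F_k(1)], [N_bound] is [a A / ((k - a) g + k A)]. As [g <= A], the
    denominator exceeds [Lam = k g (3 - a)/2] by at least [(k (1 + a)/2 - a) g], nonnegative for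
    [k >= 1 >= a]. *)
Lemma monotonicity_bound (a c : R) (k : nat) (ha : 0 < a <= 1) (hk : (1 <= k)%nat)
  (hN : Rabs c < N_bound (2 * a) k) : 0 < mono_const a c k.
Proof.
  assert (hk1 := INR_ge_1 k hk). unfold N_bound in hN.
  replace (2 * a / 2) with a in hN by field.
  assert (hA := Fser_1_pos a 1 ha (le_n 1)). assert (hB := Fser_1_pos a k ha hk).
  assert (hBA := Fser_1_antitone a k ha hk).
  assert (hq := Fser_ratio a k ha hk).
  replace ((INR k - a) * Gamma (INR k + 1) * Gamma (2 + a) / Gamma (INR k + 1 + a))
    with ((INR k - a) * (Fser a k 1 / Fser a 1 1)) in hN
    by (rewrite hq; unfold Rdiv; ring).
  unfold mono_const, Lam. set (A := Fser a 1 1) in *. set (g1 := Fser a k 1) in *.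
  assert (hD : 0 < (INR k - a) * g1 + INR k * A).
  { assert (0 <= (INR k - a) * g1) by (apply Rmult_le_pos; lra).
    assert (0 < INR k * A) by (apply Rmult_lt_0_compat; lra). lra. }
  replace (2 * a / (2 * ((INR k - a) * (g1 / A) + INR k)))
    with (a * A / ((INR k - a) * g1 + INR k * A)) in hN.
  2:{ replace ((INR k - a) * (g1 / A) + INR k)
        with (((INR k - a) * g1 + INR k * A) / A) by (field; lra). field. lra. }
  apply Rmult_lt_compat_r with (r := (INR k - a) * g1 + INR k * A) in hN; [| easy].
  replace (a * A / ((INR k - a) * g1 + INR k * A) * ((INR k - a) * g1 + INR k * A))
    with (a * A) in hN by (field; lra).
  assert (hL : INR k * g1 * ((3 - a) / 2) <= (INR k - a) * g1 + INR k * A).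
  { assert (INR k * g1 <= INR k * A) by (apply Rmult_le_compat_l; lra).
    assert (0 <= (INR k * (1 + a) / 2 - a) * g1) by (apply Rmult_le_pos; nra). lra. }
  assert (h := Rmult_le_compat_l (Rabs c) _ _ (Rabs_pos c) hL). lra.
Qed.

Lemma poisson_kernel_polar (alpha r theta tau : R) (hr : 0 <= r < 1) :
  poisson_kernel alpha (Cmult (polar r theta) (cis (- tau)))
  = Gamma (alpha / 2 + 1) ^ 2 / Gamma (1 + alpha) * Rpower (1 - r ^ 2) (alpha + 1)
    * / Rpower (1 - 2 * r * cos (theta - tau) + r ^ 2) (alpha / 2 + 1).
Proof.
  assert (e : Cmult (polar r theta) (cis (- tau)) = polar r (theta - tau)).
  { unfold polar, cis, Cmult. cbn [fst snd].
    rewrite cos_minus, sin_minus, cos_neg, sin_neg. f_equal; ring. }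
  rewrite e. unfold poisson_kernel. rewrite Cmod_sq, normsq_polar.
  assert (hD := modulus_pos (theta - tau) r hr).
  set (D := 1 - 2 * r * cos (theta - tau) + r ^ 2) in *.
  assert (em : Cmod (RtoC 1 - polar r (theta - tau))%C = Rpower D (/ 2)).
  { rewrite Rpower_sqrt by easy. unfold Cmod. f_equal.
    unfold Cminus, Copp, Cplus, RtoC, polar. cbn [fst snd].
    transitivity (1 - 2 * r * cos (theta - tau)
      + r ^ 2 * (sin (theta - tau) ^ 2 + cos (theta - tau) ^ 2)); [ring |].
    rewrite sin_cos_sq. unfold D. ring. }
  rewrite em, Rpower_mult.
  replace (/ 2 * (alpha + 2)) with (alpha / 2 + 1) by field.
  unfold Rdiv. ring.
Qed.

(** Each coordinate of the data is a combination of [cos(tau - psi)] and [cos(k tau - psi)], whose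
    moments are known; [Fser_normalization] removes the constants. *)
Lemma poisson_integral_Vmap (alpha c : R) (k : nat) (ustar : C -> C) (z : C)
  (ha : 0 < alpha <= 2) (hk : (1 <= k)%nat)
  (hus : forall theta, ustar (cis theta)
           = gam (Fser (alpha / 2) 1 1) (c * Fser (alpha / 2) k 1) k theta)
  (hz : unit_disk z) :
  poisson_integral alpha ustar z = Vmap (alpha / 2) c k z.
Proof.
  set (a := alpha / 2) in *. assert (haa : 0 < a <= 1) by (unfold a; lra).
  apply unit_disk_normsq in hz.
  destruct (polar_form z) as (theta & _ & ez).
  assert (hr : 0 <= sqrt (normsq z) < 1).
  { split; [apply sqrt_pos |]. rewrite <- sqrt_1. apply sqrt_lt_1_alt.
    split; [apply normsq_pos | easy]. }
  set (r := sqrt (normsq z)) in *. rewrite ez. clear ez hz.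
  set (A := Fser a 1 1) in *. set (B := c * Fser a k 1) in *.
  set (D := fun tau => / Rpower (1 - 2 * r * cos (theta - tau) + r ^ 2) (a + 1)).
  set (q := Gamma (a + 1) ^ 2 / Gamma (1 + alpha) * Rpower (1 - r ^ 2) (alpha + 1)).
  assert (mom : forall j psi, (1 <= j)%nat ->
    is_RInt (fun tau => q * Fser a j 1 * (D tau * cos (INR j * tau - psi))) 0 (2 * PI)
      (2 * PI * (Fser a j (r ^ 2) * (r ^ j * cos (INR j * theta - psi))))).
  { intros j psi hj.
    assert (h := is_RInt_scal _ _ _ (q * Fser a j 1) _
                   (poisson_moment a r theta psi j haa hj hr)).
    apply (eq_ind _ (is_RInt _ 0 (2 * PI)) h).
    assert (hn := Fser_normalization a j haa hj).
    transitivity (q * Fser a j 1 * (2 * PI * cos (INR j * theta - psi) * r ^ j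
      * (binom_coeff (a + 1) j * (Fser a j (r ^ 2) / Rpower (1 - r ^ 2) (1 + 2 * a)))));
      [reflexivity |].
    unfold q.
    replace (alpha + 1) with (1 + 2 * a) by (unfold a; field).
    replace (1 + alpha) with (1 + 2 * a) by (unfold a; field).
    assert (hp : 0 < Rpower (1 - r ^ 2) (1 + 2 * a)) by apply exp_pos.
    assert (hg := Gamma_pos (1 + 2 * a) ltac:(lra)).
    transitivity (Gamma (a + 1) ^ 2 / Gamma (1 + 2 * a) * binom_coeff (a + 1) j
      * Fser a j 1 * (2 * PI * (Fser a j (r ^ 2) * (r ^ j * cos (INR j * theta - psi))))).
    - match goal with |- ?x = ?y => change (@eq R x y) end. field. lra.
    - now rewrite hn, Rmult_1_l. }
  assert (I : forall psi d, is_RInt (fun tau =>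
      q * Fser a 1 1 * (D tau * cos (INR 1 * tau - psi))
      + d * (q * Fser a k 1 * (D tau * cos (INR k * tau - psi)))) 0 (2 * PI)
    (2 * PI * (Fser a 1 (r ^ 2) * (r ^ 1 * cos (INR 1 * theta - psi)))
     + d * (2 * PI * (Fser a k (r ^ 2) * (r ^ k * cos (INR k * theta - psi)))))).
  { intros psi d. exact (is_RInt_plus _ _ _ _ _ _ (mom 1%nat psi (le_n 1))
      (is_RInt_scal _ _ _ d _ (mom k psi hk))). }
  assert (ker : forall tau, poisson_kernel alpha (Cmult (polar r theta) (cis (- tau)))
                            = q * D tau)
    by (intros; now apply poisson_kernel_polar).
  set (J := fun psi d =>
    2 * PI * (Fser a 1 (r ^ 2) * (r ^ 1 * cos (INR 1 * theta - psi)))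
    + d * (2 * PI * (Fser a k (r ^ 2) * (r ^ k * cos (INR k * theta - psi))))).
  unfold poisson_integral.
  (* The phase [PI / 2] turns cosines into sines; the sign of [c] flips because the second mode is
     [e^(-i k tau)]. *)
  rewrite (is_RInt_unique (V := C_R_CompleteNormedModule) _ _ _ (J 0 c, J (PI / 2) (- c))).
  - assert (hpi := PI_RGT_0). unfold Vmap, J. rewrite normsq_polar, zpow_polar.
    unfold polar, Cmult, RtoC. cbn [fst snd].
    rewrite !Rminus_0_r, !cos_minus, cos_PI2, sin_PI2. simpl INR. rewrite !Rmult_1_l.
    apply injective_projections; cbn [fst snd]; field; lra.
  - apply (is_RInt_fct_extend_pair (U := R_NormedModule) (V := R_NormedModule));
      [apply is_RInt_ext with (2 := I 0 c)
      | apply is_RInt_ext with (2 := I (PI / 2) (- c))]; intros tau _;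
      match goal with |- ?x = ?y => change (@eq R x y) end;
      rewrite ker, hus; unfold gam, A, B, Cmult, RtoC; cbn [fst snd];
      rewrite ?Rminus_0_r, ?cos_minus, ?cos_PI2, ?sin_PI2; simpl INR;
      rewrite !Rmult_1_l; ring.
Qed.

Lemma continuous_on_of_lipschitz (S : C -> Prop) (f : C -> C) (L : R) (hL : 0 <= L)
  (h : forall z w, S z -> S w -> dsq (f z) (f w) <= L * dsq z w) :
  continuous_on (T := C_UniformSpace) (U := C_UniformSpace) S f.
Proof.
  intros z hz P [e hP]. assert (he := cond_pos e).
  (* Balls are squares, so [dsq] is at most [2 d^2] for this radius [d], and [L * (2 d^2)] is below
     [(2 (L + 1) d)^2 = e^2]. *)
  assert (hd : 0 < e / (2 * (L + 1))) by (apply Rdiv_lt_0_compat; lra).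
  exists (mkposreal _ hd). intros w [h1 h2] hw. apply hP. apply ball_of_dsq.
  apply Rle_lt_trans with (1 := h w z hw hz).
  change (Rabs (fst w - fst z) < e / (2 * (L + 1))) in h1.
  change (Rabs (snd w - snd z) < e / (2 * (L + 1))) in h2.
  set (d := e / (2 * (L + 1))) in *.
  assert (sq : forall x : R, Rabs x < d -> x ^ 2 <= d ^ 2).
  { intros x hx. rewrite <- pow2_abs. apply pow_incr. split; [apply Rabs_pos | lra]. }
  assert (q1 := sq _ h1). assert (q2 := sq _ h2).
  assert (ed : e = 2 * (L + 1) * d :> R) by (unfold d; field; lra).
  assert (hd2 : 0 < d ^ 2) by (apply pow_lt; lra).
  assert (L * dsq w z <= L * (2 * d ^ 2))
    by (apply Rmult_le_compat_l; [easy | replace (2 * d ^ 2) with (d ^ 2 + d ^ 2) by ring;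
        exact (Rplus_le_compat _ _ _ _ q1 q2)]).
  rewrite ed. replace ((2 * (L + 1) * d) ^ 2) with (4 * (L + 1) ^ 2 * d ^ 2) by ring.
  assert (0 <= L * L * d ^ 2) by (apply Rmult_le_pos; [now apply Rmult_le_pos | lra]).
  assert (0 <= L * d ^ 2) by (apply Rmult_le_pos; lra). lra.
Qed.

Lemma unit_circle_normsq (z : C) : unit_circle z <-> normsq z = 1.
Proof.
  unfold unit_circle. rewrite <- Cmod_sq. assert (h := Cmod_ge_0 z). split; intros e.
  - rewrite e. ring.
  - assert (e' : (Cmod z - 1) * (Cmod z + 1) = 0) by lra.
    apply Rmult_integral in e'. lra.
Qed.

(** The inverse is obtained by choice; the lower bound makes preimages unique and the chosen inverse
    Lipschitz. *)
Lemma homeomorphism_of_bilipschitz (S T : C -> Prop) (f : C -> C) (L m : R)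
  (hL : 0 <= L) (hm : 0 < m)
  (hup : forall z w, S z -> S w -> dsq (f z) (f w) <= L * dsq z w)
  (hlow : forall z w, S z -> S w -> m * dsq z w <= dsq (f z) (f w))
  (hT : forall w, T w <-> exists z, S z /\ f z = w) : homeomorphism S T f.
Proof.
  set (g := fun w => epsilon (inhabits (RtoC 0)) (fun z => S z /\ f z = w)).
  assert (hg : forall w, T w -> S (g w) /\ f (g w) = w).
  { intros w hw. apply hT in hw. exact (epsilon_spec (inhabits (RtoC 0)) _ hw). }
  split; [now apply continuous_on_of_lipschitz with L |].
  split; [intros z hz; apply hT; now exists z |].
  exists g. split; [| split; [| split]].
  - apply continuous_on_of_lipschitz with (/ m).
    + now apply Rlt_le, Rinv_0_lt_compat.
    + intros w w' hw hw'. destruct (hg w hw) as [s1 e1]. destruct (hg w' hw') as [s2 e2].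
      assert (h := hlow _ _ s1 s2). rewrite e1, e2 in h.
      apply Rmult_le_reg_l with m; [easy |].
      rewrite <- Rmult_assoc, Rinv_r, Rmult_1_l by lra. exact h.
  - intros w hw. now apply hg.
  - intros z hz. destruct (hg (f z)) as [s1 e1]; [apply hT; now exists z |].
    apply dsq_eq0. assert (h := hlow _ _ s1 hz). rewrite e1 in h.
    apply Rmult_le_reg_l with m; [easy |]. apply Rle_trans with (1 := h).
    unfold dsq. lra.
  - intros w hw. now apply hg.
Qed.

Theorem proposition4p6
  (k : nat) (alpha c : R)
  (hk : (1 <= k)%nat) (halpha : 0 < alpha <= 2)
  (hc : - L_bound alpha k < c < L_bound alpha k)
  (ustar : C -> C)
  (hustar : forall theta : R,
     ustar (cis theta) =
     (RtoC (F_at_1 alpha 1) * cis theta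
      + RtoC (c * F_at_1 alpha k) * cis (- (INR k * theta)))%C)
  (u : C -> C)
  (hu : forall z : C, unit_disk z -> u z = poisson_integral alpha ustar z) :
  exists gamma Omega : C -> Prop,
    homeomorphism unit_circle gamma ustar /\
    convex_jordan_curve gamma /\
    bounded_convex_domain Omega /\
    (forall z : C, gamma z <-> boundary Omega z) /\
    real_kernel_harmonic alpha u /\
    injective_on unit_disk u /\
    maps_onto unit_disk Omega u.
Proof.
  set (a := alpha / 2). assert (ha : 0 < a <= 1) by (unfold a; lra).
  assert (ea : alpha = 2 * a) by (unfold a; field).
  rewrite !F_at_1_eq in hustar by (try easy; lia). fold a in hustar.
  assert (hcL : Rabs c < L_bound alpha k) by (apply Rabs_def1; lra).
  assert (hconv : INR k ^ 2 * Rabs (c * Fser a k 1) < Fser a 1 1).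
  { apply convexity_bound; try easy. rewrite <- ea.
    apply Rlt_le_trans with (1 := hcL), Rmin_l. }
  assert (hmono : 0 < mono_const a c k).
  { apply monotonicity_bound; try easy. rewrite <- ea.
    apply Rlt_le_trans with (1 := hcL), Rmin_r. }
  set (A := Fser a 1 1) in *. set (B := c * Fser a k 1) in *.
  assert (hus : forall theta, ustar (cis theta) = gam A B k theta).
  { intros theta. rewrite hustar. unfold gam, cis, Cmult, Cplus, RtoC. cbn [fst snd].
    rewrite cos_neg, sin_neg. f_equal; ring. }
  assert (hcis : forall theta, cis theta = polar 1 theta)
    by (intros; unfold cis, polar; f_equal; ring).
  assert (huV : forall z, unit_disk z -> u z = Vmap a c k z).
  { intros z hz. rewrite hu by easy. now apply poisson_integral_Vmap. }
  (* [u] and [ustar] are thus restrictions of the single map [Vmap], to the disk and to its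
     boundary. *)
  assert (husV : forall z, unit_circle z -> ustar z = Vmap a c k z).
  { intros z hz. apply unit_circle_normsq in hz. destruct (unit_polar z hz) as [t ->].
    rewrite <- hcis, hus, hcis. symmetry. now apply Vmap_circle. }
  assert (hle : forall z, unit_circle z -> normsq z <= 1)
    by (intros z hz; apply unit_circle_normsq in hz; lra).
  set (gamma := fun w : C => exists theta, w = gam A B k theta).
  assert (hgam : forall w, gamma w <-> exists z, unit_circle z /\ ustar z = w).
  { intros w. split.
    - intros [t ->]. exists (cis t). split; [| apply hus].
      apply unit_circle_normsq. rewrite hcis, normsq_polar. ring.
    - intros (z & hz & <-). apply unit_circle_normsq in hz.
      destruct (unit_polar z hz) as [t ->]. exists t. now rewrite <- hcis, hus. }
  assert (hhom : homeomorphism unit_circle gamma ustar).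
  { apply homeomorphism_of_bilipschitz with 4 (mono_const a c k ^ 2).
    - lra.
    - now apply pow_lt.
    - intros z w hz hw. rewrite !husV by easy. apply Vmap_lipschitz; try easy; now apply hle.
    - intros z w hz hw. rewrite !husV by easy. apply Vmap_expanding; try easy; now apply hle.
    - exact hgam. }
  assert (honto : maps_onto unit_disk (Omega_set A B k) u).
  { intros w. split.
    - intros hw. destruct (Vmap_onto a c k ha hk hconv hmono w hw) as (z & hz & e).
      assert (hz' : unit_disk z) by now apply unit_disk_normsq.
      exists z. split; [easy |]. now rewrite huV.
    - intros (z & hz & <-). rewrite huV by easy. apply unit_disk_normsq in hz.
      now apply Vmap_into. }
  assert (hdom : bounded_convex_domain (Omega_set A B k)).
  { split; [now apply Omega_set_open |].
    split; [exists (0, 0); now apply Omega_set_0 |].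
    split; [apply Omega_set_convex |].
    (* Every point of the domain is a value of [Vmap], which fixes 0 and at most doubles
       distances. *)
    exists (sqrt 4). intros w hw.
    destruct (Vmap_onto a c k ha hk hconv hmono w hw) as (z & hz & <-).
    assert (h0 : normsq (0, 0) = 0) by (unfold normsq; simpl; ring).
    assert (h := Vmap_lipschitz a c k ha hk z (0, 0) hmono ltac:(lra) ltac:(lra)).
    assert (en : forall w, dsq w (0, 0) = normsq w)
      by (intros; unfold dsq, normsq; simpl; ring).
    rewrite Vmap_0, !en in h by easy.
    apply sqrt_le_1_alt. change (normsq (Vmap a c k z) <= 4). lra. }
  assert (hbd : forall z : C, gamma z <-> boundary (Omega_set A B k) z).
  { intros z. symmetry. now apply boundary_Omega_set. }
  exists gamma, (Omega_set A B k).
  split; [exact hhom |]. split.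
  { split; [now exists ustar | now exists (Omega_set A B k)]. }
  split; [exact hdom |]. split; [exact hbd |]. split; [| split; [| exact honto]].
  (* The coefficients [c] and [- c] for the two components come from the conjugate in
     [c F_k conj(z)^k]. *)
  - eapply real_kernel_harmonic_of_solutions.
    + exact (C2_solution_combine a 1 c _ _
        (radial_harmonic_solution a 1 ha (le_n 1) _ _ _ _ _ (harmonic_re_zpow 1))
        (radial_harmonic_solution a k ha hk _ _ _ _ _ (harmonic_re_zpow k))).
    + exact (C2_solution_combine a 1 (- c) _ _
        (radial_harmonic_solution a 1 ha (le_n 1) _ _ _ _ _ (harmonic_im_zpow 1))
        (radial_harmonic_solution a k ha hk _ _ _ _ _ (harmonic_im_zpow k))).
    + intros z hz. rewrite huV by easy. unfold Vmap. simpl (zpow 1 z). cbn [fst snd].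
      f_equal; ring.
  - intros z w hz hw e. rewrite !huV in e by easy.
    apply unit_disk_normsq in hz. apply unit_disk_normsq in hw.
    apply (Vmap_injective a c k ha hk hmono); [lra | lra | exact e].
Qed.
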